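(* Assume (A.1)–(A.8) and (P.1)–(P.8) (listed in the context), with the constant $\underline M$ in (P.5) satisfying $\underline M\ge1$. Let $(x_k)$ and $(\mu_k)$ be the primal and dual iterates generated by the ICGALP algorithm, $(x^\star,\mu^\star)$ a saddle point of the Lagrangian $\mathcal L$, and $\Gamma_k=\sum_{i=0}^k\gamma_i$. Then the following hold. (0) Feasibility: almost surely, $\lim_k\|Ax_k-b\|=0$; $\inf_{0\le i\le k}\|Ax_i-b\|=O(1/\sqrt{\Gamma_k})$; there is a subsequence $(x_{k_j})$ with $\|Ax_{k_j}-b\|\le1/\sqrt{\Gamma_{k_j}}$ for all $j$; and $\big\|A\big(\sum_{i=0}^k\gamma_ix_i/\Gamma_k\big)-b\big\|=O(1/\sqrt{\Gamma_k})$. (i) Convergence of the Lagrangian: $\lim_{k\to\infty}\mathcal L(x_k,\mu^\star)=\mathcal L(x^\star,\mu^\star)$ almost surely. (ii) Almost surely, every weak cluster point $\bar x$ of $(x_k)$ is a solution of the primal problem, and $(\mu_k)$ converges weakly to a solution $\bar\mu$ of the dual problem, i.e. $(\bar x,\bar\mu)$ is a saddle point of $\mathcal L$. (iii) Pointwise rate: $\inf_{0\le i\le k}\mathcal L(x_i,\mu^\star)-\mathcal L(x^\star,\mu^\star)=O(1/\Gamma_k)$ almost surely, and almost surely there is a subsequence $(x_{k_j})_j$ such that for all $j$, $\mathcal L(x_{k_j+1},\mu^\star)-\mathcal L(x^\star,\mu^\star)\le1/\Gamma_{k_j}$. (iv) Ergodic rate: with $\bar x_k=\sum_{i=0}^k\gamma_ix_{i+1}/\Gamma_k$,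 $\mathcal L(\bar x_k,\mu^\star)-\mathcal L(x^\star,\mu^\star)=O(1/\Gamma_k)$ almost surely. (v) If the primal problem admits a unique solution $x^\star$, then $(x_k,\mu_k)$ converges weakly, almost surely, to a saddle point $(x^\star,\mu^\star)$. Moreover, if $\Phi=f+g\circ T+h$ is uniformly convex on $\mathcal C$ with modulus of convexity $\psi:[0,+\infty[\to[0,\infty]$, then $(x_k)$ converges strongly, almost surely, to $x^\star$, at the ergodic rate $\psi(\|\bar x_k-x^\star\|)=O(1/\Gamma_k)$ almost surely, with $\bar x_k$ as in (iv).
   Context: **Setting.** $\mathcal H_p,\mathcal H_d,\mathcal H_v$ are real Hilbert spaces (possibly infinite-dimensional); $A:\mathcal H_p\to\mathcal H_d$ and $T:\mathcal H_p\to\mathcal H_v$ are bounded linear operators; $b\in\operatorname{ran}(A)$; $f,h$ (on $\mathcal H_p$) and $g$ (on $\mathcal H_v$) are convex, closed (lower semicontinuous), proper functions. The primal problem is $\min_{x\in\mathcal H_p}\{f(x)+g(Tx)+h(x): Ax=b\}$; the dual problem is $\min_{\mu\in\mathcal H_d}(f+g\circ T+h)^*(-A^*\mu)+\langle\mu,b\rangle$ ($(\cdot)^*$ on functions is the Legendre–Fenchel conjugate). Put $\mathcal C=\operatorname{dom}(h)$. The Lagrangian is $\mathcal L(x,\mu)=f(x)+g(Tx)+h(x)+\langle\mu,Ax-b\rangle$. **Algorithm (ICGALP).** Let $(\Omega,\mathcal F,\mathbb P)$ be a probability space, $\lambda_k:\Omega\to\mathcal H_p$ and $\lambda_k^s:\Omega\to[0,+\infty[$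 random variables (the errors). Given $x_0\in\mathcal C$, $\mu_0\in\operatorname{ran}(A)$ and nonnegative real sequences $(\gamma_k),(\beta_k),(\theta_k),(\rho_k)$, iterate for $k=0,1,2,\dots$: - $y_k=\operatorname{prox}_{\beta_k g}(Tx_k)$, where $\operatorname{prox}_{\beta g}(v)=\operatorname{argmin}_w\{g(w)+\frac1{2\beta}\|v-w\|^2\}$; - $z_k=\nabla f(x_k)+T^*(Tx_k-y_k)/\beta_k+A^*\mu_k+\rho_kA^*(Ax_k-b)+\lambda_k$; - $s_k\in\operatorname{Argmin}_{s\in\mathcal H_p}\{h(s)+\langle z_k,s\rangle\}$; - $\widehat s_k\in\{s\in\mathcal H_p: h(s)+\langle z_k,s\rangle\le h(s_k)+\langle z_k,s_k\rangle+\lambda_k^s\}$; - $x_{k+1}=x_k-\gamma_k(x_k-\widehat s_k)$; - $\mu_{k+1}=\mu_k+\theta_k(Ax_{k+1}-b)$. Filtration: $\mathfrak S=(\mathcal S_k)_{k\in\mathbb N}$, $\mathcal S_k=\sigma(x_0,\mu_0,\widehat s_0,\dots,\widehat s_k)$ (so $x_{k+1},\mu_{k+1}$ are $\mathcal S_k$-measurable). $\ell^1_+$ is the set of nonnegative summable real sequences; $\ell^1_+(\mathfrak S)$ is the set of sequences $(a_k)$ of $[0,+\infty[$-valued random variables, $a_k$ being $\mathcal S_k$-measurable, with $\sum_k a_k<+\infty$ almost surely. **$(F,\zeta)$-smoothness.** Let $F:\mathcal H_p\to\mathbb R\cup\{+\infty\}$ and $\zeta:]0,1]\to[0,+\infty[$.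 The pair $(f,\mathcal C)$ with $\mathcal C\subset\operatorname{dom}(f)$ is $(F,\zeta)$-smooth if there is an open set $\mathcal C_0$ with $\mathcal C\subset\mathcal C_0\subset\operatorname{int}(\operatorname{dom}F)$ such that $F$ and $f$ are differentiable on $\mathcal C_0$, $F-f$ is convex on $\mathcal C_0$, and $$K_{(F,\zeta,\mathcal C)}=\sup\Big\{\tfrac{D_F(z,x)}{\zeta(\gamma)}: x,s\in\mathcal C,\ \gamma\in]0,1],\ z=x+\gamma(s-x)\Big\}<+\infty,$$ where $D_F(z,x)=F(z)-F(x)-\langle\nabla F(x),z-x\rangle$. **Assumptions on the functions.** - (A.1) $f$, $g\circ T$ and $h$ are proper, convex, lower semicontinuous on $\mathcal H_p$. - (A.2) $(f,\mathcal C)$ is $(F,\zeta)$-smooth. - (A.3) $\mathcal C$ is weakly compact (and thus contained in a ball of radius $R>0$). - (A.4) $T\mathcal C\subset\operatorname{dom}(\partial g)$ and $M=\sup_{x\in\mathcal C}\|[\partial g(Tx)]^0\|<\infty$, where $[\partial g(v)]^0$ is the minimal-norm element of $\partial g(v)$. - (A.5) $h$ is Lipschitz continuous relative to $\mathcal C$ with constant $L_h\ge0$: $|h(x)-h(z)|\le L_h\|x-z\|$ for all $x,z\in\mathcal C$. - (A.6) There exists a saddle point $(x^\star,\mu^\star)\in\mathcal H_p\times\mathcal H_d$ of $\mathcal L$. - (A.7) $\operatorname{ran}(A)$ is closed. - (A.8) One of the following holds: (a) $A^{-1}(b)\cap\operatorname{int}(\operatorname{dom}(g\circ T))\cap\operatorname{int}(\mathcal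 C)\ne\emptyset$, where $A^{-1}(b)$ is the preimage of $b$; or (b) $\mathcal H_p,\mathcal H_d$ are finite-dimensional, $A^{-1}(b)\cap\operatorname{ri}(\operatorname{dom}(g\circ T))\cap\operatorname{ri}(\mathcal C)\neq\emptyset$, and $\operatorname{ran}(A^* )\cap\big(\operatorname{LinHull}(\operatorname{dom}(g\circ T)\cap\mathcal C)\big)^\perp=\{0\}$ (LinHull is the linear hull, ri the relative interior). **Assumptions on parameters and errors.** - (P.1) $(\gamma_k)\subset]0,1]$ and $(\zeta(\gamma_k)),(\gamma_k^2/\beta_k),(\gamma_k\beta_k)\in\ell^1_+$. - (P.2) $(\gamma_k)\notin\ell^1$. - (P.3) $(\beta_k)$ is nonincreasing and converges to $0$. - (P.4) $(\rho_k)$ is nondecreasing with $0<\underline\rho\le\rho_k\le\overline\rho<+\infty$. - (P.5) There are constants $\underline M,\overline M>0$ with $\underline M\le\gamma_k/\gamma_{k+1}\le\overline M$ for all $k$. - (P.6) $\theta_k=\gamma_k/c$ for some $c>0$ with $\overline M/c-\underline\rho/2<0$. - (P.7) $\rho_{k+1}-\rho_k-\gamma_{k+1}\rho_{k+1}+\frac2c\gamma_k-\frac{\gamma_k^2}c\le\gamma_{k+1}$ for all $k$, with $c$ from (P.6). - (P.8) $(\gamma_{k+1}\mathbb E[\|\lambda_{k+1}\|\mid\mathcal S_k])_k\in\ell^1_+(\mathfrak S)$ and $(\gamma_{k+1}\mathbb E[\lambda^s_{k+1}\mid\mathcal S_k])_k\in\ell^1_+(\mathfrak S)$. *)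

(* Defs.v *)
From HB Require Import structures.
From mathcomp Require Import all_boot all_order all_algebra.
From mathcomp Require Import all_classical all_reals all_analysis.
Import Order.TTheory GRing.Theory Num.Theory.
Import numFieldNormedType.Exports.

Set Implicit Arguments.
Unset Strict Implicit.
Unset Printing Implicit Defensive.

Local Open Scope classical_set_scope.
Local Open Scope ring_scope.

(** Real Hilbert spaces: complete normed modules whose norm is induced by an
    inner product. *)
HB.mixin Record CompleteNormedModule_isHilbert (R : realType) V
    of CompleteNormedModule R V := {
  inner : V -> V -> R ;
  innerC : forall x y, inner x y = inner y x ;
  innerDl : forall x y z, inner (x + y) z = inner x z + inner y z ;
  innerZl : forall (a : R) x y, inner (a *: x) y = a * inner x y ;
  inner_norm : forall x, inner x x = `|x| ^+ 2 }.

#[short(type="hilbertType")]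
HB.structure Definition Hilbert (R : realType) :=
  {V of CompleteNormedModule_isHilbert R V & CompleteNormedModule R V}.

Section operators.
Context {R : realType}.
Implicit Types H K : hilbertType R.

Definition bounded_operator H K (A : H -> K) :=
  exists M : R, forall x, `|A x| <= M * `|x|.

(* For a bounded linear A, the Riesz representation theorem gives exactly one
   such vector; the default 0 is never used. *)
Definition adjoint H K (A : H -> K) (y : K) : H :=
  xget 0 [set v | forall x, inner v x = inner y (A x)].

Definition orthogonal_complement H (S : set H) : set H :=
  [set u | forall v, S v -> inner u v = 0].

Definition is_subspace H (V : set H) :=
  [/\ V 0, forall x y, V x -> V y -> V (x + y)
    & forall (a : R) x, V x -> V (a *: x)].

Definition linear_hull H (S : set H) : set H := smallest (@is_subspace H) S.

Definition is_affine H (V : set H) :=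
  forall (t : R) x y, V x -> V y -> V (t *: x + (1 - t) *: y).

Definition affine_hull H (S : set H) : set H := smallest (@is_affine H) S.

(* The interior of S relative to its affine hull. *)
Definition relative_interior H (S : set H) : set H :=
  [set x | S x /\ exists2 e : R, 0 < e & ball x e `&` affine_hull S `<=` S].

Definition finite_dimensional H :=
  exists (n : nat) (e : 'I_n -> H),
    forall x, exists a : 'I_n -> R, x = \sum_(i < n) a i *: e i.

(* The coarsest topology for which all the maps x |-> <x, u> are continuous. *)
Definition weak_space H : topologicalType :=
  initial_topology (fun x : H => inner x : prod_topology (fun _ : H => R)).

Definition weakly_compact H (S : set H) := compact (S : set (weak_space H)).

Definition weakly_converges H (u : nat -> H) (l : H) :=
  (u : nat -> weak_space H) @ \oo --> (l : weak_space H).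

Definition weak_cluster_point H (u : nat -> H) (l : H) :=
  cluster ((u : nat -> weak_space H) @ \oo) (l : weak_space H).

End operators.

Section convex_analysis.
Context {R : realType}.
Implicit Types H : hilbertType R.
Local Open Scope ereal_scope.

Definition dom H (phi : H -> \bar R) : set H := [set x | phi x < +oo].

Definition proper_fun H (phi : H -> \bar R) :=
  (forall x, phi x != -oo) /\ dom phi !=set0.

Definition convex_efun H (phi : H -> \bar R) :=
  forall x y (t : R), (0 < t < 1)%R ->
    phi (t *: x + (1 - t) *: y)%R <= t%:E * phi x + (1 - t)%:E * phi y.

Definition proper_convex_lsc H (phi : H -> \bar R) :=
  [/\ proper_fun phi, convex_efun phi & lower_semicontinuous phi].

Definition argmin H (phi : H -> \bar R) : set H :=
  [set x | forall y, phi x <= phi y].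

Definition prox H (beta : R) (g : H -> \bar R) (v : H) : H :=
  xget 0%R (argmin (fun w => g w + ((2 * beta)^-1 * `|v - w| ^+ 2)%:E)).

Definition subdifferential H (g : H -> \bar R) (v : H) : set H :=
  [set u | forall w, g v + (inner u (w - v)%R)%:E <= g w].

(* The element of minimal norm; it is unique when S is nonempty, closed and
   convex, as nonempty subdifferentials are. *)
Definition min_norm_element H (S : set H) : H :=
  xget 0%R [set u | S u /\ forall v, S v -> (`|u| <= `|v|)%R].

Definition conjugate H (phi : H -> \bar R) (u : H) : \bar R :=
  ereal_sup [set (inner u x)%:E - phi x | x in [set: H]].

(* Frechet differentiability of an extended-real-valued function: phi must be
   finite around x, so that [fine] does not turn infinite values into 0. *)
Definition ediff H (phi : H -> \bar R) (x : H) :=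
  (\forall y \near x, phi y \is a fin_num) /\
  differentiable (fun y => fine (phi y)) x.

Definition gradient H (phi : H -> \bar R) (x : H) : H :=
  xget 0%R [set v | forall u, inner v u = 'd (fun y => fine (phi y)) x u].

Definition bregman H (F : H -> \bar R) (z x : H) : R :=
  (fine (F z) - fine (F x) - inner (gradient F x) (z - x))%R.

(* No convexity is required of the set S: the inequality is asked at the
   points of the segment [x, y] that lie in S. *)
Definition convex_on H (S : set H) (phi : H -> R) :=
  forall x y (t : R), S x -> S y -> (0 < t < 1)%R ->
    S (t *: x + (1 - t) *: y)%R ->
    (phi (t *: x + (1 - t) *: y) <= t * phi x + (1 - t) * phi y)%R.

(* K_(F, zeta, C). The quotient is the one of \bar R, where the inverse of 0
   is +oo: zeta may vanish, and r / 0 is +oo for r > 0 (and 0 / 0 is 0). *)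
Definition smoothness_const H (F : H -> \bar R) (zeta : R -> R) (C : set H)
    : \bar R :=
  ereal_sup [set k | exists (x s : H) (r : R), [/\ C x, C s, (0 < r <= 1)%R &
    k = (bregman F (x + r *: (s - x))%R x)%:E / (zeta r)%:E]].

(* zeta is only used on ]0, 1]. *)
Definition Fzeta_smooth H (F : H -> \bar R) (zeta : R -> R)
    (f : H -> \bar R) (C : set H) :=
  [/\ forall x, F x != -oo,
      forall r, (0 < r <= 1)%R -> (0 <= zeta r)%R,
      C `<=` dom f,
      exists C0 : set H,
        [/\ open C0, C `<=` C0, C0 `<=` (dom F)°,
            forall x, C0 x -> ediff F x /\ ediff f x
          & convex_on C0 (fun x => fine (F x) - fine (f x))%R]
    & smoothness_const F zeta C < +oo].

Definition uniformly_convex_on H (C : set H) (phi : H -> \bar R)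
    (psi : R -> \bar R) :=
  [/\ forall t, (0 <= t)%R -> 0 <= psi t,
      forall t, (0 <= t)%R -> psi t = 0 <-> t = 0%R,
      forall t u, (0 <= t)%R -> (t <= u)%R -> psi t <= psi u
    & forall x y (t : R), C x -> C y -> (0 < t < 1)%R ->
        phi (t *: x + (1 - t) *: y)%R + (t * (1 - t))%:E * psi `|x - y|%R
          <= t%:E * phi x + (1 - t)%:E * phi y].

End convex_analysis.

Section problem.
Context {R : realType} {Hp Hd Hv : hilbertType R}.
Variables (A : Hp -> Hd) (T : Hp -> Hv) (b : Hd).
Variables (f h : Hp -> \bar R) (g : Hv -> \bar R).
Local Open Scope ereal_scope.

Definition objective (x : Hp) : \bar R := f x + g (T x) + h x.

Definition lagrangian (x : Hp) (mu : Hd) : \bar R :=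
  objective x + (inner mu (A x - b)%R)%:E.

Definition saddle_point (xs : Hp) (ms : Hd) :=
  (forall mu, lagrangian xs mu <= lagrangian xs ms) /\
  (forall x, lagrangian xs ms <= lagrangian x ms).

Definition primal_solution (x : Hp) :=
  A x = b /\ forall y, A y = b -> objective x <= objective y.

Definition dual_objective (mu : Hd) : \bar R :=
  conjugate objective (- adjoint A mu)%R + (inner mu b)%:E.

Definition dual_solution (mu : Hd) := argmin dual_objective mu.

(* The deterministic part of the iteration, along one realization. *)
Record icgalp_iteration (gamma beta theta rho : nat -> R)
    (lam : nat -> Hp) (lams : nat -> R)
    (x : nat -> Hp) (mu : nat -> Hd) (y : nat -> Hv) (z s shat : nat -> Hp)
    : Prop := {
  icgalp_x0 : dom h (x 0%N) ;
  icgalp_mu0 : range A (mu 0%N) ;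
  icgalp_y : forall k, y k = prox (beta k) g (T (x k)) ;
  icgalp_z : forall k, z k = (gradient f (x k)
    + (beta k)^-1 *: adjoint T (T (x k) - y k) + adjoint A (mu k)
    + rho k *: adjoint A (A (x k) - b) + lam k)%R ;
  icgalp_s : forall k, argmin (fun v => h v + (inner (z k) v)%:E) (s k) ;
  icgalp_shat : forall k, h (shat k) + (inner (z k) (shat k))%:E
    <= h (s k) + (inner (z k) (s k))%:E + (lams k)%:E ;
  icgalp_x : forall k, x k.+1 = (x k - gamma k *: (x k - shat k))%R ;
  icgalp_mu : forall k, mu k.+1 = (mu k + theta k *: (A (x k.+1) - b))%R }.

End problem.

Section sequences.
Context {R : realType}.

Definition ell1_plus (u : nat -> R) := (forall k, 0 <= u k) /\ cvgn (series u).

Definition ebigO (u : nat -> \bar R) (v : nat -> R) :=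
  exists K : R, \forall k \near \oo, (`|u k| <= (K * `|v k|)%:E)%E.

Definition psum (gamma : nat -> R) (k : nat) : R := \sum_(i < k.+1) gamma i.

Definition weighted_mean (H : hilbertType R) (gamma : nat -> R)
    (u : nat -> H) (k : nat) : H :=
  (psum gamma k)^-1 *: \sum_(i < k.+1) gamma i *: u i.

End sequences.

Section probability.
Context {R : realType} {d : measure_display} {Omega : measurableType d}.
Variable P : probability Omega R.
Implicit Types H : hilbertType R.

(* The sigma-algebra generated by X, for the Borel sigma-algebra of H. *)
Definition sigma_of H (X : Omega -> H) : set (set Omega) :=
  preimage_set_system [set: Omega] X <<s open >>.

Definition borel_random_variable H (X : Omega -> H) :=
  sigma_of X `<=` measurable.

Definition filtration (Hp Hd : hilbertType R) (x0 : Omega -> Hp)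
    (mu0 : Omega -> Hd) (shat : nat -> Omega -> Hp) (k : nat)
    : set (set Omega) :=
  <<s sigma_of x0 `|` sigma_of mu0 `|`
      \bigcup_(i in [set i | (i <= k)%N]) sigma_of (shat i) >>.

Definition measurable_wrt (G : set (set Omega)) (Y : Omega -> R) :=
  preimage_set_system [set: Omega] Y measurable `<=` G.

(* Y is a (finite) version of E[X | G], for X nonnegative; X need not be
   integrable. *)
Definition cond_expectation (G : set (set Omega)) (X Y : Omega -> R) :=
  [/\ measurable_wrt G Y, forall w, 0 <= Y w
    & forall B, G B ->
        (\int[P]_(w in B) (Y w)%:E = \int[P]_(w in B) (X w)%:E)%E].

Definition ell1_plus_filtered (S : nat -> set (set Omega))
    (a : nat -> Omega -> R) :=
  [/\ forall k w, 0 <= a k w, forall k, measurable_wrt (S k) (a k)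
    & {ae P, forall w, cvgn (series (a^~ w))}].

End probability.

(* Main.v *)
(** The noise enters only through the summability of gamma_k |lam_k| and
    gamma_k lams_k, which holds almost surely: stopping the partial sums of the
    conditional expectations at level N makes them bounded expectations. The rest is
    pathwise. Let E_k(u, m) be the augmented Lagrangian in which g is replaced
    by its Moreau envelope of parameter beta_k. One conditional-gradient step
    decreases E_k(., mu_k) up to a summable error that does not depend on
    mu_k. Hence the primal-dual gap E_k(x_(k+1), mu_k) - 2 min E_k(., mu_k) is
    quasi-decreasing, with gains that make gamma_k |A x_k - b|^2 summable; then
    E_k(x_(k+1), mu_k) + (c/2) |mu_k - m|^2 is quasi-decreasing for every
    optimal multiplier m, with gains proportional to gamma_k times the
    optimality gap of L(., m) at x_(k+1). Values follow from convexity of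
    L(., m), and the weak convergence of mu_k from Opial's argument. *)

Require Import Defs.
From HB Require Import structures.
From mathcomp Require Import all_boot all_order all_algebra.
From mathcomp Require Import all_classical all_reals all_analysis.
From mathcomp Require Import measurable_realfun ring lra.
Import Order.TTheory GRing.Theory Num.Theory.
Import numFieldNormedType.Exports.

Local Open Scope classical_set_scope.
Local Open Scope ring_scope.

Set Implicit Arguments.
Unset Strict Implicit.
Unset Printing Implicit Defensive.

(** * Real sequences *)

(** The obstacle is that nothing bounds mu_k a priori, so neither E_k(x_(k+1), mu_k) nor its minimum
    can be controlled alone. Passing from mu_k to mu_(k+1) adds theta_k |a|^2 to the first and, up
    to summable errors, at least theta_k <a, t> to the second, where a and t are the residuals of
    x_(k+1) and of a near minimizer. Subtracting the minimum twice completes a square: |a|^2 - 2 <a,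
    t> = |a - t|^2 - |t|^2. The term |a - t|^2 is paid for by the quadratic penalty, which provides
    gamma rho / 2 |a - t|^2 in the conditional-gradient step; this is where the condition
    [Mhi / c < rholo / 2] enters. The gap is bounded below whatever mu_k is, because the minimum is
    at most the value at [xstar], where the multiplier term vanishes. Its quasi-monotonicity bounds
    E_k(x_(k+1), mu_k) above, and the second Lyapunov function needs that bound to absorb the
    mismatch between gamma_k in the dual step and gamma_(k+1) in the primal one. *)

Definition bounded_sums {R : realType} (u : nat -> R) :=
  exists B : R, forall n, \sum_(0 <= k < n) u k <= B.

Section real_sequences.
Context {R : realType}.
Implicit Types u v w p e gamma : nat -> R.

Lemma bounded_sums_le u v : (forall k, u k <= v k) ->
  bounded_sums v -> bounded_sums u.
Proof.
by move=> uv [B vB]; exists B => n; apply: le_trans (vB n); exact: ler_sum.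
Qed.

Lemma bounded_sumsD u v : bounded_sums u -> bounded_sums v ->
  bounded_sums (fun k => u k + v k).
Proof.
move=> [B uB] [D vD]; exists (B + D) => n.
by rewrite big_split /= lerD.
Qed.

Lemma bounded_sumsZ (a : R) u : 0 <= a -> bounded_sums u ->
  bounded_sums (fun k => a * u k).
Proof.
move=> a0 [B uB]; exists (a * B) => n.
by rewrite -mulr_sumr ler_wpM2l.
Qed.

Lemma bounded_sums_shift u : 0 <= u 0%N -> bounded_sums u ->
  bounded_sums (fun k => u k.+1).
Proof.
move=> u0 [B uB]; exists B => n; apply: le_trans (uB n.+1).
by rewrite big_nat_recl//= lerDr.
Qed.

Lemma bounded_sums_unshift u : bounded_sums (fun k => u k.+1) ->
  bounded_sums u.
Proof.
move=> [B uB]; exists (Num.max 0 (u 0%N + B)) => -[|n].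
  by rewrite big_geq// le_max lexx.
by rewrite big_nat_recl//= le_max lerD2l uB orbT.
Qed.

Lemma bounded_sums_telescope u (B : R) : (forall k, B <= u k) ->
  bounded_sums (fun k => u k - u k.+1).
Proof.
move=> uB; exists (u 0%N - B) => n.
rewrite (_ : \sum_(0 <= k < n) _ = u 0%N - u n); first by rewrite lerD2l lerN2.
elim: n => [|n IH]; first by rewrite big_geq// subrr.
by rewrite big_nat_recr//= IH; ring.
Qed.

Lemma bounded_sums_cvg u : (forall k, 0 <= u k) -> bounded_sums u ->
  cvgn (series u).
Proof.
move=> u0 [B uB]; apply: nondecreasing_is_cvgn.
  by apply/nondecreasing_seqP => n; rewrite /series/= big_nat_recr//= lerDl.
by exists B => _ [n _ <-]; exact: uB.
Qed.

Lemma ell1_bounded_sums u : ell1_plus u -> bounded_sums u.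
Proof.
move=> [u0 cu]; exists (limn (series u)) => n.
apply: (@nondecreasing_cvgn_le _ (series u)) => //.
by apply/nondecreasing_seqP => k; rewrite /series/= big_nat_recr//= lerDl.
Qed.

Lemma divergent_series_unbounded gamma : (forall k, 0 <= gamma k) ->
  ~ cvgn (series gamma) ->
  forall B : R, exists N, forall n, (N <= n)%N ->
    B < \sum_(0 <= k < n) gamma k.
Proof.
move=> g0 ncv B; apply: contrapT => H; apply: ncv.
apply: bounded_sums_cvg => //; exists B => n.
rewrite leNgt; apply/negP => Bn; apply: H; exists n => m nm.
apply: (lt_le_trans Bn); rewrite (big_cat_nat _ nm)//= lerDl.
exact: sumr_ge0.
Qed.

(* Quasi-monotonicity: subtracting the partial sums of e makes u
   nonincreasing. *)
Lemma quasi_decreasing_cvg u p e (L : R) :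
  (forall k, u k.+1 + p k <= u k + e k) -> (forall k, 0 <= p k) ->
  (forall k, 0 <= e k) -> (forall k, L <= u k) -> bounded_sums e ->
  [/\ cvgn u, bounded_sums p & exists B : R, forall k, u k <= B].
Proof.
move=> step p0 e0 Lu be; have [E eE] := be.
have upe n : u n + \sum_(0 <= k < n) p k <= u 0%N + \sum_(0 <= k < n) e k.
  elim: n => [|n IH]; first by rewrite !big_geq.
  by rewrite !big_nat_recr//=; have := step n; lra.
have sp n : 0 <= \sum_(0 <= k < n) p k by exact: sumr_ge0.
split; last 2 first.
- by exists (u 0%N + E - L) => n; have := upe n; have := eE n; have := Lu n; lra.
- by exists (u 0%N + E) => n; have := upe n; have := eE n; have := sp n; lra.
have ce : cvgn (series e) by exact: bounded_sums_cvg.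
have cue : cvgn (u - series e).
  apply: nonincreasing_is_cvgn.
    apply/nonincreasing_seqP => n.
    change (u n.+1 - series e n.+1 <= u n - series e n).
    have -> : series e n.+1 = series e n + e n.
      by rewrite /series /= big_nat_recr.
    by have := step n; have := p0 n; lra.
  exists (L - E) => _ [n _ <-]; change (L - E <= u n - series e n).
  by have := Lu n; have := eE n; rewrite /series /=; lra.
rewrite (_ : u = (u - series e) + series e); first exact: is_cvgD.
by rewrite subrK.
Qed.

(** * Weighted sums with non-summable weights *)

Section weights.
Variable gamma : nat -> R.
Hypothesis gamma0 : forall k, 0 < gamma k.
Hypothesis gamma_div : ~ cvgn (series gamma).

(** If [w] stayed above [eps] from [N] on, the weighted sums would dominate [eps] times a divergent
    series. *)
Lemma weighted_sum_small w (N : nat) (eps : R) : 0 < eps ->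
  bounded_sums (fun k => gamma k * w k) ->
  exists2 k, (N <= k)%N & w k < eps.
Proof.
move=> e0 [B wB]; apply: contrapT => H.
have wge k : (N <= k)%N -> eps <= w k.
  by move=> Nk; rewrite leNgt; apply/negP => we; apply: H; exists k.
pose S n := \sum_(0 <= k < n) gamma k.
have := divergent_series_unbounded (fun k => ltW (gamma0 k)) gamma_div
  (S N + eps^-1 * (B - \sum_(0 <= k < N) gamma k * w k)).
move=> [M /(_ (maxn M N) (leq_maxl _ _))].
rewrite (big_cat_nat _ (leq_maxr M N))//= -/(S N) ltrD2l mulrC ltr_pdivrMr//.
have := wB (maxn M N); rewrite (big_cat_nat _ (leq_maxr M N))//=.
have : (\sum_(N <= i < maxn M N) gamma i) * eps <=
       \sum_(N <= i < maxn M N) gamma i * w i.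
  rewrite mulr_suml big_nat_cond [leRHS]big_nat_cond; apply: ler_sum => i.
  by rewrite andbT => /andP[Ni _]; rewrite ler_pM2l// wge.
lra.
Qed.

Lemma weighted_sum_lim w (l : R) : w @ \oo --> l ->
  bounded_sums (fun k => gamma k * w k) -> l <= 0.
Proof.
move=> wl bw; rewrite leNgt; apply/negP => l0.
have l20 : 0 < l / 2 by lra.
have /cvgrPdist_lt/(_ _ l20) [N _ HN] := wl.
have [k Nk wk] := weighted_sum_small N l20 bw.
have /= := HN k Nk; rewrite ltr_norml => /andP[_]; lra.
Qed.

(* Squaring turns the slow growth into a summable perturbation. *)
Lemma slow_growth_cvg0 w (alpha : R) : 0 <= alpha ->
  bounded_sums (fun k => gamma k ^+ 2) ->
  (forall k, 0 <= w k) -> (forall k, w k.+1 <= w k + alpha * gamma k) ->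
  bounded_sums (fun k => gamma k * w k) -> w @ \oo --> 0.
Proof.
move=> a0 bg w0 wS bw.
pose e k := 2 * alpha * (gamma k * w k) + alpha ^+ 2 * gamma k ^+ 2.
have e0 k : 0 <= e k.
  by rewrite /e addr_ge0// ?mulr_ge0// ?sqr_ge0// ltW.
have be : bounded_sums e.
  by apply: bounded_sumsD; apply: bounded_sumsZ; rewrite ?mulr_ge0// sqr_ge0.
have [] := @quasi_decreasing_cvg (fun k => w k ^+ 2) (fun=> 0) e 0.
- move=> k; rewrite addr0 /e.
  apply: (@le_trans _ _ ((w k + alpha * gamma k) ^+ 2)); last by lra.
  by rewrite ler_sqr ?nnegrE// addr_ge0// mulr_ge0// ltW.
- by [].
- exact: e0.
- by move=> k; rewrite sqr_ge0.
- exact: be.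
move=> cw2 _ [B wB].
have l0 : limn (fun k => w k ^+ 2) <= 0.
  have [D wD] : bounded_sums (fun k => gamma k * w k) by [].
  (* [B] bounds the squares, and [w <= w ^+ 2 + 1/4], so [B + 1] bounds [w] itself. Multiplying the
     summable [gamma k * w k] by it dominates [gamma k * w k ^+ 2]. *)
  have B0 : 0 <= B + 1 by have := wB 0%N; have := sqr_ge0 (w 0%N); lra.
  apply: weighted_sum_lim cw2 _.
  apply: bounded_sums_le (bounded_sumsZ B0 bw) => k.
  rewrite [leRHS]mulrCA ler_pM2l// expr2 ler_wpM2r//.
  have := wB k; have := sqr_ge0 (w k - 1/2); lra.
have w2 : (fun k => w k ^+ 2) @ \oo --> (0 : R).
  rewrite (_ : 0 = limn (fun k => w k ^+ 2)) //.
  apply/le_anti/andP; split=> //.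
  by apply: limr_ge => //; apply: nearW => k; exact: sqr_ge0.
apply/cvgrPdist_lt => eps eps0.
have /cvgrPdist_lt/(_ _ (exprn_gt0 2 eps0)) := w2.
apply: filterS => k; rewrite !sub0r !normrN normrX.
by rewrite ltr_sqr ?nnegrE// ltW.
Qed.

Lemma psum_gt0 k : 0 < psum gamma k.
Proof.
rewrite /psum big_ord_recr/= ltr_wpDl// sumr_ge0// => i _; exact: ltW.
Qed.

Lemma psumE k : psum gamma k = \sum_(0 <= i < k.+1) gamma i.
Proof. by rewrite /psum big_mkord. Qed.

Lemma psumS k : psum gamma k.+1 = psum gamma k + gamma k.+1.
Proof. by rewrite /psum big_ord_recr. Qed.

(* Abel-Dini: \sum_k gamma k / psum gamma k diverges, since each of its tails
   has blocks of mass at least 1/2. *)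
Lemma weighted_sum_rate w : bounded_sums (fun k => gamma k * w k) ->
  (forall k, 0 <= w k) ->
  forall N, exists2 k, (N <= k)%N & w k <= (psum gamma k)^-1.
Proof.
move=> bw w0 N; apply: contrapT => H.
have wge k : (N <= k)%N -> (psum gamma k)^-1 <= w k.
  move=> Nk; rewrite leNgt; apply/negP => we; apply: H; exists k => //.
  exact: ltW.
have gw0 k : 0 <= gamma k * w k by rewrite mulr_ge0// ltW.
have /cauchy_cvgP := bounded_sums_cvg gw0 bw.
move=> /cauchy_seriesP/(_ (1/2) ltac:(lra)).
case=> -[U V] /= [[M1 _ U1] [M2 _ V1]] UV.
(* [N.+1] instead of [N] makes [m] positive, so that the sum [a] below is not empty. *)
pose m := maxn (maxn M1 M2) N.+1.
have Nm : (N <= m)%N by rewrite (leq_trans (leqnSn N))// leq_maxr.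
have [n0 Hn0] := divergent_series_unbounded (fun k => ltW (gamma0 k)) gamma_div
  (2 * \sum_(0 <= k < m) gamma k).
pose n := maxn n0 m.
have mn : (m <= n)%N by exact: leq_maxr.
have := UV (m, n); rewrite /=; have : U m /\ V n.
  split; first by apply: U1; rewrite /= /m -maxnA leq_maxl.
  apply: V1 => /=; apply: leq_trans mn.
  by rewrite /m (maxnC M1) -maxnA leq_maxl.
move=> -[Um Vn] /(_ (conj Um Vn)).
rewrite ger0_norm ?sumr_ge0//; apply/negP; rewrite -leNgt.
have := Hn0 n (leq_maxl _ _); rewrite (big_cat_nat _ mn)//=.
set a := \sum_(0 <= i < m) gamma i; set b := \sum_(m <= i < n) gamma i => ab.
have m0 : (0 < m)%N by rewrite /m leq_max orbT.
have a0 : 0 < a.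
  rewrite /a -(prednK m0) -psumE; exact: psum_gt0.
(* [n] was chosen so that the full sum [a + b] exceeds [2 * a]: the block carries at least half of
   it, and no [psum gamma i] inside the block exceeds [a + b]. *)
apply: (@le_trans _ _ ((a + b)^-1 * b)).
  by rewrite [leRHS]mulrC ler_pdivlMr; lra.
rewrite {2}/b mulr_sumr; apply: ler_sum_nat => i /andP[mi ni]; rewrite mulrC ler_pM2l//.
apply: le_trans (wge i (leq_trans Nm mi)).
rewrite lef_pV2 ?posrE ?psum_gt0//; last by lra.
rewrite psumE /a /b -big_cat_nat//= (big_cat_nat _ ni)//= lerDl.
by rewrite sumr_ge0// => j _; exact: ltW.
Qed.

End weights.

Lemma subsequence_exists (Q : nat -> Prop) :
  (forall N, exists2 k, (N <= k)%N & Q k) ->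
  exists2 phi : nat -> nat, {homo phi : i j / (i < j)%N} & forall j, Q (phi j).
Proof.
move=> H; have /choice[nxt Hn] : forall N, exists k, (N <= k)%N /\ Q k.
  by move=> N; have [k] := H N; exists k.
pose phi j := iter j (fun k => nxt k.+1) (nxt 0%N).
exists phi.
  apply: homo_ltn; first by move=> ? ? ?; exact: ltn_trans.
  by move=> i; rewrite /phi iterS; exact: (Hn _).1.
by case=> [|j]; rewrite /phi ?iterS; exact: (Hn _).2.
Qed.

End real_sequences.

(** * Hilbert spaces *)

Section inner_product.
Context {R : realType} {H : hilbertType R}.
Implicit Types x y z u v : H.

Lemma innerDr x y z : inner x (y + z) = inner x y + inner x z.
Proof. by rewrite innerC innerDl innerC (innerC z). Qed.

Lemma innerZr (a : R) x y : inner x (a *: y) = a * inner x y.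
Proof. by rewrite innerC innerZl innerC. Qed.

Lemma innerNl x y : inner (- x) y = - inner x y.
Proof. by rewrite -scaleN1r innerZl mulN1r. Qed.

Lemma innerNr x y : inner x (- y) = - inner x y.
Proof. by rewrite innerC innerNl innerC. Qed.

Lemma inner0l x : inner 0 x = 0.
Proof. by rewrite -(scale0r 0) innerZl mul0r. Qed.

Lemma inner0r x : inner x 0 = 0.
Proof. by rewrite innerC inner0l. Qed.

Lemma innerBl x y z : inner (x - y) z = inner x z - inner y z.
Proof. by rewrite innerDl innerNl. Qed.

Lemma innerBr x y z : inner x (y - z) = inner x y - inner x z.
Proof. by rewrite innerDr innerNr. Qed.

Lemma normD_sqr x y : `|x + y| ^+ 2 = `|x| ^+ 2 + 2 * inner x y + `|y| ^+ 2.
Proof. by rewrite -!inner_norm innerDl !innerDr (innerC y x); ring. Qed.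

Lemma normB_sqr x y : `|x - y| ^+ 2 = `|x| ^+ 2 - 2 * inner x y + `|y| ^+ 2.
Proof. by rewrite normD_sqr innerNr normrN; ring. Qed.

Lemma normZ_sqr (a : R) x : `|a *: x| ^+ 2 = a ^+ 2 * `|x| ^+ 2.
Proof. by rewrite normrZ exprMn real_normK// num_real. Qed.

(** Cauchy-Schwarz: the squared norm of |y| x - |x| y is 2 |x| |y| times the difference of the two
    sides. *)
Lemma inner_le x y : inner x y <= `|x| * `|y|.
Proof.
have [->|x0] := eqVneq x 0; first by rewrite inner0l normr0 mul0r.
have [->|y0] := eqVneq y 0; first by rewrite inner0r normr0 mulr0.
have px : 0 < `|x| by rewrite normr_gt0.
have py : 0 < `|y| by rewrite normr_gt0.
have := sqr_ge0 `| `|y| *: x - `|x| *: y |.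
rewrite normB_sqr !normZ_sqr innerZl innerZr => h.
have : 0 <= (2 * (`|x| * `|y|)) * (`|x| * `|y| - inner x y) by nra.
by rewrite pmulr_rge0 ?subr_ge0// !mulr_gt0.
Qed.

Lemma inner_normM x y : `|inner x y| <= `|x| * `|y|.
Proof.
by rewrite ler_norml inner_le lerNl -innerNl (le_trans (inner_le _ _))// normrN.
Qed.

Lemma inner_eq0 x : (forall y, inner x y = 0) -> x = 0.
Proof.
by move=> /(_ x); rewrite inner_norm => /eqP; rewrite sqrf_eq0 normr_eq0 => /eqP.
Qed.

Lemma inner_continuousr u : continuous (inner u : H -> R).
Proof.
move=> x; apply/cvgrPdist_lt => e e0; near=> y.
rewrite -innerBr (le_lt_trans (inner_normM _ _))//.
have p : 0 < `|u| + 1 by rewrite ltr_wpDl.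
apply: (@le_lt_trans _ _ ((`|u| + 1) * `|x - y|)).
  by rewrite ler_wpM2r// lerDl.
rewrite mulrC -ltr_pdivlMr//; near: y.
by apply: cvgr_dist_lt => //; rewrite divr_gt0.
Unshelve. all: by end_near. Qed.

End inner_product.

Lemma segmentE {R : realType} {V : lmodType R} (t : R) (x y : V) :
  t *: x + (1 - t) *: y = y + t *: (x - y).
Proof. by rewrite scalerBl scale1r scalerBr addrCA. Qed.

Section strongly_convex_minimization.
Context {R : realType} {H : hilbertType R}.
Variables (phi : H -> \bar R) (beta : R) (v : H).
Hypothesis beta0 : 0 < beta.
Hypotheses (phi_proper : proper_fun phi) (phi_cvx : convex_efun phi)
  (phi_lsc : lower_semicontinuous phi).

Let q w := (2 * beta)^-1 * `|v - w| ^+ 2.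

Let phi_fin w : dom phi w -> phi w \is a fin_num.
Proof. by move=> dw; rewrite fin_numElt ltNye (proj1 phi_proper). Qed.

Let q_continuous : continuous q.
Proof.
have -> : q = (fun w => (2 * beta)^-1 * (`|v - w| * `|v - w|)).
  by apply/funext => w; rewrite /q expr2.
move=> w; apply: cvgM; first exact: cvg_cst.
have vw : `|v - x| @[x --> w] --> `|v - w|.
  by apply: cvg_norm; apply: cvgB => //; exact: cvg_cst.
by apply: cvgM.
Qed.

(* Minimizing sequences are Cauchy by the midpoint inequality, and lower
   semicontinuity makes their limit a minimizer. *)
Lemma prox_objective_argmin (c : R) :
  (forall w, dom phi w -> c <= fine (phi w) + q w) ->
  argmin (fun w => phi w + (q w)%:E)%E !=set0.
Proof.
move=> cJ; have [w0 dw0] := phi_proper.2.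
pose J w := fine (phi w) + q w.
pose S := [set J w | w in dom phi].
have hS : has_inf S.
  split; first by exists (J w0), w0.
  by exists c => _ [w dw <-]; exact: cJ.
pose m := inf S.
have mJ w : dom phi w -> m <= J w.
  by move=> dw; apply: ge_inf; [exact: hS.2|exists w].
have exn n : exists w, dom phi w /\ J w < m + n.+1%:R^-1.
  have n0 : 0 < n.+1%:R^-1 :> R by rewrite invr_gt0.
  by have [_ [w dw <-]] := inf_adherent n0 hS; exists w.
have [w Hw] := choice exn.
(* By the parallelogram identity, [q] at the midpoint falls short of the mean of its values by a
   quarter of [(2 * beta)^-1 * |a - b|^2]; hence the 8. *)
have mid a b : dom phi a -> dom phi b ->
    (8 * beta)^-1 * `|a - b| ^+ 2 <= (J a + J b) / 2 - m.
  move=> da db; pose t := (1 / 2 : R).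
  have t01 : 0 < t < 1 by apply/andP; split; rewrite /t; lra.
  have := phi_cvx a b t01.
  set ab := (t *: a + (1 - t) *: b) => le1.
  have dab : dom phi ab.
    apply: le_lt_trans le1 _.
    by rewrite -(fineK (phi_fin da)) -(fineK (phi_fin db)) -!EFinM -EFinD ltry.
  move: le1; rewrite -(fineK (phi_fin da)) -(fineK (phi_fin db)).
  rewrite -(fineK (phi_fin dab)) -!EFinM -EFinD lee_fin => le1.
  have qE : q ab = (q a + q b) / 2 - (8 * beta)^-1 * `|a - b| ^+ 2.
    rewrite /q.
    have -> : v - ab = t *: (v - a) + t *: (v - b).
      rewrite /ab (_ : 1 - t = t); last by rewrite /t; lra.
      rewrite !scalerBr addrACA -opprD -scalerDl (_ : t + t = 1) ?scale1r//.
      by rewrite /t; lra.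
    have -> : a - b = (v - b) - (v - a).
      by rewrite opprB addrCA addrAC subrr add0r.
    move: (v - a) (v - b) => X Y.
    rewrite normB_sqr normD_sqr !normZ_sqr innerZl innerZr (innerC Y).
    by rewrite /t; field; exact: lt0r_neq0.
  have := mJ _ dab; rewrite /J qE; rewrite /t in le1.
  lra.
have cw : cauchy (w @ \oo).
  apply/cauchy_ballP => e e0; rewrite near_map2.
  have K0 : 0 < (8 * beta)^-1 * e ^+ 2.
    by rewrite mulr_gt0 ?exprn_gt0// invr_gt0 mulr_gt0.
  near=> i j => /=; rewrite -ball_normE /ball_/=.
  rewrite -(@ltr_pXn2r _ 2)// ?nnegrE// ?ltW//.
  have b8 : 0 < (8 * beta)^-1 by rewrite invr_gt0 mulr_gt0.
  rewrite -(ltr_pM2l b8).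
  apply: le_lt_trans (mid _ _ (Hw i).1 (Hw j).1) _.
  have hi := (Hw i).2; have hj := (Hw j).2.
  have hiK : i.+1%:R^-1 < (8 * beta)^-1 * e ^+ 2.
    by near: i; apply: (near_infty_natSinv_lt (PosNum K0)).
  have hjK : j.+1%:R^-1 < (8 * beta)^-1 * e ^+ 2.
    by near: j; apply: (near_infty_natSinv_lt (PosNum K0)).
  move: hi hj hiK hjK; move: (_^-1 * _) (i.+1%:R^-1) (j.+1%:R^-1) (J _) (J _).
  move=> ? ? ? ? ?.
  lra.
have wp : w @ \oo --> lim (w @ \oo) by exact: cauchy_cvg.
set p := lim (w @ \oo) in wp.
have qw : q (w n) @[n --> \oo] --> q p by apply: continuous_cvg => //; exact: q_continuous.
have pm : (phi p <= (m - q p)%:E)%E.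
  rewrite leNgt; apply/negP => lt1.
  (* A real level strictly below [phi p] is needed also when [phi p] is [+oo], a case that lower
     semicontinuity has to exclude as well. *)
  have [a a1 a2] : exists2 a : R, m - q p < a & (a%:E < phi p)%E.
    have [E|E] := boolP (phi p \is a fin_num).
    - move: lt1; rewrite -(fineK E) lte_fin => lt1.
      by exists ((m - q p + fine (phi p)) / 2); rewrite ?lte_fin; lra.
    - exists (m - q p + 1); first by rewrite ltrDl.
      have /eqP -> : phi p == +oo%E.
        by move: E; rewrite fin_numElt negb_and -!leNgt leeNy_eq leye_eq
          (negbTE (proj1 phi_proper p)).
      exact: ltry.
  have [V Vp aV] := phi_lsc a2.
  have e0 : 0 < (a - (m - q p)) / 2 by lra.
  have [n [Vn [n1 n2]]] : exists n, V (w n) /\ n.+1%:R^-1 < (a - (m - q p)) / 2 /\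
      `|q p - q (w n)| < (a - (m - q p)) / 2.
    apply: (@filter_ex _ \oo); near=> n; split; last split.
    - by near: n; exact: wp.
    - by near: n; apply: (near_infty_natSinv_lt (PosNum e0)).
    - by near: n; move/cvgrPdist_lt : qw; exact.
  have := aV _ Vn; rewrite -(fineK (phi_fin (Hw n).1)) lte_fin => h1.
  have := (Hw n).2; rewrite /J => h2.
  move: n2; rewrite ltr_norml => /andP[_].
  move: h1 h2 n1 {lt1 a1 a2 e0}.
  move: (q p) (q (w n)) (n.+1%:R^-1) (fine _) => ? ? ? ?; lra.
have dp : dom phi p by apply: le_lt_trans pm _; exact: ltry.
exists p => u /=.
apply: (@le_trans _ _ m%:E).
  move: pm; rewrite -(fineK (phi_fin dp)) -EFinD !lee_fin; lra.
have [du|] := boolP (phi u < +oo)%E; last first.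
  by rewrite -leNgt leye_eq => /eqP ->; rewrite addye// leey.
by rewrite -(fineK (phi_fin du)) -EFinD lee_fin; exact: mJ.
Unshelve. all: by end_near. Qed.

(** Fermat's rule without derivatives: comparing [p] with the points [p + t (w - p)] gives the
    subgradient inequality up to an error of order [t]. *)
Lemma prox_objective_subgradient p :
  argmin (fun w => phi w + (q w)%:E)%E p ->
  dom phi p /\ subdifferential phi p (beta^-1 *: (v - p)).
Proof.
move=> minp.
have dp : dom phi p.
  have [w dw] := phi_proper.2; have := minp w.
  rewrite /= -(fineK (phi_fin dw)) -EFinD /dom /= => h.
  have : (phi p + (q p)%:E < +oo)%E by apply: le_lt_trans h _; exact: ltry.
  by case: (phi p) => [r _| |_]//; rewrite ?ltry ?ltNyr.
split=> // w.
have [dw|] := boolP (phi w < +oo)%E; last first.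
  by rewrite -leNgt leye_eq => /eqP ->; rewrite leey.
rewrite -(fineK (phi_fin dp)) -(fineK (phi_fin dw)) -EFinD lee_fin.
set fp := fine _; set fw := fine _.
have key (t : R) : 0 < t -> t < 1 ->
    fp + inner (beta^-1 *: (v - p)) (w - p) <=
    fw + t * ((2 * beta)^-1 * `|w - p| ^+ 2).
  move=> t0 t1; have t01 : 0 < t < 1 by rewrite t0.
  have := phi_cvx w p t01; set u := _ + _ => le1.
  have du : dom phi u.
    apply: le_lt_trans le1 _.
    by rewrite -(fineK (phi_fin dw)) -(fineK (phi_fin dp)) -!EFinM -EFinD ltry.
  move: le1; rewrite -(fineK (phi_fin dw)) -(fineK (phi_fin dp)).
  rewrite -(fineK (phi_fin du)) -!EFinM -EFinD lee_fin -/fp -/fw => le1.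
  have := minp u; rewrite /= -(fineK (phi_fin du)) -(fineK (phi_fin dp)).
  rewrite -!EFinD lee_fin -/fp => le2.
  have vu : v - u = (v - p) - t *: (w - p).
    by rewrite /u segmentE opprD addrA.
  move: le2; rewrite /q vu (normB_sqr (v - p)) innerZr normZ_sqr innerZl => le2.
  have b2 : (2 * beta)^-1 = beta^-1 / 2 by rewrite invfM mulrC.
  rewrite b2 in le2 *; set i := inner _ _ in le2 *.
  set X := `|w - p| ^+ 2 in le2 *; set Y := `|v - p| ^+ 2 in le2.
  rewrite -(ler_pM2l t0).
  nra.
rewrite leNgt; apply/negP => lt1.
set X := (2 * beta)^-1 * `|w - p| ^+ 2 in key.
have X0 : 0 <= X by rewrite mulr_ge0 ?sqr_ge0// invr_ge0 mulr_ge0// ltW.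
pose del := fp + inner (beta^-1 *: (v - p)) (w - p) - fw.
have del0 : 0 < del by rewrite /del; lra.
(* Small enough for the error [t * X] to be at most half of the supposed defect [del]; the [+ 1]
   covers [X = 0], and [1/2] keeps [t] below 1. *)
pose t := Num.min (1/2) (del / (2 * (X + 1))).
have X1 : 0 < X + 1 by lra.
have t0 : 0 < t.
  by rewrite lt_min; apply/andP; split; [lra|rewrite divr_gt0 ?mulr_gt0].
have t1 : t < 1 by rewrite gt_min; apply/orP; left; lra.
have := key t t0 t1; have : t * X <= del / 2.
  apply: (@le_trans _ _ (del / (2 * (X + 1)) * (X + 1))).
    apply: ler_pM => //; first exact: ltW.
      by rewrite ge_min lexx orbT.
    by rewrite lerDl.
  by rewrite invfM mulrA mulfVK ?lt0r_neq0.
rewrite /del in del0 *; lra.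
Qed.

End strongly_convex_minimization.

Section riesz_representation.
Context {R : realType} {H : hilbertType R}.

(** The representing vector is the minimizer of [|w|^2 / 2 - l w], that is, the proximal point of
    [- l] at 0. The subgradient inequality there, tested at [x] and at [- x], becomes an
    equality. *)
Lemma riesz (l : H -> R) (M : R) : (forall x y, l (x + y) = l x + l y) ->
  (forall a x, l (a *: x) = a * l x) -> (forall x, `|l x| <= M * `|x|) ->
  exists p, forall x, inner p x = l x.
Proof.
move=> lD lZ lM; pose phi x := (- l x)%:E.
have lN x : l (- x) = - l x by rewrite -scaleN1r lZ mulN1r.
have l0 : l 0 = 0 by rewrite -(scale0r 0) lZ mul0r.
have M0 : 0 <= `|M| by [].
have l_cont : continuous l.
  move=> x; apply/cvgrPdist_lt => e e0; near=> y.
  rewrite -lN -lD (le_lt_trans (lM _))//.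
  apply: (@le_lt_trans _ _ ((`|M| + 1) * `|x - y|)).
    by rewrite ler_wpM2r// (le_trans (ler_norm _))// lerDl.
  rewrite mulrC -ltr_pdivlMr ?ltr_wpDl//; near: y.
  by apply: cvgr_dist_lt => //; rewrite divr_gt0// ltr_wpDl.
have phi_proper : proper_fun phi by split=> //; exists 0; exact: ltry.
have phi_cvx : convex_efun phi.
  by move=> x y t _; rewrite /phi -!EFinM -EFinD lee_fin lD !lZ; lra.
have phi_lsc : lower_semicontinuous phi.
  move=> x a; rewrite lte_fin => ax; exists [set y | a < - l y] => //.
  have : \forall y \near x, `|l x - l y| < - l x - a.
    by have /cvgrPdist_lt := l_cont x; apply; rewrite subr_gt0.
  by apply: filterS => y /=; rewrite ltr_norml => /andP[]; lra.
have low w : dom phi w ->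
    - `|M| ^+ 2 / 2 <= fine (phi w) + (2 * 1)^-1 * `|0 - w| ^+ 2.
  move=> _ /=; rewrite sub0r normrN mulr1.
  have := lM w; have := ler_norm (l w); have := sqr_ge0 (`|w| - `|M|).
  have : M * `|w| <= `|M| * `|w| by rewrite ler_wpM2r// ler_norm.
  lra.
have [p] := prox_objective_argmin ltr01 phi_proper phi_cvx phi_lsc low.
move=> /(prox_objective_subgradient ltr01 phi_proper phi_cvx)[_ sub].
exists p => x.
have key y : - l p + inner (- p) y <= - l (p + y).
  have := sub (p + y); rewrite -EFinD lee_fin.
  by rewrite invr1 scale1r sub0r addrAC subrr add0r.
have := key x; have := key (- x).
by rewrite !lD lN innerNr !innerNl; lra.
Unshelve. all: by end_near. Qed.

Lemma adjointE {K : hilbertType R} (A : {linear H -> K}) y x :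
  bounded_operator A -> inner (adjoint A y) x = inner y (A x).
Proof.
move=> [M AM].
have : [set v | forall x, inner v x = inner y (A x)] !=set0.
  apply: (@riesz _ (`|y| * M)) => [u v|a u|u].
  - by rewrite linearD innerDr.
  - by rewrite linearZ innerZr.
  - by rewrite (le_trans (inner_normM _ _))// -mulrA ler_wpM2l.
by move=> /(xgetPex 0); exact.
Qed.

Lemma gradientE (phi : H -> \bar R) x u :
  differentiable (fun y => fine (phi y)) x ->
  inner (gradient phi x) u = 'd (fun y => fine (phi y)) x u.
Proof.
move=> dphi; set D := 'd _ x.
have : [set v | forall u, inner v u = D u] !=set0.
  have /linear_bounded_continuous/linear_boundedP Db : continuous D.
    exact: diff_continuous.
  have [M _ DM] : exists2 M : R, True & forall y, `|D y| <= M * `|y|.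
    have [M0 [_ HM]] := Db; exists (M0 + 1) => // y.
    by apply: HM; rewrite ltrDl.
  apply: (@riesz _ M) => // [v w|a v].
  - by rewrite linearD.
  - by rewrite linearZ.
by move=> /(xgetPex 0); exact.
Qed.

(** One-sided in [t]: a convex set containing [x] and [x + v] gives information on the segment
    between them, not on its backward extension. *)
Lemma gradient_quotient_cvg (phi : H -> \bar R) x v :
  differentiable (fun y => fine (phi y)) x ->
  (fun t : R => t^-1 * (fine (phi (x + t *: v)) - fine (phi x))) @ 0^'+
    --> inner (gradient phi x) v.
Proof.
move=> dphi; rewrite gradientE// -deriveE//.
rewrite (_ : (fun t : R => _) = (fun t : R => t^-1 *:
    (((fun y => fine (phi y)) \o shift x) (t *: v) - fine (phi x)))).
  by apply: cvg_dnbhs_at_right; exact: diff_derivable.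
by apply/funext => t; rewrite /= [t *: v + x]addrC.
Qed.

Lemma gradient_le (phi : H -> \bar R) x v (c : R) :
  differentiable (fun y => fine (phi y)) x ->
  (forall t : R, 0 < t < 1 ->
    fine (phi (x + t *: v)) <= fine (phi x) + t * c) ->
  inner (gradient phi x) v <= c.
Proof.
move=> dphi le1; have cv := gradient_quotient_cvg (v := v) dphi.
rewrite -(cvg_lim _ cv)//; apply: limr_le; first by apply/cvg_ex; eexists; exact: cv.
near=> t.
have t0 : 0 < t by near: t; exact: nbhs_right_gt.
have t1 : t < 1 by near: t; exact: nbhs_right_lt.
by rewrite ler_pdivrMl// lerBlDl le1// t0.
Unshelve. all: by end_near. Qed.

(** The quotients are subtracted before the limit, because the estimate to be differentiated
    concerns only the difference [phi - psi]; it will come from the convexity of [F - f]. *)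
Lemma gradientB_le (phi psi : H -> \bar R) x v (c : R) :
  differentiable (fun y => fine (phi y)) x ->
  differentiable (fun y => fine (psi y)) x ->
  (forall t : R, 0 < t < 1 ->
    fine (phi (x + t *: v)) - fine (psi (x + t *: v)) <=
    fine (phi x) - fine (psi x) + t * c) ->
  inner (gradient phi x) v - inner (gradient psi x) v <= c.
Proof.
move=> dphi dpsi le1.
have cv : ((fun t : R => t^-1 * (fine (phi (x + t *: v)) - fine (phi x)))
    - (fun t : R => t^-1 * (fine (psi (x + t *: v)) - fine (psi x)))) @ 0^'+
    --> inner (gradient phi x) v - inner (gradient psi x) v.
  by apply: cvgB; exact: gradient_quotient_cvg.
rewrite -(cvg_lim _ cv)//; apply: limr_le; first by apply/cvg_ex; eexists; exact: cv.
near=> t.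
have t0 : 0 < t by near: t; exact: nbhs_right_gt.
have t1 : t < 1 by near: t; exact: nbhs_right_lt.
have t01 : 0 < t < 1 by rewrite t0.
rewrite fctE /= -mulrBr ler_pdivrMl//; have := le1 t t01; lra.
Unshelve. all: by end_near. Qed.

End riesz_representation.

(** * Minimal norm elements and weak convergence *)

Section minimal_norm.
Context {R : realType} {H : hilbertType R}.

(** The minimal-norm element is the proximal point at 0 of the indicator function [phi] of [S],
    whose lower semicontinuity is the closedness of [S]. *)
Lemma min_norm_elementP (S : set H) : S !=set0 -> closed S ->
  (forall x y (t : R), 0 < t < 1 -> S x -> S y -> S (t *: x + (1 - t) *: y)) ->
  S (min_norm_element S) /\ forall v, S v -> `|min_norm_element S| <= `|v|.
Proof.
move=> [s0 Ss0] Scl Scvx.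
pose phi w : \bar R := if `[< S w >] then 0%E else +oo%E.
have phiS w : S w -> phi w = 0%E by move=> Sw; rewrite /phi asboolT.
have phiN w : ~ S w -> phi w = +oo%E by move=> Sw; rewrite /phi asboolF.
have domS w : dom phi w -> S w.
  by move=> dw; apply: contrapT => /phiN E; move: dw; rewrite /dom /= E ltxx.
have phi_proper : proper_fun phi.
  split; first by move=> x; rewrite /phi; case: ifP.
  by exists s0; rewrite /dom /= phiS// ltry.
have phi_cvx : convex_efun phi.
  move=> x y t t01; have /andP[t0 t1] := t01.
  have [Sx|/phiN ->] := pselect (S x); last first.
    rewrite gt0_muley ?lte_fin// addye ?leey//.
    by rewrite /phi; case: ifP => _; rewrite ?mule0// gt0_muley// lte_fin subr_gt0.
  have [Sy|/phiN ->] := pselect (S y); last first.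
    by rewrite [X in (_ <= _ + X)%E]gt0_muley ?lte_fin ?subr_gt0// (phiS x)// mule0 add0e leey.
  by rewrite (phiS x)// (phiS y)// !mule0 adde0 phiS//; exact: Scvx.
have phi_lsc : lower_semicontinuous phi.
  move=> x a ax; have [Sx|NSx] := pselect (S x).
    exists setT; first exact: filterT.
    move=> y _; move: ax; rewrite phiS// => a0.
    by rewrite /phi; case: ifP => // _; exact: ltry.
  exists (~` S); first by apply: open_nbhs_nbhs; split => //; exact: closed_openC.
  by move=> y /phiN ->; exact: ltry.
have low w : dom phi w -> 0 <= fine (phi w) + (2 * 1)^-1 * `|0 - w| ^+ 2.
  by move=> /domS/phiS ->; rewrite add0r mulr_ge0// sqr_ge0.
have [p minp] := prox_objective_argmin ltr01 phi_proper phi_cvx phi_lsc low.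
have [/domS Sp _] := prox_objective_subgradient ltr01 phi_proper phi_cvx minp.
have : [set u | S u /\ forall v, S v -> `|u| <= `|v|] !=set0.
  exists p; split=> // v Sv; have := minp v.
  rewrite /= !phiS// !add0e lee_fin ler_pM2l ?invr_gt0 ?mulr_gt0//.
  by rewrite !sub0r !normrN ler_sqr ?nnegrE.
by move=> /(xgetPex 0).
Qed.

(** A subdifferential is an intersection of closed half-spaces, one for each point of [dom g]. Hence
    [min_norm_element] is a genuine subgradient here, and a bound on its norm bounds a
    subgradient. *)
Lemma subdifferential_min_norm (g : H -> \bar R) v : proper_fun g ->
  subdifferential g v !=set0 ->
  subdifferential g v (min_norm_element (subdifferential g v)).
Proof.
move=> [gN [w0 dw0]] ne; have [u0 u0s] := ne.
have gv : g v \is a fin_num.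
  have := u0s w0; rewrite fin_numElt ltNye gN /=.
  case: (g v) (gN v) => [r| |] // _; first by rewrite ltry.
  by rewrite addye// => /(le_lt_trans)/(_ dw0); rewrite ltxx.
apply: (@min_norm_elementP _ ne _ _).1.
  have -> : subdifferential g v = \bigcap_(w in dom g)
      ((inner (w - v) : H -> R) @^-1` [set r | r <= fine (g w) - fine (g v)]).
    apply/seteqP; split=> u /= uP w.
      move=> dw /=; have := uP w; rewrite innerC.
      have gw : g w \is a fin_num by rewrite fin_numElt ltNye gN.
      by rewrite -(fineK gv) -(fineK gw) -EFinD lee_fin /= lerBrDl.
    have [dw|] := boolP (g w < +oo)%E; last first.
      by rewrite -leNgt leye_eq => /eqP ->; rewrite leey.
    have gw : g w \is a fin_num by rewrite fin_numElt ltNye gN.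
    have := uP w dw; rewrite /= innerC.
    by rewrite -(fineK gv) -(fineK gw) -EFinD lee_fin /= lerBrDl.
  apply: closed_bigI => w _; apply: preimage_closed; last exact: closed_le.
  by move=> x _; exact: inner_continuousr.
move=> x y t /andP[t0 t1] xs ys w; have := xs w; have := ys w.
have [dw|] := boolP (g w < +oo)%E; last first.
  by rewrite -leNgt leye_eq => /eqP ->; rewrite !leey.
have gw : g w \is a fin_num by rewrite fin_numElt ltNye gN.
rewrite -(fineK gv) -(fineK gw) -!EFinD !lee_fin innerDl !innerZl.
nra.
Qed.

End minimal_norm.

Section weak_topology.
Context {R : realType} {H : hilbertType R}.
Implicit Types (x : nat -> H) (l u : H).

Lemma weak_space_continuous u : continuous (fun z : weak_space H => inner z u).
Proof.
move=> z; apply: (@continuous_comp _ _ _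
  (fun x : weak_space H => (inner x : prod_topology (fun _ : H => R)))
  (fun phi : prod_topology (fun _ : H => R) => phi u)).
  exact: initial_continuous.
exact: (@proj_continuous H (fun _ => R) u).
Qed.

Lemma weakly_convergesI x l :
  (forall u, inner (x k) u @[k --> \oo] --> inner l u) -> weakly_converges x l.
Proof.
move=> xl.
have xl' : (fun k => (inner (x k) : prod_topology (fun _ : H => R))) @ \oo -->
    (inner l : prod_topology (fun _ : H => R)).
  apply/cvg_sup => u A [_ [[B Bo <-] Bl] BA].
  have : \forall k \near \oo, B (inner (x k) u).
    by apply: xl; apply: open_nbhs_nbhs.
  by apply: filterS => k Bk; apply: BA.
move=> A [_ [[B Bo <-] Bl] BA].
have : \forall k \near \oo, B (inner (x k)).
  by apply: xl'; apply: open_nbhs_nbhs.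
by apply: filterS => k Bk; apply: BA.
Qed.

(** One test vector at a time suffices: the arguments on cluster points gather all the functionals
    they need into a single vector. *)
Lemma weak_cluster_point_frequently x l : weak_cluster_point x l ->
  forall u (e : R) N, 0 < e ->
  exists2 k, (N <= k)%N & `|inner (x k) u - inner l u| < e.
Proof.
move=> cl u e N e0.
have nb : nbhs (l : weak_space H) [set z | `|inner l u - inner z u| < e].
  by have /cvgrPdist_lt/(_ _ e0) := @weak_space_continuous u l.
have Fx : ((x : nat -> weak_space H) @ \oo) [set x k | k in [set k | (N <= k)%N]].
  by exists N => // k Nk; exists k.
have [_ [[k Nk <-]] /= h] := cl _ _ Fx nb.
by exists k => //; rewrite distrC.
Qed.

(** Each [inner z u] is bounded for [z] in [S], as the weakly continuous image of a compact set. The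
    uniform boundedness principle makes the bound uniform on the unit ball, and [u = z / |z|] then
    gives the norm of [z]. *)
Lemma weakly_compact_bounded (S : set H) : weakly_compact S ->
  exists2 B : R, 0 <= B & forall z, S z -> `|z| <= B.
Proof.
move=> Sc.
have pb : pointwise_bounded [set (inner z : H -> R^o) | z in S].
  move=> u.
  have : compact ((fun z : weak_space H => inner z u) @` (S : set (weak_space H))).
    apply: (@continuous_compact (weak_space H)) => //.
    apply: continuous_subspaceT => z A Az.
    exact: (@weak_space_continuous u z A Az).
  move/(@compact_bounded _ R^o _) => [M [_ HM]]; exists (M + 1) => _ [z Sz <-].
  by apply: HM; [rewrite ltrDl|exists z].
have lin f : [set (inner z : H -> R^o) | z in S] f ->
    bounded_fun_norm f /\ linear f.
  move=> [z Sz <-]; split.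
    move=> r; exists (`|z| * r) => y yr.
    by apply: le_trans (inner_normM _ _) _; rewrite ler_wpM2l.
  by move=> a u v; rewrite innerDr innerZr.
have [M HM] := Banach_Steinhauss lin pb 1.
exists `|M| => // z Sz.
have [->|z0] := eqVneq z 0; first by rewrite normr0.
have zp : 0 < `|z| by rewrite normr_gt0.
have : `|inner z (`|z|^-1 *: z)| <= M.
  apply: HM; first by exists z.
  by rewrite normrZ normfV normr_id mulVf// lt0r_neq0.
rewrite innerZr inner_norm expr2 mulKf ?lt0r_neq0// normr_id => /le_trans; apply.
exact: ler_norm.
Qed.

(** * Weak limits along ultrafilters *)

Section ultrafilters.
Variable U : set_system nat.
Context {UU : UltraFilter U}.

Lemma ultra_bounded_cvg (r : nat -> R) (B : R) : (forall k, `|r k| <= B) ->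
  cvg (r @ U).
Proof.
move=> rB; have rU : (r @ U) `[- B, B]%classic.
  change (U (r @^-1` `[- B, B]%classic)).
  by apply: filterE => k /=; rewrite in_itv /=; have := rB k; rewrite ler_norml.
have [p [_ cp]] := @segment_compact R (- B) B (r @ U) _ rU.
apply/cvg_ex; exists p => A Ap.
have [//|nA] := in_ultra_setVsetC (r @^-1` A) UU.
have [z [/= nAz Az]] := cp (~` A) A nA Ap.
by case: (nAz Az).
Qed.

(** This replaces the extraction of weakly convergent subsequences: along an ultrafilter the bounded
    sequences [inner (x k) u] converge for all [u] at once, and their limit is a bounded linear
    functional of [u]. *)
Lemma ultra_bounded_weak_lim x (B : R) : (forall k, `|x k| <= B) ->
  exists l, forall u, inner (x k) u @[k --> U] --> inner l u.
Proof.
move=> xB; have B0 : 0 <= B by apply: le_trans (xB 0%N).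
have bnd u k : `|inner (x k) u| <= B * `|u|.
  by rewrite (le_trans (inner_normM _ _))// ler_wpM2r.
have cv u : inner (x k) u @[k --> U] --> lim (inner (x k) u @[k --> U]).
  by apply: ultra_bounded_cvg => k; exact: bnd.
have [u v|a u|u|p Hp] := @riesz R H (fun u => lim (inner (x k) u @[k --> U])) B.
- apply/cvg_lim => //; under eq_fun do rewrite innerDr.
  exact: cvgD.
- apply/cvg_lim => //; under eq_fun do rewrite innerZr.
  by apply: cvgM => //; exact: cvg_cst.
- have cvn : `|inner (x k) u| @[k --> U] --> `|lim (inner (x k) u @[k --> U])|.
    by apply: cvg_norm; exact: cv.
  by rewrite -(cvg_lim _ cvn)//; apply: limr_le;
    [apply/cvg_ex; eexists; exact: cvn|apply: filterE => k; exact: bnd].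
by exists p => u; rewrite Hp.
Qed.

End ultrafilters.

Lemma ultra_along_infinity (Q : set nat) :
  (forall N, exists2 k, (N <= k)%N & Q k) ->
  exists U : set_system nat, [/\ UltraFilter U, U Q & (\oo : set_system nat) `<=` U].
Proof.
move=> freq.
have PF : ProperFilter (within Q \oo).
  apply: Build_ProperFilter_ex => A [N _ HN]; have [k Nk Qk] := freq N.
  by exists k; exact: HN.
have [U [UU sU]] := ultraFilterLemma PF.
exists U; split => //.
  by apply: sU; exists 0%N.
by move=> A [N _ HA]; apply: sU; exists N => // k Nk _; exact: HA.
Qed.

(** If convergence failed for some [u], the bad indices would be unbounded, and an ultrafilter
    containing them would have a weak limit other than [l]. *)
Lemma weakly_converges_ultra x l (B : R) : (forall k, `|x k| <= B) ->
  (forall (U : set_system nat), UltraFilter U -> (\oo : set_system nat) `<=` U ->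
    forall l', (forall u, inner (x k) u @[k --> U] --> inner l' u) -> l' = l) ->
  weakly_converges x l.
Proof.
move=> xB uniq; apply: weakly_convergesI => u; apply/cvgrPdist_lt => e e0.
apply: contrapT => nH.
have [N|U [UU UQ sU]] :=
    @ultra_along_infinity [set k | ~ `|inner l u - inner (x k) u| < e].
  apply: contrapT => H1; apply: nH; exists N => // k Nk.
  by apply: contrapT => H2; apply: H1; exists k.
have [l' Hl'] := ultra_bounded_weak_lim xB.
have E := uniq U UU sU l' Hl'; rewrite E in Hl'.
have /cvgrPdist_lt/(_ _ e0) UG := Hl' u.
by have [k [/= H1 H2]] := filter_ex (filterI UQ UG).
Qed.

(* Opial: for two weak cluster points l1, l2 in Z, the convergence of
   |x k - l1|^2 - |x k - l2|^2 makes inner (x k) (l1 - l2) converge. *)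
Lemma opial x (Z : set H) (B : R) : (forall k, `|x k| <= B) ->
  (forall l, Z l -> cvgn (fun k => `|x k - l| ^+ 2)) ->
  (forall (U : set_system nat), UltraFilter U -> (\oo : set_system nat) `<=` U ->
    forall l, (forall u, inner (x k) u @[k --> U] --> inner l u) -> Z l) ->
  exists2 l, Z l & weakly_converges x l.
Proof.
move=> xB cvZ clZ.
have [//|U [UU _ sU]] := @ultra_along_infinity setT; first by move=> N; exists N.
have [l Hl] := ultra_bounded_weak_lim xB.
have Zl := clZ U UU sU l Hl.
exists l => //; apply: (weakly_converges_ultra xB) => U' UU' sU' l' Hl'.
have Zl' := clZ U' UU' sU' l' Hl'.
have cv : cvgn (fun k => inner (x k) (l' - l)).
  rewrite (_ : (fun k => _) = (fun k => 2^-1 * (`|x k - l| ^+ 2 - `|x k - l'| ^+ 2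
     - (`|l| ^+ 2 - `|l'| ^+ 2)))); last first.
    by apply/funext => k; rewrite !normB_sqr innerBr; field.
  apply: is_cvgM; first exact: is_cvg_cst.
  apply: is_cvgB; last exact: is_cvg_cst.
  by apply: is_cvgB; exact: cvZ.
(* A limit along [\oo] can be computed along any finer ultrafilter: [U] and [U'] give two values for
   the same number, whose difference is [|l' - l|^2]. *)
have E1 : lim (inner (x k) (l' - l) @[k --> \oo]) = inner l (l' - l).
  apply: (@cvg_unique _ (@norm_hausdorff _ R) (inner (x k) (l' - l) @[k --> U])).
    by apply: cvg_trans cv; exact: cvg_app.
  exact: Hl.
have E2 : lim (inner (x k) (l' - l) @[k --> \oo]) = inner l' (l' - l).
  apply: (@cvg_unique _ (@norm_hausdorff _ R) (inner (x k) (l' - l) @[k --> U'])).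
    by apply: cvg_trans cv; exact: cvg_app.
  exact: Hl'.
apply/eqP; rewrite -subr_eq0 -normr_eq0 -sqrf_eq0 -inner_norm innerBl -E1 -E2.
by rewrite subrr.
Qed.

End weak_topology.

(** * Conditional summability *)

Section conditional_summability.
Context {R : realType} {d : measure_display} {Omega : measurableType d}.
Variable P : probability Omega R.

Lemma aeS (A B : Omega -> Prop) : (forall w, A w -> B w) ->
  {ae P, forall w, A w} -> {ae P, forall w, B w}.
Proof. exact: (@filterS _ _ (ae_filter_ringOfSetsType P)). Qed.

Lemma aeI (A B : Omega -> Prop) : {ae P, forall w, A w} ->
  {ae P, forall w, B w} -> {ae P, forall w, A w /\ B w}.
Proof. exact: (@filterI _ _ (ae_filter_ringOfSetsType P)). Qed.

(* Truncating on the events {sum_(i <= n) a_i <= N}, which belong to the n-th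
   sigma-algebra, turns the conditional expectations into expectations bounded
   by N; their union over N has full measure. *)
Lemma conditional_bounded_sums (G : nat -> set (set Omega))
    (gamma : nat -> R) (X e : nat -> Omega -> R) :
  (forall n, <<s G n >> `<=` measurable) ->
  (forall i n, (i <= n)%N -> <<s G i >> `<=` <<s G n >>) ->
  (forall n, 0 < gamma n) ->
  (forall n, measurable_fun setT (X n)) -> (forall n w, 0 <= X n w) ->
  (forall n, cond_expectation P <<s G n >> (X n) (e n)) ->
  ell1_plus_filtered P (fun n => <<s G n >>) (fun n w => gamma n * e n w) ->
  {ae P, forall w, bounded_sums (fun n => gamma n * X n w)}.
Proof.
move=> Gm Gmono g0 mX X0 ce [a0 ma sa].
pose a n w := gamma n * e n w.
pose S n w := \sum_(0 <= i < n.+1) a i w.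
pose B (N n : nat) := [set w | S n w <= N%:R].
have BG N n : <<s G n >> (B N n).
  (* [Omega] is equipped with the n-th sigma-algebra instead of the ambient one, so that closure of
     measurable functions under sums applies inside it. *)
  pose T' := g_sigma_algebraType (G n).
  have mS : measurable_fun [set: T'] (S n : T' -> R).
    rewrite /S; under eq_fun do rewrite big_nat_cond.
    under eq_fun do rewrite -big_filter.
    have : forall i, i \in [seq i <- index_iota 0 n.+1 | (0 <= i < n.+1)%N && true] ->
        (i <= n)%N by move=> i; rewrite mem_filter andbT => /andP[].
    elim: [seq _ <- _ | _] => [_|i s IH Hs].
      by under eq_fun do rewrite big_nil; exact: measurable_cst.
    under eq_fun do rewrite big_cons.
    apply: measurable_realfun.measurable_funD.
      move=> _ Y mY; apply: (Gmono i); first by rewrite Hs// mem_head.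
      by apply: ma; exists Y.
    by apply: IH => j js; apply: Hs; rewrite in_cons js orbT.
  have SB : (S n : T' -> R) @^-1` `]-oo, N%:R]%classic = B N n.
    by apply/seteqP; split => w; rewrite /B/= in_itv.
  have := mS measurableT `]-oo, N%:R]%classic (measurable_itv _).
  by rewrite setTI SB.
have mB N n : measurable (B N n) by exact: Gm (BG N n).
pose h N n : Omega -> \bar R :=
  (EFin \o (fun w => gamma n * X n w)) \_ (B N n).
have mrestr N n (f : Omega -> R) : measurable_fun setT f ->
    measurable_fun setT ((EFin \o f) \_ (B N n)).
  move=> mf; apply: (measurable_restrictT _ (mB N n)).1.
  by apply: measurable_funTS; exact/measurable_EFinP.
have mh N n : measurable_fun setT (h N n).
  by apply: mrestr; apply: measurable_funM => //; exact: measurable_cst.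
have h0 N n w : (0 <= h N n w)%E.
  by rewrite /h patchE; case: ifP => // _; rewrite lee_fin mulr_ge0// ltW.
have me n : measurable_fun setT (a n).
  move=> _ Y mY; apply: (Gm n); apply: ma; by exists Y.
(* [B N n] belongs to the n-th sigma-algebra, so the defining identity of the conditional
   expectation holds on it. *)
have int_h N n : (\int[P]_w h N n w = \int[P]_w ((EFin \o a n) \_ (B N n)) w)%E.
  rewrite /h -!integral_mkcond.
  under eq_integral do rewrite /= EFinM.
  under [RHS]eq_integral do rewrite /= EFinM.
  have [mwe e0 ceB] := ce n.
  rewrite !ge0_integralZl_EFin ?ltW//.
  - by rewrite ceB.
  - by move=> w _; rewrite lee_fin.
  - apply: measurable_funTS; apply/measurable_EFinP => _ Y mY.
    by apply: (Gm n); apply: mwe; exists Y.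
  - by move=> w _; rewrite lee_fin.
  - by apply: measurable_funTS; apply/measurable_EFinP.
(* Either the last event occurs, and then the partial sum it controls bounds all the terms kept, or
   the last term is cut off and the induction hypothesis applies. *)
have trunc N m w : (\sum_(0 <= n < m) ((EFin \o a n) \_ (B N n)) w <= N%:R%:E)%E.
  elim: m => [|m IH]; first by rewrite big_geq// lee_fin.
  have [Bm|NBm] := pselect (B N m w); last first.
    by rewrite big_nat_recr//= patchE memNset// adde0 IH.
  apply: (@le_trans _ _ (S m w)%:E); last by rewrite lee_fin; exact: Bm.
  rewrite /S -sumEFin; apply: lee_sum => i _.
  by rewrite patchE; case: ifP => // _; rewrite lee_fin; exact: a0.
have fin_sum N : {ae P, forall w, \sum_(0 <= n <oo) h N n w \is a fin_num}%E.
  have mH : measurable_fun setT (fun w => \sum_(0 <= n <oo) h N n w)%E.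
    exact: ge0_emeasurable_sum.
  have H0 w : (0 <= \sum_(0 <= n <oo) h N n w)%E by exact: nneseries_ge0.
  have iH : P.-integrable setT (fun w => \sum_(0 <= n <oo) h N n w)%E.
    apply/integrableP; split => //.
    under eq_integral do rewrite gee0_abs//.
    rewrite integral_nneseries//.
    apply: (@le_lt_trans _ _ N%:R%:E); last exact: ltry.
    apply: lime_le; first by apply: is_cvg_nneseries => n _ _; exact: integral_ge0.
    apply: nearW => m; under eq_bigr do rewrite int_h.
    rewrite -ge0_integral_sum//; last 2 first.
    - by move=> n; exact: mrestr.
    - by move=> n w _; rewrite patchE; case: ifP => // _; rewrite lee_fin; exact: a0.
    apply: (@le_trans _ _ (\int[P]_w (cst N%:R%:E) w)%E); last first.
      by rewrite integral_cst// [X in (_ * X <= _)%E](probability_setT P) mule1.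
    apply: ge0_le_integral => //.
    - move=> w _; apply: sume_ge0 => n _.
      by rewrite patchE; case: ifP => // _; rewrite lee_fin; exact: a0.
    - by apply: emeasurable_sum => n; exact: mrestr.
  by apply: aeS (integrable_ae measurableT iH) => w; exact.
apply: aeS (aeI (ae_foralln fin_sum) sa).
move=> w [Hfin cva].
(* For this [w] all the partial sums stay below one integer level, so at that level nothing is
   truncated and the finite sum of [h] is the sum sought. *)
have [M SM] : exists M : R, forall n, S n w <= M.
  exists (limn (series (fun n => a n w))) => n.
  apply: (@nondecreasing_cvgn_le _ (series (fun n => a n w)) _ _ n.+1) => //.
  by apply/nondecreasing_seqP => k; rewrite /series/= big_nat_recr//= lerDl a0.
pose N := Num.truncn (Num.max M 0); have MN : M <= N.+1%:R.
  apply: le_trans (ltW (truncnS_gt _)); by rewrite le_max lexx.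
exists (fine (\sum_(0 <= n <oo) h N.+1 n w)%E) => m.
rewrite -lee_fin fineK; last exact: Hfin.
apply: le_trans (@nneseries_lim_ge _ _ xpredT 0%N m _); last by move=> *; exact: h0.
rewrite -sumEFin; apply: lee_sum => n _.
by rewrite /h patchE mem_set//=; exact: le_trans (SM n) MN.
Qed.

Lemma borel_norm_measurable {H : hilbertType R} (X : Omega -> H) :
  borel_random_variable X -> measurable_fun setT (fun w => `|X w|).
Proof.
move=> bX; apply: (@measurability _ _ _ _ _ _ (@RGenOInfty.G R)).
  exact: RGenOInfty.measurableE.
move=> _ [_ [y ->] <-]; rewrite setTI.
apply: bX; exists [set x | y < `|x|]; last first.
  by rewrite setTI; apply/seteqP; split => w /=; rewrite in_itv/= andbT.
apply: sub_sigma_algebra.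
apply: (@open_comp _ _ (fun x : H => `|x|) [set r : R | y < r]).
  by move=> x _; exact: norm_continuous.
exact: open_gt.
Qed.

End conditional_summability.

(** * Lyapunov analysis *)

Section augmented_lagrangian_descent.
Context {R : realType} {Hp Hd : hilbertType R}.
Variables (A : {linear Hp -> Hd}) (b : Hd) (C : set Hp).
Variables (Phi : Hp -> R) (Psi : nat -> Hp -> R).
Variables (gamma beta theta rho eps : nat -> R).
Variables (rholo rhohi Mhi c K D Ba : R).
Variables (x shat : nat -> Hp) (mu : nat -> Hd) (xstar : Hp).

Let res u := A u - b.
(** [Psi k] stands for the objective smoothed with parameter [beta k]. Besides the one-step
    inequality [descent], all that is kept of it is that it increases with [k], in steps of at most
    [(beta k - beta k.+1) * K], and lies within [beta k * K] below [Phi]. *)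
Let E k u m := Psi k u + inner m (res u) + rho k / 2 * `|res u| ^+ 2.

Hypothesis gamma01 : forall k, 0 < gamma k <= 1.
Hypothesis gamma_dec : forall k, gamma k.+1 <= gamma k.
Hypothesis gamma_ratio : forall k, gamma k <= Mhi * gamma k.+1.
Hypothesis gamma_div : ~ cvgn (series gamma).
Hypothesis gamma2_sum : bounded_sums (fun k => gamma k ^+ 2).
Hypothesis beta_gt0 : forall k, 0 < beta k.
Hypothesis beta_dec : forall k, beta k.+1 <= beta k.
Hypothesis beta_cvg : beta @ \oo --> 0.
Hypothesis gammabeta_sum : bounded_sums (fun k => gamma k * beta k).
Hypothesis rho_inc : forall k, rho k <= rho k.+1.
Hypothesis rho_bnd : forall k, rholo <= rho k <= rhohi.
Hypothesis rholo_gt0 : 0 < rholo.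
Hypothesis c_gt0 : 0 < c.
Hypothesis thetaE : forall k, theta k = gamma k / c.
Hypothesis Mhi_lt : Mhi / c < rholo / 2.
Hypothesis eps_ge0 : forall k, 0 <= eps k.
Hypothesis eps_sum : bounded_sums eps.
Hypothesis K_ge0 : 0 <= K.
Hypothesis C_cvx : forall u v (t : R), C u -> C v -> 0 <= t <= 1 ->
  C (v + t *: (u - v)).
Hypothesis Phi_cvx : forall u v (t : R), C u -> C v -> 0 <= t <= 1 ->
  Phi (v + t *: (u - v)) <= Phi v + t * (Phi u - Phi v).
Hypothesis Phi_bnd : forall u, C u -> `|Phi u| <= D.
Hypothesis res_bnd : forall u, C u -> `|res u| <= Ba.
Hypothesis Psi_le : forall k u, C u -> Psi k u <= Phi u.
Hypothesis Psi_ge : forall k u, C u -> Phi u <= Psi k u + beta k * K.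
Hypothesis Psi_inc : forall k u, C u -> Psi k u <= Psi k.+1 u.
Hypothesis Psi_step : forall k u, C u ->
  Psi k.+1 u <= Psi k u + (beta k - beta k.+1) * K.
Hypothesis Cx : forall k, C (x k).
Hypothesis Cshat : forall k, C (shat k).
Hypothesis xS : forall k, x k.+1 = x k + gamma k *: (shat k - x k).
Hypothesis muS : forall k, mu k.+1 = mu k + theta k *: res (x k.+1).
Hypothesis descent : forall k u, C u ->
  E k (x k.+1) (mu k) <= (1 - gamma k) * E k (x k) (mu k)
    + gamma k * E k u (mu k) - gamma k * rho k / 2 * `|A u - A (x k)| ^+ 2
    + eps k.
Hypothesis Cxstar : C xstar.
Hypothesis Axstar : A xstar = b.

Let gamma_gt0 k : 0 < gamma k. Proof. by have /andP[] := gamma01 k. Qed.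
Let gamma_le1 k : gamma k <= 1. Proof. by have /andP[] := gamma01 k. Qed.
Let gamma_ge0 k : 0 <= gamma k. Proof. exact: ltW. Qed.
Let Ba_ge0 : 0 <= Ba. Proof. exact: le_trans (res_bnd Cxstar). Qed.
Let D_ge0 : 0 <= D. Proof. exact: le_trans (Phi_bnd Cxstar). Qed.
Let res_xstar : res xstar = 0. Proof. by rewrite /res Axstar subrr. Qed.
Let res2_bnd u : C u -> `|res u| ^+ 2 <= Ba ^+ 2.
Proof. by move=> Cu; rewrite ler_sqr ?nnegrE//; exact: res_bnd. Qed.
Let Phi_le u : C u -> Phi u <= D.
Proof. by move=> /Phi_bnd; exact: le_trans (ler_norm _). Qed.
Let Phi_ge u : C u -> - D <= Phi u.
Proof. by move=> /Phi_bnd; rewrite ler_norml => /andP[]. Qed.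
Let beta_ge0 k : 0 <= beta k. Proof. exact: ltW. Qed.
Let betaK_ge0 k : 0 <= beta k * K. Proof. exact: mulr_ge0. Qed.
Let beta_le0 k : beta k <= beta 0%N.
Proof. by elim: k => [//|k IH]; exact: le_trans (beta_dec k) IH. Qed.
Let rho_gt0 k : 0 < rho k.
Proof. by have /andP[+ _] := rho_bnd k; exact: lt_le_trans. Qed.
Let rho_le k : rho k <= rhohi. Proof. by have /andP[] := rho_bnd k. Qed.
Let theta_gt0 k : 0 < theta k. Proof. by rewrite thetaE divr_gt0. Qed.
Let thetaS k : theta k <= Mhi / c * gamma k.+1.
Proof. by rewrite thetaE mulrAC ler_pM2r ?invr_gt0. Qed.

Let rho_tel_sum : bounded_sums (fun k => rho k.+1 - rho k).
Proof.
apply: (@bounded_sums_le _ _ (fun k => (- rho k) - (- rho k.+1))).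
  by move=> k; lra.
by apply: (@bounded_sums_telescope _ _ (- rhohi)) => k; rewrite lerN2.
Qed.

Let res_seg k :
  res (x k.+1) = res (x k) + gamma k *: (res (shat k) - res (x k)).
Proof.
rewrite /res xS linearD linearZ linearB addrAC.
by congr (_ + _ *: _); rewrite opprB addrA subrK.
Qed.

(** The tolerance of the near minimizers: positive, so that they exist even if the infimum is not
    attained, and summable. *)
Let eta k := gamma k ^+ 2.
Let eta_ge0 k : 0 <= eta k. Proof. exact: sqr_ge0. Qed.
Let eta_le1 k : eta k <= 1.
Proof. by rewrite exprn_ile1. Qed.

(** The bound degrades with [|m|]; it only ensures that the infimum at a fixed multiplier is
    finite. *)
Let E_lb k u m : C u -> - D - beta 0%N * K - `|m| * Ba <= E k u m.
Proof.
move=> Cu; rewrite /E.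
have h1 := Psi_ge k Cu; have h2 := Phi_ge Cu.
have h3 : beta k * K <= beta 0%N * K by rewrite ler_wpM2r.
have h4 : - (`|m| * Ba) <= inner m (res u).
  have := inner_normM m (res u); rewrite ler_norml => /andP[+ _].
  by apply: le_trans; rewrite lerN2 ler_wpM2l// res_bnd.
have h5 : 0 <= rho k / 2 * `|res u| ^+ 2.
  by rewrite mulr_ge0 ?sqr_ge0// ltW// divr_gt0.
lra.
Qed.

Lemma near_minimizers : exists xt : nat -> Hp, forall k, C (xt k) /\
  forall u, C u -> E k (xt k) (mu k) <= E k u (mu k) + eta k.
Proof.
suff H k : exists u, C u /\ forall v, C v -> E k u (mu k) <= E k v (mu k) + eta k.
  by have [xt] := choice H; exists xt.
pose S := [set E k u (mu k) | u in C].
have hS : has_inf S.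
  split; first by exists (E k xstar (mu k)), xstar.
  by exists (- D - beta 0%N * K - `|mu k| * Ba) => _ [u Cu <-]; exact: E_lb.
have e0 : 0 < eta k by rewrite exprn_gt0.
have [_ [u Cu <-] uS] := inf_adherent e0 hS.
exists u; split=> // v Cv; apply: le_trans (ltW uS) _.
by rewrite lerD2r; apply: ge_inf; [exact: hS.2|exists v].
Qed.

(** * Quasi-monotonicity of the primal-dual gap *)

Section primal_dual_gap.
Variable xt : nat -> Hp.
Hypothesis xtP : forall k, C (xt k) /\
  forall u, C u -> E k (xt k) (mu k) <= E k u (mu k) + eta k.

Let Cxt k : C (xt k) := (xtP k).1.
Let V k := E k (x k.+1) (mu k).
Let Dv k := E k (xt k) (mu k).
Let e k := E k (x k) (mu k).

Let E_next k u : E k.+1 u (mu k.+1) = E k u (mu k)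
  + (Psi k.+1 u - Psi k u) + theta k * inner (res (x k.+1)) (res u)
  + (rho k.+1 - rho k) / 2 * `|res u| ^+ 2.
Proof. by rewrite /E muS innerDl innerZl; lra. Qed.

Let e_next k : e k.+1 <= V k + (beta k - beta k.+1) * K
  + theta k * `|res (x k.+1)| ^+ 2 + (rho k.+1 - rho k) / 2 * Ba ^+ 2.
Proof.
rewrite /e E_next -/(V k) inner_norm.
have h1 := Psi_step k (Cx k.+1).
have h2 : (rho k.+1 - rho k) / 2 * `|res (x k.+1)| ^+ 2
    <= (rho k.+1 - rho k) / 2 * Ba ^+ 2.
  by apply: ler_wpM2l; [have := rho_inc k; lra|exact: res2_bnd].
lra.
Qed.

(** [xt k.+1] is an admissible competitor for the minimum of index [k]. This is why the dual
    increment involves its residual, paired with that of [x k.+1]. *)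
Let Dv_next k : Dv k - eta k + theta k * inner (res (x k.+1)) (res (xt k.+1))
  <= Dv k.+1.
Proof.
rewrite {2}/Dv E_next.
have h1 := (xtP k).2 _ (Cxt k.+1); rewrite -/(Dv k) in h1.
have h2 := Psi_inc k (Cxt k.+1).
have h3 : 0 <= (rho k.+1 - rho k) / 2 * `|res (xt k.+1)| ^+ 2.
  by rewrite mulr_ge0 ?sqr_ge0//; have := rho_inc k; lra.
lra.
Qed.

(** What remains of the penalty coefficient after the dual step has taken its share [Mhi / c]. *)
Let del := rholo / 2 - Mhi / c.
Let del_gt0 : 0 < del. Proof. by rewrite /del subr_gt0. Qed.

Let gain k := del * (gamma k.+1 * `|res (x k.+1) - res (xt k.+1)| ^+ 2)
  + c^-1 * (gamma k.+1 * `|res (xt k.+1)| ^+ 2)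
  + gamma k.+1 * (e k.+1 - Dv k.+1 + eta k.+1).
Let loss k := K * (beta k - beta k.+1) + Ba ^+ 2 / 2 * (rho k.+1 - rho k)
  + 2 * eta k + eta k.+1 + eps k.+1.

Let gap_ge0 k : 0 <= e k - Dv k + eta k.
Proof. by have := (xtP k).2 _ (Cx k); rewrite /e /Dv; lra. Qed.

Let gain_ge0 k : 0 <= gain k.
Proof.
by rewrite /gain !addr_ge0// !mulr_ge0// ?sqr_ge0// ltW// invr_gt0.
Qed.

Let loss_ge0 k : 0 <= loss k.
Proof.
by rewrite /loss !addr_ge0// ?mulr_ge0// ?subr_ge0.
Qed.

Let beta_tel_sum : bounded_sums (fun k => beta k - beta k.+1).
Proof. by apply: (@bounded_sums_telescope _ _ 0). Qed.

Let loss_sum : bounded_sums loss.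
Proof.
apply: bounded_sumsD; last exact: bounded_sums_shift.
apply: bounded_sumsD; last by apply: bounded_sums_shift.
apply: bounded_sumsD; last exact: bounded_sumsZ.
apply: bounded_sumsD; first exact: bounded_sumsZ.
by apply: bounded_sumsZ => //; rewrite divr_ge0// sqr_ge0.
Qed.

Let gap_step k : V k.+1 - 2 * Dv k.+1 + gain k <= V k - 2 * Dv k + loss k.
Proof.
have h1 := descent k.+1 (Cxt k.+1).
rewrite -/(V k.+1) -/(e k.+1) -/(Dv k.+1) in h1.
have h2 := e_next k; have h3 := Dv_next k.
have resB : A (xt k.+1) - A (x k.+1) = - (res (x k.+1) - res (xt k.+1)).
  by rewrite /res opprB opprB addrA subrK.
rewrite resB normrN in h1.
rewrite /gain /loss.
move: h1 h2 h3; set a := res (x k.+1); set t := res (xt k.+1) => h1 h2 h3.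
have hB := normB_sqr a t.
have g0 := gamma_gt0 k.+1; have g1 := gamma_le1 k.+1.
have hY : gamma k.+1 * rholo <= gamma k.+1 * rho k.+1.
  by rewrite ler_pM2l//; have /andP[] := rho_bnd k.+1.
have hth := thetaS k.
have hth' : c^-1 * gamma k.+1 <= theta k.
  by rewrite thetaE mulrC ler_pM2r ?invr_gt0.
have he : gamma k.+1 * eta k.+1 <= eta k.+1.
  by rewrite ler_piMl.
set Y := `|a - t| ^+ 2 in hB h1 *.
have Y0 : 0 <= Y by exact: sqr_ge0.
set T := `|t| ^+ 2 in hB *.
have T0 : 0 <= T by exact: sqr_ge0.
(* [theta k] is compared with [gamma k.+1] in both directions: above for the harmful |a - t|^2, and
   below, since the steps decrease, for the useful |t|^2. *)
have k1 : theta k * Y <= Mhi / c * gamma k.+1 * Y by rewrite ler_wpM2r.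
have k2 : gamma k.+1 * rholo * Y <= gamma k.+1 * rho k.+1 * Y.
  by rewrite ler_wpM2r.
have k3 : c^-1 * gamma k.+1 * T <= theta k * T by rewrite ler_wpM2r.
have k4 : theta k * `|a| ^+ 2 = theta k * Y + 2 * (theta k * inner a t) - theta k * T.
  by rewrite hB; ring.
rewrite k4 in h2.
rewrite /del.
have -> : (rholo / 2 - Mhi / c) * (gamma k.+1 * Y)
  = gamma k.+1 * rholo * Y / 2 - Mhi / c * gamma k.+1 * Y by ring.
lra.
Qed.

(** Weak duality: the residual vanishes at [xstar], so the bound does not see [mu k]. *)
Let Dv_le k : Dv k <= Phi xstar + eta k.
Proof.
have := (xtP k).2 _ Cxstar; rewrite -/(Dv k) /E res_xstar inner0r normr0 expr0n/= mulr0 !addr0.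
by have := Psi_le k Cxstar; lra.
Qed.

Let gap_lb k : - Phi xstar - 2 <= V k - 2 * Dv k.
Proof.
have h1 := Dv_le k; have := (xtP k).2 _ (Cx k.+1); rewrite -/(Dv k) -/(V k).
by have := eta_le1 k; lra.
Qed.

Lemma gap_convergence :
  [/\ cvgn (fun k => V k - 2 * Dv k),
      bounded_sums (fun k => gamma k * `|res (x k)| ^+ 2),
      bounded_sums (fun k => gamma k * (e k - Dv k + eta k))
    & exists B : R, forall k, V k <= B].
Proof.
have [cv sg [B Bu]] := quasi_decreasing_cvg gap_step gain_ge0 loss_ge0 gap_lb
  loss_sum.
split=> //; last 2 first.
- apply: bounded_sums_unshift; apply: bounded_sums_le sg => k.
  by rewrite /gain lerDr addr_ge0// !mulr_ge0// ?sqr_ge0// ltW// invr_gt0.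
- exists (B + 2 * (Phi xstar + 1)) => k.
  by have := Bu k; have := Dv_le k; have := eta_le1 k; lra.
apply: bounded_sums_unshift.
(* The gain contains |a - t|^2 with coefficient [del] and |t|^2 with coefficient [c^-1]. Inverting
   both, and using |a|^2 <= 2 |a - t|^2 + 2 |t|^2, yields this factor. *)
have s0 : 0 <= 2 * (del^-1 + c).
  by rewrite mulr_ge0// addr_ge0// ltW// invr_gt0.
apply: bounded_sums_le (bounded_sumsZ s0 sg) => k.
have g := gap_ge0 k.+1.
set a := res (x k.+1); set t := res (xt k.+1).
have g0 := gamma_ge0 k.+1.
have hn : `|a| ^+ 2 <= 2 * `|a - t| ^+ 2 + 2 * `|t| ^+ 2.
  have := sqr_ge0 `|a - t - t|; rewrite (normB_sqr (a - t) t).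
  have : `|a| ^+ 2 = `|(a - t) + t| ^+ 2 by rewrite subrK.
  by rewrite (normD_sqr (a - t) t); lra.
have d0 : 0 < del^-1 by rewrite invr_gt0.
have P1 : 0 <= gamma k.+1 * `|a - t| ^+ 2 by rewrite mulr_ge0// sqr_ge0.
have P2 : 0 <= gamma k.+1 * `|t| ^+ 2 by rewrite mulr_ge0// sqr_ge0.
have P3 : 0 <= gamma k.+1 * (e k.+1 - Dv k.+1 + eta k.+1) by rewrite mulr_ge0.
have hg : gamma k.+1 * `|a| ^+ 2
    <= 2 * (gamma k.+1 * `|a - t| ^+ 2) + 2 * (gamma k.+1 * `|t| ^+ 2).
  by have := ler_wpM2l g0 hn; lra.
apply: le_trans hg _; rewrite /gain -/a -/t.
move: P1 P2 P3; set p := gamma k.+1 * `|_| ^+ 2; set q := gamma k.+1 * `|_| ^+ 2.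
set r := gamma k.+1 * _ => P1 P2 P3.
have e1 : del^-1 * (del * p) = p by rewrite mulKf// lt0r_neq0.
have e2 : c * (c^-1 * q) = q by rewrite mulVKf// lt0r_neq0.
have m1 : 0 <= del^-1 * (c^-1 * q + r).
  apply: mulr_ge0; first exact: ltW.
  by apply: addr_ge0 => //; apply: mulr_ge0 => //; rewrite ltW// invr_gt0.
have m2 : 0 <= c * (del * p + r).
  apply: mulr_ge0; first exact: ltW.
  by apply: addr_ge0 => //; apply: mulr_ge0 => //; exact: ltW.
have -> : 2 * (del^-1 + c) * (del * p + c^-1 * q + r) =
  2 * (del^-1 * (del * p) + del^-1 * (c^-1 * q + r)
     + (c * (c^-1 * q) + c * (del * p + r))) by ring.
rewrite e1 e2; lra.
Qed.

End primal_dual_gap.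

Let V k := E k (x k.+1) (mu k).
Let e k := E k (x k) (mu k).

Lemma residual_sum : bounded_sums (fun k => gamma k * `|res (x k)| ^+ 2).
Proof. by have [xt xtP] := near_minimizers; have [_ h _ _] := gap_convergence xtP. Qed.

(** Convexity of the squared residual along the step towards [shat k]; this is the slow growth that
    turns weighted summability into convergence to 0. *)
Let res_sqr_seg k : `|res (x k.+1)| ^+ 2 <= `|res (x k)| ^+ 2 + Ba ^+ 2 * gamma k.
Proof.
rewrite res_seg normD_sqr innerZr normZ_sqr.
have := res2_bnd (Cshat k); have := sqr_ge0 `|res (x k)|.
set a := res (x k); set s := res (shat k) => a0 s0.
have hB : `|s - a| ^+ 2 = `|s| ^+ 2 - 2 * inner a s + `|a| ^+ 2.
  by rewrite normB_sqr innerC.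
have hI : inner a (s - a) = inner a s - `|a| ^+ 2 by rewrite innerBr inner_norm.
have Y0 := sqr_ge0 `|s - a|; rewrite hI.
have g0 := gamma_ge0 k; have g1 := gamma_le1 k.
have k1 : gamma k ^+ 2 * `|s - a| ^+ 2 <= gamma k * `|s - a| ^+ 2.
  by rewrite ler_wpM2r// expr2 ler_piMl.
have k2 : gamma k * `|s| ^+ 2 <= gamma k * Ba ^+ 2 by rewrite ler_wpM2l.
have k3 : 0 <= gamma k * `|a| ^+ 2 by rewrite mulr_ge0.
rewrite hB in k1 *; lra.
Qed.

Lemma residual_sqr_cvg : (fun k => `|res (x k)| ^+ 2) @ \oo --> 0.
Proof.
apply: (slow_growth_cvg0 gamma_gt0 gamma_div (alpha := Ba ^+ 2)) => //.
- exact: sqr_ge0.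
- exact: residual_sum.
Qed.

Lemma residual_cvg : (fun k => `|res (x k)|) @ \oo --> 0.
Proof.
apply/cvgrPdist_lt => r r0.
have /cvgrPdist_lt/(_ _ (exprn_gt0 2 r0)) := residual_sqr_cvg.
apply: filterS => k; rewrite !sub0r !normrN normrX normr_id.
by rewrite ltr_sqr ?nnegrE// ltW.
Qed.

(** * Lyapunov function relative to an optimal multiplier *)

Section saddle.
Variable mustar : Hd.
Hypothesis saddle : forall u, C u -> Phi xstar <= Phi u + inner mustar (res u).

Let w k := Phi (x k) + inner mustar (res (x k)) - Phi xstar.
Let m k := `|mu k - mustar| ^+ 2.
Let v k := V k - Phi xstar.
(** The augmented gap with [mustar] in place of [mu k]. It appears when the decrease of [v] is added
    to the cross term of the dual distance, and unlike [v] it is nonnegative up to [beta k * K]. *)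
Let Q k := v k - inner (mu k - mustar) (res (x k.+1)).

Let w_ge0 k : 0 <= w k.
Proof. by have := saddle (Cx k); rewrite /w; lra. Qed.

Let QE k : Q k = (Psi k (x k.+1) - Phi (x k.+1)) + w k.+1
  + rho k / 2 * `|res (x k.+1)| ^+ 2.
Proof. by rewrite /Q /v /V /E /w innerBl; lra. Qed.

Let Q_ge k : w k.+1 <= Q k + beta k * K.
Proof.
rewrite QE; have := Psi_ge k (Cx k.+1).
have : 0 <= rho k / 2 * `|res (x k.+1)| ^+ 2.
  by rewrite mulr_ge0 ?sqr_ge0// ltW// divr_gt0.
lra.
Qed.

Let mS k : m k.+1 = m k + 2 * (theta k * inner (mu k - mustar) (res (x k.+1)))
  + theta k ^+ 2 * `|res (x k.+1)| ^+ 2.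
Proof.
have -> : m k.+1 = `|(mu k - mustar) + theta k *: res (x k.+1)| ^+ 2.
  by rewrite /m muS addrAC.
by rewrite (normD_sqr (mu k - mustar)) innerZr normZ_sqr.
Qed.

(** The squared residual is counted twice: once for the effect of the dual update on the augmented
    Lagrangian, once for the quadratic term in the expansion of [m k.+1]. *)
Let loss2 k : R := K * (beta k - beta k.+1)
  + (2 * (Mhi / c)) * (gamma k.+1 * `|res (x k.+1)| ^+ 2)
  + Ba ^+ 2 / 2 * (rho k.+1 - rho k) + eps k.+1 + K * (gamma k * beta k).

Let Mhi_ge0 : 0 <= Mhi.
Proof.
have := gamma_ratio 0; have := gamma_gt0 1; have := gamma_gt0 0 => g0 g1 h.
by rewrite -(pmulr_lge0 _ g1); apply: le_trans h; exact: ltW.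
Qed.

Let loss2_sum : bounded_sums loss2.
Proof.
apply: bounded_sumsD; last exact: bounded_sumsZ.
apply: bounded_sumsD; last exact: bounded_sums_shift.
apply: bounded_sumsD; last by apply: bounded_sumsZ => //; rewrite divr_ge0// sqr_ge0.
apply: bounded_sumsD.
  by apply: bounded_sumsZ => //; apply: (@bounded_sums_telescope _ _ 0).
apply: bounded_sumsZ; first by rewrite !mulr_ge0// invr_ge0 ltW.
apply: (@bounded_sums_shift _ (fun k => gamma k * `|res (x k)| ^+ 2)).
  by rewrite mulr_ge0// sqr_ge0.
exact: residual_sum.
Qed.

Let loss2_ge0 k : 0 <= loss2 k.
Proof.
rewrite /loss2 !addr_ge0// ?mulr_ge0// ?subr_ge0// ?invr_ge0 ?sqr_ge0//.
exact: ltW.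
Qed.

(** The competitor in the descent inequality is now [xstar], whose value is at most [Phi xstar] for
    every multiplier. *)
Let V_step k : v k.+1 <= (1 - gamma k.+1) * v k + (K * (beta k - beta k.+1)
  + Mhi / c * (gamma k.+1 * `|res (x k.+1)| ^+ 2)
  + Ba ^+ 2 / 2 * (rho k.+1 - rho k) + eps k.+1).
Proof.
have h1 := descent k.+1 Cxstar.
rewrite -/(V k.+1) -/(e k.+1) in h1.
have h2 : E k.+1 xstar (mu k.+1) <= Phi xstar.
  rewrite /E res_xstar inner0r normr0 expr0n/= mulr0 !addr0.
  exact: Psi_le.
have g0 := gamma_ge0 k.+1; have g1 := gamma_le1 k.+1.
have h3 := ler_wpM2l g0 h2.
have h4 : 0 <= gamma k.+1 * rho k.+1 / 2 * `|A xstar - A (x k.+1)| ^+ 2.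
  by rewrite mulr_ge0 ?sqr_ge0// divr_ge0// mulr_ge0// ltW.
have h5 : e k.+1 - Phi xstar <= v k + (K * (beta k - beta k.+1)
  + Mhi / c * (gamma k.+1 * `|res (x k.+1)| ^+ 2)
  + Ba ^+ 2 / 2 * (rho k.+1 - rho k)).
  have i1 := Psi_step k (Cx k.+1).
  have i2 : (rho k.+1 - rho k) / 2 * `|res (x k.+1)| ^+ 2
      <= (rho k.+1 - rho k) / 2 * Ba ^+ 2.
    by apply: ler_wpM2l; [have := rho_inc k; lra|exact: res2_bnd].
  have i3 : theta k * `|res (x k.+1)| ^+ 2
      <= Mhi / c * gamma k.+1 * `|res (x k.+1)| ^+ 2.
    by rewrite ler_wpM2r ?sqr_ge0.
  rewrite /e /v /V /E muS innerDl innerZl inner_norm; lra.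
set r := _ + Ba ^+ 2 / 2 * _ in h5 *.
have r0 : 0 <= r.
  rewrite /r !addr_ge0// ?mulr_ge0// ?subr_ge0// ?invr_ge0 ?sqr_ge0//.
  exact: ltW.
have h6 : (1 - gamma k.+1) * (e k.+1 - Phi xstar) <= (1 - gamma k.+1) * v k + r.
  have g10 : 0 <= 1 - gamma k.+1 by rewrite subr_ge0.
  apply: le_trans (ler_wpM2l g10 h5) _.
  by rewrite mulrDr lerD2l ler_piMl// gerBl.
rewrite /v; move: h6; rewrite /v; lra.
Qed.

Let U k := v k + c / 2 * m k.

Let inner_young k (r : R) : 0 < r ->
  - (r * m k) - `|res (x k.+1)| ^+ 2 / (4 * r) <=
  inner (mu k - mustar) (res (x k.+1)).
Proof.
move=> r0; have := sqr_ge0 `|(2 * r) *: (mu k - mustar) + res (x k.+1)|.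
rewrite normD_sqr normZ_sqr innerZl -/(m k) => h.
have r4 : 0 < 4 * r by rewrite mulr_gt0.
rewrite -subr_ge0 -(pmulr_rge0 _ r4).
set i := inner _ _ in h *; set a := `|res _| ^+ 2 in h *.
have -> : 4 * r * (i - (- (r * m k) - a / (4 * r))) =
  (2 * r) ^+ 2 * m k + 2 * (2 * r * i) + a by field; exact: lt0r_neq0.
exact: h.
Qed.

(** [v k] may be very negative when [mu k] is large. Young's inequality pays for this with half of
    the term [c / 2 * m k]; the other half is what bounds the multipliers in the end. *)
Let U_lb (k : nat) : c / 4 * m k - beta 0%N * K - Ba ^+ 2 / c <= U k.
Proof.
have c4 : 0 < c / 4 by rewrite divr_gt0.
have h1 := inner_young k c4.
have h2 : Q k = v k - inner (mu k - mustar) (res (x k.+1)) by [].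
have h3 := Q_ge k; have h4 := w_ge0 k.+1.
have h5 : beta k * K <= beta 0%N * K by rewrite ler_wpM2r.
have h6 : `|res (x k.+1)| ^+ 2 / (4 * (c / 4)) <= Ba ^+ 2 / c.
  rewrite (_ : 4 * (c / 4) = c); last by field.
  by rewrite ler_pM2r ?invr_gt0//; exact: res2_bnd.
rewrite /U; lra.
Qed.

Lemma dual_lyapunov : [/\ cvgn (fun k => v k + c / 2 * m k),
  bounded_sums (fun k => gamma k * w k.+1)
  & exists2 B : R, 0 <= B & forall k, `|mu k - mustar| <= B].
Proof.
have [xt xtP] := near_minimizers.
have [_ _ _ [B VB]] := gap_convergence xtP.
pose B1 := `|B - Phi xstar|.
have vB k : v k <= B1.
  by apply: le_trans (ler_norm _); rewrite lerD2r; exact: VB.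
have B10 : 0 <= B1 by exact: normr_ge0.
have step k : U k.+1 + gamma k * w k.+1 <=
    U k + (loss2 k + B1 * (gamma k - gamma k.+1)).
  have h1 := V_step k; have h2 := mS k.
  have h3 : Q k = v k - inner (mu k - mustar) (res (x k.+1)) by [].
  have g0 := gamma_ge0 k.
  have h4 := ler_wpM2l g0 (Q_ge k); rewrite h3 in h4.
  have dg : 0 <= gamma k - gamma k.+1 by rewrite subr_ge0.
  (* The primal step contracts with [gamma k.+1], the dual one moves with [gamma k]. The discrepancy
     multiplies [v k], which is bounded above thanks to the primal-dual gap, so that it
     telescopes. *)
  have h5 := ler_wpM2l dg (vB k).
  (* Since [theta k = gamma k / c], the weight [c / 2] turns the cross term [2 * theta k] into
     exactly [gamma k]. *)
  have h6 : c / 2 * m k.+1 = c / 2 * m k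
      + gamma k * inner (mu k - mustar) (res (x k.+1))
      + gamma k * theta k / 2 * `|res (x k.+1)| ^+ 2.
    by rewrite h2 thetaE; field; exact: lt0r_neq0.
  have h7 : gamma k * theta k / 2 * `|res (x k.+1)| ^+ 2 <=
      Mhi / c * (gamma k.+1 * `|res (x k.+1)| ^+ 2).
    rewrite mulrA ler_wpM2r ?sqr_ge0//; apply: le_trans (thetaS k).
    have := ler_piMl (ltW (theta_gt0 k)) (gamma_le1 k).
    by have := theta_gt0 k; lra.
  rewrite /U /loss2 h6; lra.
have Ulb k : - beta 0%N * K - Ba ^+ 2 / c <= U k.
  have := U_lb k; have : 0 <= c / 4 * m k.
    by rewrite mulr_ge0 ?sqr_ge0// divr_ge0// ltW.
  lra.
have gw0 k : 0 <= gamma k * w k.+1 by exact: mulr_ge0.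
have l0 k : 0 <= loss2 k + B1 * (gamma k - gamma k.+1).
  by rewrite addr_ge0// mulr_ge0// subr_ge0.
have ls : bounded_sums (fun k => loss2 k + B1 * (gamma k - gamma k.+1)).
  apply: bounded_sumsD => //; apply: bounded_sumsZ => //.
  exact: (@bounded_sums_telescope _ _ 0).
have [cU sw [B2 UB]] := quasi_decreasing_cvg step gw0 l0 Ulb ls.
split => //.
pose B3 := (B2 + beta 0%N * K + Ba ^+ 2 / c) / (c / 4).
have c4 : 0 < c / 4 by rewrite divr_gt0.
have mB k : m k <= B3.
  rewrite /B3 ler_pdivlMr// mulrC; have := U_lb k; have := UB k; lra.
exists (B3 + 1).
  by have := mB 0%N; have := sqr_ge0 `|mu 0%N - mustar|; rewrite /m; lra.
move=> k; have := mB k; have := sqr_ge0 (`|mu k - mustar| - 1/2); rewrite /m; lra.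
Qed.

Let gamma_shift_sum (u : nat -> R) : (forall k, 0 <= u k) ->
  bounded_sums (fun k => gamma k * u k.+1) -> bounded_sums (fun k => gamma k * u k).
Proof.
move=> u0 h; apply: bounded_sums_unshift; apply: bounded_sums_le h => k.
by rewrite ler_wpM2r.
Qed.

Lemma lagrangian_gap_sum : bounded_sums (fun k => gamma k * w k.+1).
Proof. by have [_ h _] := dual_lyapunov. Qed.

Lemma lagrangian_gap_cvg : w @ \oo --> 0.
Proof.
(* Bounds the Lagrangian gap at every [shat k], hence by convexity the increase of [w] per unit of
   [gamma k]. *)
pose alpha := 2 * D + `|mustar| * Ba.
apply: (slow_growth_cvg0 gamma_gt0 gamma_div (alpha := alpha)) => //.
- by rewrite addr_ge0 ?mulr_ge0.
- move=> k.
  have g01 : 0 <= gamma k <= 1 by rewrite gamma_ge0 gamma_le1.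
  have := Phi_cvx (Cshat k) (Cx k) g01; rewrite -xS => h1.
  have h2 : Phi (shat k) + inner mustar (res (shat k)) - Phi xstar <= alpha.
    have i1 := Phi_le (Cshat k); have i2 := Phi_ge Cxstar.
    have i3 : inner mustar (res (shat k)) <= `|mustar| * Ba.
      apply: le_trans (inner_le _ _) _.
      by rewrite ler_wpM2l//; exact: res_bnd.
    by rewrite /alpha; lra.
  have h3 : inner mustar (res (x k.+1)) = inner mustar (res (x k))
      + gamma k * (inner mustar (res (shat k)) - inner mustar (res (x k))).
    by rewrite res_seg (innerDr mustar (res (x k))) innerZr
      (innerBr mustar (res (shat k))).
  have h4 := ler_wpM2l (gamma_ge0 k) h2.
  have h5 := mulr_ge0 (gamma_ge0 k) (w_ge0 k).
  move: h5; rewrite /w h3; lra.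
- exact: gamma_shift_sum lagrangian_gap_sum.
Qed.

(** The index map [n] is the identity for [e], and the successor for [v], where the primal point is
    one step ahead of the multiplier. *)
Let dist0_cvg (u : nat -> R) (n : nat -> nat) (B : R) :
  n @ \oo --> \oo ->
  (forall k, `|u k| <= beta k * K + w (n k) + rhohi / 2 * `|res (x (n k))| ^+ 2
    + B * `|res (x (n k))|) -> u @ \oo --> 0.
Proof.
move=> ninf uB.
have bnd : (fun k => beta k * K + w (n k) + rhohi / 2 * `|res (x (n k))| ^+ 2
    + B * `|res (x (n k))|) @ \oo --> (0 : R).
  have -> : (0 : R) = 0 * K + 0 + rhohi / 2 * 0 + B * 0 by ring.
  apply: cvgD; last by apply: cvgMr; exact: (cvg_comp _ _ ninf residual_cvg).
  apply: cvgD; last by apply: cvgMr; exact: (cvg_comp _ _ ninf residual_sqr_cvg).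
  apply: cvgD; last exact: (cvg_comp _ _ ninf lagrangian_gap_cvg).
  exact: cvgMl.
apply/cvgrPdist_lt => r r0.
have /cvgrPdist_lt/(_ _ r0) := bnd; apply: filterS => k.
rewrite !sub0r !normrN; apply: le_lt_trans.
exact: le_trans (uB k) (ler_norm _).
Qed.

Let E_dist k u (B : R) : C u -> `|mu k - mustar| <= B ->
  `|E k u (mu k) - Phi xstar| <= beta k * K
  + (Phi u + inner mustar (res u) - Phi xstar)
  + rhohi / 2 * `|res u| ^+ 2 + B * `|res u|.
Proof.
move=> Cu muB.
have h1 := Psi_le k Cu; have h2 := Psi_ge k Cu.
have h3 : `|inner (mu k - mustar) (res u)| <= B * `|res u|.
  by apply: le_trans (inner_normM _ _) _; rewrite ler_wpM2r.
have h4 : rho k / 2 * `|res u| ^+ 2 <= rhohi / 2 * `|res u| ^+ 2.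
  by rewrite ler_wpM2r ?sqr_ge0//; have := rho_le k; lra.
have h5 : 0 <= rho k / 2 * `|res u| ^+ 2.
  by rewrite mulr_ge0 ?sqr_ge0// ltW// divr_gt0.
have h6 := saddle Cu; have h7 := betaK_ge0 k.
move: h3; rewrite ler_norml innerBl /E => /andP[h31 h32].
rewrite ler_norml; apply/andP; split; lra.
Qed.

Let V_cvg : v @ \oo --> 0.
Proof.
have [_ _ [B B0 muB]] := dual_lyapunov.
apply: (@dist0_cvg _ (fun k => k.+1) B); first
  by move=> S [N _ HN]; exists N => // k Nk; apply: HN; exact: leqW.
by move=> k; exact: E_dist.
Qed.

Let e_cvg : e @ \oo --> Phi xstar.
Proof.
have [_ _ [B B0 muB]] := dual_lyapunov.
rewrite -[X in _ --> X]add0r.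
rewrite (_ : e = (fun k => (e k - Phi xstar) + Phi xstar)); last first.
  by apply/funext => k; rewrite subrK.
apply: cvgD; last exact: cvg_cst.
by apply: (@dist0_cvg _ id B) => // k; exact: E_dist.
Qed.

Lemma dual_distance_cvg : cvgn (fun k => `|mu k - mustar| ^+ 2).
Proof.
have [cU _ _] := dual_lyapunov.
rewrite (_ : (fun k => _) =
  (fun k => (v k + c / 2 * m k - v k) * (2 / c))); last first.
  by apply/funext => k; rewrite /m; field; exact: lt0r_neq0.
apply: is_cvgM; last exact: is_cvg_cst.
by apply: is_cvgB => //; apply/cvg_ex; exists 0; exact: V_cvg.
Qed.

(* The values of the smoothed dual functions at mu k converge to the optimal
   value: along the converging primal-dual gap the summable one tends to 0. *)
Lemma dual_value_asymptotics u (r : R) : C u -> 0 < r ->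
  \forall k \near \oo, Phi xstar - r <=
    Phi u + inner (mu k) (res u) + rhohi / 2 * `|res u| ^+ 2.
Proof.
move=> Cu r0.
have [xt xtP] := near_minimizers.
have [cgap _ sgap _] := gap_convergence xtP.
pose Dv k := E k (xt k) (mu k).
(* [V] and [V - 2 Dv] both converge, which forces the limit of [Dv]. *)
pose Dlim := (Phi xstar - limn (fun k => V k - 2 * Dv k)) / 2.
have cD : Dv @ \oo --> Dlim.
  rewrite (_ : Dv = (fun k => (v k + Phi xstar - (V k - 2 * Dv k)) / 2)); last first.
    by apply/funext => k; rewrite /v; field.
  apply: cvgMl; apply: cvgB => //.
  rewrite -[X in _ --> X]add0r; apply: cvgD; last exact: cvg_cst.
  exact: V_cvg.
have le1 : Phi xstar - Dlim <= 0.
  apply: (weighted_sum_lim gamma_gt0 gamma_div (cvgB e_cvg cD)).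
  apply: bounded_sums_le sgap => k; rewrite ler_pM2l// lerDl.
  exact: eta_ge0.
have ceta : eta @ \oo --> 0.
  apply: cvg_series_cvg_0; apply: bounded_sums_cvg => //.
have r20 : 0 < r / 2 by lra.
have /cvgrPdist_lt/(_ _ r20) n1 := cD.
have /cvgrPdist_lt/(_ _ r20) n2 := ceta.
near=> k.
have h1 : `|Dlim - Dv k| < r / 2 by near: k; exact: n1.
have h2 : `|0 - eta k| < r / 2 by near: k; exact: n2.
have h3 := (xtP k).2 _ Cu; rewrite -/(Dv k) /E in h3.
have h4 := Psi_le k Cu.
have h5 : rho k / 2 * `|res u| ^+ 2 <= rhohi / 2 * `|res u| ^+ 2.
  by rewrite ler_wpM2r ?sqr_ge0//; have := rho_le k; lra.
move: h1 h2; rewrite !ltr_norml => /andP[_ h1] /andP[h2 _].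
rewrite -/(eta k) in h3; lra.
Unshelve. all: by end_near. Qed.

End saddle.

(** The multiplier is quantified inside the conclusion: Opial's argument compares the same iterates
    with every optimal multiplier, not only with a given one. *)
Lemma augmented_lagrangian_asymptotics :
  [/\ bounded_sums (fun k => gamma k * `|A (x k) - b| ^+ 2),
      (fun k => `|A (x k) - b|) @ \oo --> 0
    & forall mustar, (forall u, C u -> Phi xstar <= Phi u + inner mustar (A u - b)) ->
      let w k := Phi (x k) + inner mustar (A (x k) - b) - Phi xstar in
      [/\ bounded_sums (fun k => gamma k * w k.+1), w @ \oo --> 0,
          exists2 B : R, 0 <= B & forall k, `|mu k - mustar| <= B,
          cvgn (fun k => `|mu k - mustar| ^+ 2)
        & forall u r, C u -> 0 < r -> \forall k \near \oo, Phi xstar - r <=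
            Phi u + inner (mu k) (A u - b) + rhohi / 2 * `|A u - b| ^+ 2]].
Proof.
split; [exact: residual_sum|exact: residual_cvg|move=> mustar saddle w; split].
- exact: lagrangian_gap_sum.
- exact: lagrangian_gap_cvg.
- by have [_ _ h] := dual_lyapunov saddle.
- exact: dual_distance_cvg.
- by move=> u r Cu r0; exact: dual_value_asymptotics saddle _ _ Cu r0.
Qed.

End augmented_lagrangian_descent.

(** * Moreau envelopes *)

Section convex_functions.
Context {R : realType} {H : hilbertType R}.
Implicit Types (phi g : H -> \bar R).

Lemma dom_fin_num phi u : phi u != -oo%E -> dom phi u -> phi u \is a fin_num.
Proof. by move=> phiN du; rewrite fin_numElt ltNye phiN. Qed.

Lemma convex_efun_segment phi u v (t : R) : (forall w, phi w != -oo%E) ->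
  convex_efun phi -> dom phi u -> dom phi v -> 0 <= t <= 1 ->
  dom phi (v + t *: (u - v)) /\
  fine (phi (v + t *: (u - v))) <= fine (phi v) + t * (fine (phi u) - fine (phi v)).
Proof.
move=> phiN cvx du dv /andP[t0 t1].
have fu := dom_fin_num (phiN u) du; have fv := dom_fin_num (phiN v) dv.
have [->|tn0] := eqVneq t 0; first by rewrite scale0r addr0 mul0r addr0.
have [->|tn1] := eqVneq t 1.
  by rewrite scale1r addrCA subrr addr0 mul1r addrCA subrr addr0.
have t01 : 0 < t < 1 by rewrite !lt_neqAle t0 t1 eq_sym tn0 tn1.
have := cvx u v t t01; rewrite segmentE -(fineK fu) -(fineK fv) -!EFinM -EFinD.
move=> le1; have dw : dom phi (v + t *: (u - v)).
  by apply: le_lt_trans le1 _; exact: ltry.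
split=> //; move: le1; rewrite -(fineK (dom_fin_num (phiN _) dw)) lee_fin; lra.
Qed.

Lemma subdifferential_le phi p u w : (forall w, phi w != -oo%E) ->
  dom phi p -> dom phi w -> subdifferential phi p u ->
  fine (phi p) + inner u (w - p) <= fine (phi w).
Proof.
move=> phiN dp dw /(_ w).
rewrite -(fineK (dom_fin_num (phiN p) dp)) -(fineK (dom_fin_num (phiN w) dw)).
by rewrite -EFinD lee_fin.
Qed.

(** Evaluated at the proximal point rather than as an infimum, which makes it real-valued;
    [moreau_envelope_le] recovers minimality over [dom g]. *)
Definition moreau_envelope (beta : R) g v : R :=
  fine (g (prox beta g v)) + (2 * beta)^-1 * `|v - prox beta g v| ^+ 2.

Section moreau.
Variable g : H -> \bar R.
Hypotheses (g_pcl : proper_convex_lsc g)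
  (g_sub : exists2 v0, dom g v0 & subdifferential g v0 !=set0).

Let gN w : g w != -oo%E. Proof. by have [[]] := g_pcl. Qed.

Lemma prox_subgradient (beta : R) v : 0 < beta -> dom g (prox beta g v) /\
  subdifferential g (prox beta g v) (beta^-1 *: (v - prox beta g v)).
Proof.
move=> b0; have [g_proper g_cvx g_lsc] := g_pcl.
have [v0 dv0 [u0 u0s]] := g_sub.
apply: prox_objective_subgradient => //.
suff : argmin (fun w => g w + ((2 * beta)^-1 * `|v - w| ^+ 2)%:E)%E !=set0.
  by move=> /(xgetPex 0).
(* The exact minimum over [w] of the affine minorant of [g] at [v0] plus the proximal quadratic. *)
pose low := fine (g v0) + inner u0 (v - v0) - beta / 2 * `|u0| ^+ 2.
apply: (@prox_objective_argmin _ _ _ _ _ b0 g_proper g_cvx g_lsc low) => w dw.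
have h1 := subdifferential_le gN dv0 dw u0s.
have h2 : inner u0 (w - v0) = inner u0 (v - v0) - inner u0 (v - w).
  by rewrite !innerBr; ring.
have := sqr_ge0 `|beta *: u0 - (v - w)|.
rewrite (normB_sqr (beta *: u0)) normZ_sqr innerZl => h3.
have h4 : 0 <= (2 * beta)^-1 * (beta ^+ 2 * `|u0| ^+ 2
    - 2 * (beta * inner u0 (v - w)) + `|v - w| ^+ 2).
  by rewrite mulr_ge0// invr_ge0 mulr_ge0// ltW.
have h5 : (2 * beta)^-1 * (beta ^+ 2 * `|u0| ^+ 2
    - 2 * (beta * inner u0 (v - w)) + `|v - w| ^+ 2) =
  beta / 2 * `|u0| ^+ 2 - inner u0 (v - w) + (2 * beta)^-1 * `|v - w| ^+ 2.
  by field; exact: lt0r_neq0.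
rewrite /low /=; lra.
Qed.

Section fixed_parameter.
Variable beta : R.
Hypothesis beta_gt0 : 0 < beta.
Let p v := prox beta g v.
(** A subgradient of [g] at [p v]. It also acts as the gradient of the envelope at [v], through the
    two-sided estimates below and without any differentiation. *)
Let e v := beta^-1 *: (v - p v).
Let env v := moreau_envelope beta g v.

Let p_sub v : forall w, dom g w -> fine (g (p v)) + inner (e v) (w - p v) <= fine (g w).
Proof.
move=> w dw; have [dp sp] := prox_subgradient v beta_gt0.
exact: subdifferential_le gN dp dw sp.
Qed.

Let dp v : dom g (p v). Proof. by have [] := prox_subgradient v beta_gt0. Qed.

Let pE v : v - p v = beta *: e v.
Proof. by rewrite /e scalerA mulfV ?scale1r// lt0r_neq0. Qed.

Let envE v : env v = fine (g (p v)) + beta / 2 * `|e v| ^+ 2.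
Proof.
by rewrite /env /moreau_envelope -/(p v) pE normZ_sqr; field; exact: lt0r_neq0.
Qed.

Lemma moreau_envelope_le v w : dom g w ->
  moreau_envelope beta g v <= fine (g w) + (2 * beta)^-1 * `|v - w| ^+ 2.
Proof.
move=> dw; rewrite -/(env v) envE; have h1 := p_sub v dw.
have h2 : w - p v = beta *: e v - (v - w).
  by rewrite -pE opprB addrAC addrCA subrr addr0 addrC.
rewrite h2 innerBr innerZr inner_norm in h1.
have := sqr_ge0 `|beta *: e v - (v - w)|.
rewrite (normB_sqr (beta *: e v)) normZ_sqr innerZl => h3.
have h4 : 0 <= (2 * beta)^-1 * (beta ^+ 2 * `|e v| ^+ 2
    - 2 * (beta * inner (e v) (v - w)) + `|v - w| ^+ 2).
  by rewrite mulr_ge0// invr_ge0 mulr_ge0// ltW.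
have h5 : (2 * beta)^-1 * (beta ^+ 2 * `|e v| ^+ 2
    - 2 * (beta * inner (e v) (v - w)) + `|v - w| ^+ 2) =
  beta / 2 * `|e v| ^+ 2 - inner (e v) (v - w) + (2 * beta)^-1 * `|v - w| ^+ 2.
  by field; exact: lt0r_neq0.
lra.
Qed.

Lemma moreau_envelope_le_fun v : dom g v -> moreau_envelope beta g v <= fine (g v).
Proof.
by move=> /(moreau_envelope_le v); rewrite subrr normr0 expr0n/= mulr0 addr0.
Qed.

(** Take [p v] as competitor at [v']: expanding the square gives the right-hand side exactly. *)
Lemma moreau_envelope_smooth v v' :
  moreau_envelope beta g v' <= moreau_envelope beta g v
  + inner (beta^-1 *: (v - prox beta g v)) (v' - v)
  + (2 * beta)^-1 * `|v' - v| ^+ 2.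
Proof.
apply: le_trans (moreau_envelope_le v' (dp v)) _.
rewrite -/(env v) -/(p v) -/(e v) envE.
have -> : v' - p v = beta *: e v + (v' - v).
  by rewrite -pE [RHS]addrC addrA subrK.
rewrite (normD_sqr (beta *: e v)) normZ_sqr innerZl.
rewrite le_eqVlt; apply/orP; left; apply/eqP; field; exact: lt0r_neq0.
Qed.

(** The subgradient inequality for [g] from [p v] to [p v'] leaves the slack
    [beta / 2 * |e v - e v'|^2]. *)
Lemma moreau_envelope_convex v v' :
  moreau_envelope beta g v + inner (beta^-1 *: (v - prox beta g v)) (v' - v)
  <= moreau_envelope beta g v'.
Proof.
rewrite -/(env v) -/(env v') -/(p v) -/(e v) !envE.
have h1 := p_sub v (dp v').
have h2 : p v' - p v = (v' - v) + beta *: e v - beta *: e v'.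
  by rewrite -!pE (addrA (v' - v)) subrK opprB [RHS]addrC addrA subrK.
rewrite h2 (innerBr (e v)) (innerDr (e v)) (innerZr _ _ (e v)) in h1.
rewrite (innerZr _ _ (e v')) inner_norm in h1.
have := sqr_ge0 `|e v - e v'|; rewrite (normB_sqr (e v)) => h3.
have h4 := mulr_ge0 (ltW beta_gt0) h3.
lra.
Qed.

Lemma moreau_envelope_ge v u : dom g v -> subdifferential g v u ->
  fine (g v) <= moreau_envelope beta g v + beta / 2 * `|u| ^+ 2.
Proof.
move=> dv su; have h1 := subdifferential_le gN dv (dp v) su.
rewrite -/(env v) envE.
have h2 : p v - v = - (beta *: e v) by rewrite -pE opprB.
rewrite h2 innerNr innerZr in h1.
have := sqr_ge0 `|e v - u|; rewrite normB_sqr (innerC (e v)) => h3.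
have h4 := mulr_ge0 (ltW beta_gt0) h3.
lra.
Qed.

(** Monotonicity of the subdifferential between [p v] and [v] gives |e|^2 <= <u, e>. The bound is
    uniform in [beta]. *)
Lemma prox_residual_norm v u : dom g v -> subdifferential g v u ->
  `|beta^-1 *: (v - prox beta g v)| ^+ 2 <= `|u| ^+ 2.
Proof.
move=> dv su; rewrite -/(p v) -/(e v).
have h1 := subdifferential_le gN dv (dp v) su.
have h2 := p_sub v dv.
have h3 : p v - v = - (beta *: e v) by rewrite -pE opprB.
rewrite h3 innerNr innerZr in h1; rewrite pE innerZr inner_norm in h2.
have h4 : beta * `|e v| ^+ 2 <= beta * inner u (e v) by lra.
rewrite ler_pM2l// in h4.
have := sqr_ge0 `|u - e v|; rewrite normB_sqr; lra.
Qed.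

End fixed_parameter.

(** The subgradient attached to [beta'] is tested at the proximal point of [beta], and its norm is
    at most [|u|]. A cost proportional to [beta - beta'] telescopes along the iteration. *)
Lemma moreau_envelope_step (beta beta' : R) v u : 0 < beta' -> beta' <= beta ->
  dom g v -> subdifferential g v u ->
  moreau_envelope beta g v <= moreau_envelope beta' g v <=
  moreau_envelope beta g v + (beta - beta') / 2 * `|u| ^+ 2.
Proof.
move=> b'0 bb' dv su; have b0 : 0 < beta by exact: lt_le_trans bb'.
have [dp sp] := prox_subgradient v b0.
have [dp' sp'] := prox_subgradient v b'0.
have h0 := prox_residual_norm b'0 dv su.
have h1 := subdifferential_le gN dp' dp sp'.
have h2 := moreau_envelope_le b0 v dp'.
apply/andP; split.
  apply: le_trans h2 _; rewrite /moreau_envelope lerD2l ler_wpM2r ?sqr_ge0//.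
  by rewrite lef_pV2 ?posrE ?mulr_gt0// ler_pM2l.
rewrite /moreau_envelope; move: h0 h1.
set p := prox beta g v; set p' := prox beta' g v; set e := _ *: _ => h0 h1.
have pE : v - p' = beta' *: e.
  by rewrite /e scalerA mulfV ?scale1r// lt0r_neq0.
have h3 : p - p' = beta' *: e - (v - p).
  by rewrite -pE opprB addrAC addrCA subrr addr0 addrC.
rewrite h3 innerBr innerZr inner_norm in h1.
rewrite pE normZ_sqr.
have := sqr_ge0 `|beta *: e - (v - p)|.
rewrite (normB_sqr (beta *: e)) normZ_sqr innerZl => h4.
have h5 : 0 <= (2 * beta)^-1 * (beta ^+ 2 * `|e| ^+ 2
    - 2 * (beta * inner e (v - p)) + `|v - p| ^+ 2).
  by rewrite mulr_ge0// invr_ge0 mulr_ge0// ltW.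
have h6 : (2 * beta)^-1 * (beta ^+ 2 * `|e| ^+ 2
    - 2 * (beta * inner e (v - p)) + `|v - p| ^+ 2) =
  beta / 2 * `|e| ^+ 2 - inner e (v - p) + (2 * beta)^-1 * `|v - p| ^+ 2.
  by field; exact: lt0r_neq0.
have h7 : (2 * beta')^-1 * (beta' ^+ 2 * `|e| ^+ 2) = beta' / 2 * `|e| ^+ 2.
  by field; exact: lt0r_neq0.
have h8 : (beta - beta') / 2 * `|e| ^+ 2 <= (beta - beta') / 2 * `|u| ^+ 2.
  by rewrite ler_wpM2l// divr_ge0// subr_ge0.
rewrite h7; lra.
Qed.

End moreau.
End convex_functions.

(** * Saddle points, weighted means and smoothness *)

Section saddle_points.
Context {R : realType} {Hp Hd Hv : hilbertType R}.
Variables (A : {linear Hp -> Hd}) (T : {linear Hp -> Hv}) (b : Hd).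
Variables (f h : Hp -> \bar R) (g : Hv -> \bar R).
Hypotheses (fN : forall u, f u != -oo%E) (hN : forall u, h u != -oo%E)
  (gN : forall v, g v != -oo%E).
Hypotheses (Cf : dom h `<=` dom f) (Cg : forall u, dom h u -> dom g (T u)).

Definition real_objective u := fine (f u) + fine (g (T u)) + fine (h u).
Let Phi := real_objective.
Let gap_condition xs ms := forall u, dom h u ->
  Phi xs <= Phi u + inner ms (A u - b).

Lemma objectiveE u : dom h u -> objective T f h g u = (Phi u)%:E.
Proof.
move=> Cu; rewrite /objective /Phi /real_objective.
have ff := dom_fin_num (fN u) (Cf Cu); have fh := dom_fin_num (hN u) Cu.
have fg := dom_fin_num (gN (T u)) (Cg Cu).
by rewrite -{1}(fineK ff) -{1}(fineK fg) -{1}(fineK fh) -!EFinD.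
Qed.

Lemma objective_pinfty u : ~ dom h u -> objective T f h g u = +oo%E.
Proof.
move=> nCu; have hy : h u = +oo%E.
  by apply/eqP; rewrite -leye_eq leNgt; apply/negP.
rewrite /objective hy addey//.
by move: (fN u) (gN (T u)); case: (f u) => [r| |]//; case: (g (T u)).
Qed.

Lemma lagrangianE u m : dom h u ->
  lagrangian A T b f h g u m = (Phi u + inner m (A u - b))%:E.
Proof. by move=> Cu; rewrite /lagrangian objectiveE// EFinD. Qed.

Lemma saddle_pointE xs ms : dom h !=set0 -> saddle_point A T b f h g xs ms ->
  [/\ dom h xs, A xs = b & gap_condition xs ms].
Proof.
move=> [x0 Cx0] [sd sp].
have Cxs : dom h xs.
  apply: contrapT => nC; have := sp x0.
  by rewrite (lagrangianE _ Cx0) /lagrangian (objective_pinfty nC) addye.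
have Axs : A xs = b.
  apply/eqP; rewrite -subr_eq0 -normr_eq0 -sqrf_eq0; apply/eqP.
  apply: le_anti; rewrite sqr_ge0 andbT.
  (* Moving the multiplier in the direction of the residual would raise the Lagrangian by its
     squared norm. *)
  have := sd (ms + (A xs - b)).
  by rewrite !lagrangianE// lee_fin lerD2l innerDl inner_norm gerDl.
split=> // u Cu; have := sp u.
by rewrite !lagrangianE// lee_fin Axs subrr inner0r addr0.
Qed.

Lemma saddle_pointI xs ms : dom h xs -> A xs = b -> gap_condition xs ms ->
  saddle_point A T b f h g xs ms.
Proof.
move=> Cxs Axs gap; split=> [m|u].
  by rewrite !lagrangianE// Axs subrr !inner0r.
have [Cu|nCu] := pselect (dom h u); last first.
  have -> : lagrangian A T b f h g u ms = +oo%E.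
    by rewrite /lagrangian objective_pinfty// addye.
  exact: leey.
by rewrite !lagrangianE// lee_fin Axs subrr inner0r addr0; exact: gap.
Qed.

Lemma primal_solutionI xs ms xb : dom h xs -> A xs = b ->
  gap_condition xs ms -> dom h xb -> A xb = b -> Phi xb <= Phi xs ->
  primal_solution A T b f h g xb.
Proof.
move=> Cxs Axs gap Cxb Axb le1; split=> // y Ay.
have [Cy|nCy] := pselect (dom h y); last first.
  by rewrite (objective_pinfty nCy) leey.
rewrite !objectiveE// lee_fin (le_trans le1)//.
by have := gap y Cy; rewrite Ay subrr inner0r addr0.
Qed.

Lemma primal_solutionE xs xb : dom h xs -> A xs = b ->
  primal_solution A T b f h g xb ->
  [/\ dom h xb, A xb = b & Phi xb <= Phi xs].
Proof.
move=> Cxs Axs [Axb /(_ xs Axs)]; rewrite (objectiveE Cxs) => le1.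
have Cxb : dom h xb.
  by apply: contrapT => nC; move: le1; rewrite objective_pinfty.
by split=> //; move: le1; rewrite objectiveE// lee_fin.
Qed.

(** Testing the conjugate at [xs] shows that every dual value is at least [- Phi xs]; the gap
    condition bounds the value at [ms] by the same number. *)
Lemma saddle_dual_solution xs ms : bounded_operator A -> dom h xs ->
  A xs = b -> gap_condition xs ms -> dual_solution A T b f h g ms.
Proof.
move=> bA Cxs Axs gap m; rewrite /dual_objective.
have adj m' u : inner (- adjoint A m') u = - inner m' (A u).
  by rewrite innerNl adjointE.
have low : ((- Phi xs - inner m b)%:E <= conjugate (objective T f h g)
    (- adjoint A m)%R)%E.
  apply: ereal_sup_ubound; exists xs => //.
  by rewrite adj Axs objectiveE// -EFinB addrC.
have up : (conjugate (objective T f h g) (- adjoint A ms)%R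
    <= (- Phi xs - inner ms b)%:E)%E.
  apply: ge_ereal_sup => _ [u _ <-].
  have [Cu|nCu] := pselect (dom h u); last first.
    by rewrite objective_pinfty// leNye.
  rewrite adj objectiveE// -EFinB lee_fin.
  by have := gap u Cu; rewrite innerBr; lra.
apply: (@le_trans _ _ (- Phi xs)%:E).
  apply: le_trans (leeD2r _ up) _.
  by rewrite -EFinD subrK.
apply: le_trans (leeD2r _ low).
by rewrite -EFinD subrK.
Qed.

End saddle_points.

Section weighted_means.
Context {R : realType} {H : hilbertType R}.
Variables (gamma : nat -> R) (C : set H) (phi : H -> R) (u : nat -> H).
Hypothesis gamma0 : forall k, 0 < gamma k.
Hypothesis C_cvx : forall u v (t : R), C u -> C v -> 0 <= t <= 1 ->
  C (v + t *: (u - v)).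
Hypothesis phi_cvx : forall u v (t : R), C u -> C v -> 0 <= t <= 1 ->
  phi (v + t *: (u - v)) <= phi v + t * (phi u - phi v).
Hypothesis Cu : forall k, C (u k).

Lemma weighted_mean0 : weighted_mean gamma u 0 = u 0%N.
Proof.
rewrite /weighted_mean /psum !big_ord_recl !big_ord0 !addr0 scalerA.
by rewrite mulVf ?scale1r// lt0r_neq0.
Qed.

Lemma weighted_meanS k : weighted_mean gamma u k.+1 = weighted_mean gamma u k
  + (gamma k.+1 / psum gamma k.+1) *: (u k.+1 - weighted_mean gamma u k).
Proof.
have p0 := psum_gt0 gamma0 k; have p1 := psum_gt0 gamma0 k.+1.
rewrite /weighted_mean big_ord_recr/=.
set S := \sum_(i < k.+1) _.
rewrite scalerDr scalerBr !scalerA [RHS]addrCA [RHS]addrC -scalerBl.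
congr (_ *: _ + _ *: _); last by rewrite mulrC.
by rewrite psumS in p1 *; field; rewrite !lt0r_neq0.
Qed.

(** Jensen multiplied by the total weight, so that the induction only adds one term; each mean is a
    convex combination of the previous one and a new point. *)
Lemma weighted_mean_jensen k : C (weighted_mean gamma u k) /\
  phi (weighted_mean gamma u k) * psum gamma k
    <= \sum_(0 <= i < k.+1) gamma i * phi (u i).
Proof.
elim: k => [|k [Cm IH]].
  rewrite weighted_mean0; split=> //.
  by rewrite psumE !big_nat1 mulrC.
rewrite weighted_meanS.
have p0 := psum_gt0 gamma0 k; have p1 := psum_gt0 gamma0 k.+1.
have t01 : 0 <= gamma k.+1 / psum gamma k.+1 <= 1.
  apply/andP; split; first by rewrite divr_ge0// ltW.
  by rewrite ler_pdivrMr// mul1r psumS lerDr ltW.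
split; first exact: C_cvx.
have := phi_cvx (Cu k.+1) Cm t01; rewrite -(ler_pM2r p1) => /le_trans; apply.
rewrite big_nat_recr//=.
apply: le_trans (lerD IH (lexx _)).
have qP : gamma k.+1 / psum gamma k.+1 * psum gamma k.+1 = gamma k.+1.
  by rewrite divfK// lt0r_neq0.
rewrite mulrDl [X in _ + X]mulrAC qP psumS; lra.
Qed.

End weighted_means.

Section smoothness.
Context {R : realType} {H : hilbertType R}.
Variables (F f : H -> \bar R) (zeta : R -> R) (C : set H).
Hypothesis C_cvx : forall u v (t : R), C u -> C v -> 0 <= t <= 1 ->
  C (v + t *: (u - v)).
Hypothesis f_cvx : forall u v (t : R), C u -> C v -> 0 <= t <= 1 ->
  fine (f (v + t *: (u - v))) <= fine (f v) + t * (fine (f u) - fine (f v)).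
Hypothesis smooth : Fzeta_smooth F zeta f C.

Lemma gradient_inequality x u : C x -> C u ->
  fine (f x) + inner (gradient f x) (u - x) <= fine (f u).
Proof.
move=> Cx Cu; have [_ _ _ [C0 [_ CC0 _ dC0 _]] _] := smooth.
have [_ [_ df]] := dC0 x (CC0 _ Cx).
rewrite -lerBrDl; apply: gradient_le => // t /andP[t0 t1].
by apply: f_cvx => //; rewrite !ltW.
Qed.

(* f inherits the Bregman bound of F because F - f is convex. *)
Lemma Fzeta_descent : exists2 K : R, 0 <= K &
  forall x s (r : R), C x -> C s -> 0 < r <= 1 ->
  fine (f (x + r *: (s - x))) <=
    fine (f x) + r * inner (gradient f x) (s - x) + K * zeta r.
Proof.
have [_ zeta0 _ [C0 [_ CC0 _ dC0 cvxFf]] Klt] := smooth.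
exists `|fine (smoothness_const F zeta C)| => // x s r Cx Cs r01.
have [/= _ dF] := (dC0 x (CC0 _ Cx)).1; have [_ df] := (dC0 x (CC0 _ Cx)).2.
have /andP[r0 r1] := r01.
set z := x + _.
have Cz : C z by apply: C_cvx => //; rewrite r1 ltW.
have zx : z - x = r *: (s - x) by rewrite /z addrC addKr.
have bregF : bregman F z x <= `|fine (smoothness_const F zeta C)| * zeta r.
  have le1 : ((bregman F z x)%:E / (zeta r)%:E <= smoothness_const F zeta C)%E.
    by apply: ereal_sup_ubound; exists x, s, r.
  (* The degenerate choice [s = x] contributes the value 0 to the supremum, even where [zeta]
     vanishes. *)
  have K0 : (0 <= smoothness_const F zeta C)%E.
    have C1 : C (x + r *: (x - x)) by rewrite subrr scaler0 addr0.
    apply: ereal_sup_ubound; exists x, x, r; split=> //.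
    rewrite subrr scaler0 addr0 /bregman !subrr inner0r subrr.
    by rewrite mul0e.
  have Kf : smoothness_const F zeta C \is a fin_num.
    by rewrite ge0_fin_numE.
  (* Where [zeta r] is 0, a positive Bregman distance would give the quotient [+oo], so finiteness
     of the supremum makes it nonpositive. *)
  have [z0|zn0] := eqVneq (zeta r) 0.
    move: le1; rewrite z0 mulr0 inver eqxx.
    have [//|b0] := leP (bregman F z x) 0.
    by rewrite gt0_muley ?lte_fin// leye_eq => /eqP E; rewrite E in Klt.
  have zp : 0 < zeta r by rewrite lt0r zn0 zeta0.
  move: le1; rewrite inver (negbTE zn0) -EFinM -(fineK Kf) lee_fin.
  rewrite ler_pdivrMr// => /le_trans; apply.
  by rewrite ler_wpM2r ?zeta0// ler_norm.
have gradFf : inner (gradient F x) (z - x) - inner (gradient f x) (z - x) <=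
    (fine (F z) - fine (f z)) - (fine (F x) - fine (f x)).
  apply: gradientB_le => // t t01.
  have t01' := t01; case/andP: t01' => t0 t1.
  have Ct : C (x + t *: (z - x)) by apply: C_cvx => //; rewrite !ltW.
  have := cvxFf z x t (CC0 _ Cz) (CC0 _ Cx) t01.
  by rewrite segmentE => /(_ (CC0 _ Ct)); lra.
have alg (p q v : H) (Fz Fx fz fx k : R) :
    Fz - Fx - inner p (r *: v) <= k ->
    inner p (r *: v) - inner q (r *: v) <= (Fz - fz) - (Fx - fx) ->
    fz <= fx + r * inner q v + k.
  by clear; rewrite !innerZr; lra.
rewrite /bregman zx in bregF; rewrite zx in gradFf.
exact: alg bregF gradFf.
Qed.

End smoothness.

(** * The conditional gradient step *)

Section one_step.
Context {R : realType} {Hp Hd Hv : hilbertType R}.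
Variables (A : {linear Hp -> Hd}) (T : {linear Hp -> Hv}) (b : Hd).
Variables (f h : Hp -> \bar R) (g : Hv -> \bar R).
Variables (C : set Hp) (B MA MT KF : R) (zeta : R -> R).
Hypotheses (bA : bounded_operator A) (bT : bounded_operator T).
Hypothesis A_le : forall u, `|A u| <= MA * `|u|.
Hypothesis T_le : forall u, `|T u| <= MT * `|u|.
Hypothesis MA0 : 0 <= MA.
Hypothesis MT0 : 0 <= MT.
Hypothesis B0 : 0 <= B.
Hypothesis C_bnd : forall u, C u -> `|u| <= B.
Hypothesis hN : forall u, h u != -oo%E.
Hypothesis C_dom : C = dom h.
Hypothesis h_cvx : forall u v (t : R), C u -> C v -> 0 <= t <= 1 ->
  fine (h (v + t *: (u - v))) <= fine (h v) + t * (fine (h u) - fine (h v)).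
Hypothesis f_grad : forall x u, C x -> C u ->
  fine (f x) + inner (gradient f x) (u - x) <= fine (f u).
Hypothesis f_smooth : forall x s (r : R), C x -> C s -> 0 < r <= 1 ->
  fine (f (x + r *: (s - x))) <=
    fine (f x) + r * inner (gradient f x) (s - x) + KF * zeta r.
Hypothesis g_pcl : proper_convex_lsc g.
Hypothesis g_sub : exists2 v0, dom g v0 & subdifferential g v0 !=set0.

Let E (beta rho : R) m u := fine (f u) + fine (h u)
  + moreau_envelope beta g (T u) + inner m (A u - b)
  + rho / 2 * `|A u - b| ^+ 2.

(** The term containing [mu] is affine and is reproduced exactly, so the error is free of [mu]: it
    collects the curvatures of [f], of the envelope and of the penalty, then the two noises. *)
Lemma conditional_gradient_step (gamma beta rho rhohi lams : R)
    (x z s shat lam : Hp) (mu : Hd) :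
  0 < gamma <= 1 -> 0 < beta -> 0 < rho <= rhohi -> C x -> C shat ->
  z = gradient f x + beta^-1 *: adjoint T (T x - prox beta g (T x))
      + adjoint A mu + rho *: adjoint A (A x - b) + lam ->
  argmin (fun v => h v + (inner z v)%:E)%E s ->
  (h shat + (inner z shat)%:E <= h s + (inner z s)%:E + lams%:E)%E ->
  forall u, C u ->
  E beta rho mu (x + gamma *: (shat - x)) <= (1 - gamma) * E beta rho mu x
    + gamma * E beta rho mu u - gamma * rho / 2 * `|A u - A x| ^+ 2
    + (KF * zeta gamma + (MT * (2 * B)) ^+ 2 / 2 * (gamma ^+ 2 / beta)
       + rhohi / 2 * (MA * (2 * B)) ^+ 2 * gamma ^+ 2
       + (2 * B) * (gamma * `|lam|) + gamma * lams).
Proof.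
move=> g01 b0 /andP[r0 rhi] Cx Cs zE smin shatle u Cu.
have /andP[g0 g1] := g01.
have diam v w : C v -> C w -> `|v - w| <= 2 * B.
  move=> Cv Cw; apply: le_trans (ler_normB _ _) _.
  by have := C_bnd Cv; have := C_bnd Cw; lra.
set e := beta^-1 *: (T x - prox beta g (T x)).
set a := A x - b.
have fi := f_grad Cx Cu; have fs := f_smooth Cx Cs g01.
move: (gradient f x) zE fi fs => gr zE fi fs.
(* The noiseless gradient of the smooth part of [E] at [x], as a functional. *)
pose Z v := inner gr v + inner e (T v) + inner mu (A v) + rho * inner a (A v).
have zv v : inner z v = Z v + inner lam v.
  rewrite zE !innerDl !innerZl !adjointE// /Z /e innerZl.
  by rewrite -/a; ring.
have ZB v w : Z (v - w) = Z v - Z w.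
  by rewrite /Z !linearB !innerBr; ring.
have gi := moreau_envelope_convex g_pcl g_sub b0 (T x) (T u).
have gs := moreau_envelope_smooth g_pcl g_sub b0 (T x) (T (x + gamma *: (shat - x))).
rewrite -/e in gi gs.
have fin_h v : C v -> h v \is a fin_num.
  by rewrite C_dom => dv; exact: dom_fin_num.
have hsz : fine (h shat) + inner z shat <= fine (h u) + inner z u + lams.
  have := le_trans shatle (leeD2r lams%:E (smin u)).
  by rewrite -(fineK (fin_h _ Cu)) -(fineK (fin_h _ Cs)) -!EFinD lee_fin.
have hseg := h_cvx Cs Cx (t := gamma).
have {}hseg := hseg (introT andP (conj (ltW g0) g1)).
pose q := shat - x.
have Tx' : T (x + gamma *: q) - T x = gamma *: T q.
  by rewrite linearD linearZ addrAC subrr add0r.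
have Ax' : A (x + gamma *: q) - b = a + gamma *: A q.
  by rewrite linearD linearZ addrAC.
rewrite -/q in fs gs hseg *; rewrite Tx' innerZr normZ_sqr in gs.
have Tq : `|T q| ^+ 2 <= (MT * (2 * B)) ^+ 2.
  rewrite ler_sqr ?nnegrE ?mulr_ge0//; apply: le_trans (T_le _) _.
  by rewrite ler_wpM2l//; exact: diam.
have Aq : `|A q| ^+ 2 <= (MA * (2 * B)) ^+ 2.
  rewrite ler_sqr ?nnegrE ?mulr_ge0//; apply: le_trans (A_le _) _.
  by rewrite ler_wpM2l//; exact: diam.
have lamb : inner lam (u - shat) <= 2 * B * `|lam|.
  apply: le_trans (inner_le _ _) _; rewrite mulrC ler_wpM2r//.
  exact: diam.
(* First-order decrease towards [shat] against the competitor [u]. Convexity handles [f] and the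
   envelope, while the penalty is expanded exactly; that expansion leaves the term in |A u - A
   x|^2. *)
have key : fine (h shat) - fine (h x) + Z q <= E beta rho mu u - E beta rho mu x
    - rho / 2 * `|A u - A x| ^+ 2 + (2 * B * `|lam| + lams).
  have zux : Z (u - x) <= fine (f u) - fine (f x) + (moreau_envelope beta g (T u)
      - moreau_envelope beta g (T x)) + (inner mu (A u) - inner mu (A x))
      + rho / 2 * (`|A u - b| ^+ 2 - `|a| ^+ 2 - `|A u - A x| ^+ 2).
    have Aub : A u - b = a + (A u - A x).
      by rewrite /a [RHS]addrC addrA subrK.
    rewrite Aub (normD_sqr a) /Z !linearB -(innerBr mu).
    by move: gi fi; lra.
  rewrite !zv in hsz.
  rewrite /E /q ZB; rewrite ZB in zux.
  rewrite innerBr in lamb; rewrite !(innerBr mu).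
  by move: zux hsz lamb; rewrite -/a; lra.
have gkey := ler_wpM2l (ltW g0) key.
have gTq : (2 * beta)^-1 * (gamma ^+ 2 * `|T q| ^+ 2)
    <= (MT * (2 * B)) ^+ 2 / 2 * (gamma ^+ 2 / beta).
  have : (gamma ^+ 2 / beta) / 2 * `|T q| ^+ 2 <=
      (gamma ^+ 2 / beta) / 2 * (MT * (2 * B)) ^+ 2.
    by rewrite ler_wpM2l// !divr_ge0 ?sqr_ge0// ltW.
  rewrite invfM; lra.
have gAq : rho / 2 * (gamma ^+ 2 * `|A q| ^+ 2)
    <= rhohi / 2 * (MA * (2 * B)) ^+ 2 * gamma ^+ 2.
  have h1 : gamma ^+ 2 * `|A q| ^+ 2 <= gamma ^+ 2 * (MA * (2 * B)) ^+ 2.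
    by rewrite ler_wpM2l// sqr_ge0.
  have h2 : rho / 2 * (gamma ^+ 2 * `|A q| ^+ 2)
      <= rhohi / 2 * (gamma ^+ 2 * (MA * (2 * B)) ^+ 2).
    apply: ler_pM => //; [by rewrite divr_ge0// ltW| |by rewrite ler_pM2r].
    by rewrite mulr_ge0 ?sqr_ge0.
  by move: h2; lra.
have Ex' : E beta rho mu (x + gamma *: q) <= E beta rho mu x
    + gamma * (fine (h shat) - fine (h x) + Z q)
    + (KF * zeta gamma + (MT * (2 * B)) ^+ 2 / 2 * (gamma ^+ 2 / beta)
       + rhohi / 2 * (MA * (2 * B)) ^+ 2 * gamma ^+ 2).
  rewrite /E Ax' -/a (normD_sqr a) innerDr !innerZr normZ_sqr /Z.
  move: fs gs hseg gTq gAq.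
  by lra.
move: Ex' gkey.
set E1 := E beta rho mu (_ + _); set E2 := E beta rho mu x.
set E3 := E beta rho mu u.
by lra.
Qed.

End one_step.

(** * Pathwise convergence *)

Section rates.
Context {R : realType}.

Lemma eqO_bound (u v : nat -> R) (K : R) :
  (forall k, `|u k| <= K * `|v k|) -> u =O_\oo v.
Proof.
move=> uv; apply/eqOP; near=> M; near=> k.
by apply: le_trans (uv k) _; rewrite ler_wpM2r.
Unshelve. all: by end_near. Qed.

Lemma ebigO_bound (u : nat -> \bar R) (v : nat -> R) (K : R) :
  (forall k, 0 <= v k) -> (forall k, 0 <= u k)%E ->
  (forall k, u k <= (K * v k)%:E)%E -> ebigO u v.
Proof.
move=> v0 u0 uv; exists K; apply: nearW => k.
by rewrite gee0_abs// ger0_norm.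
Qed.

Lemma le_sqrt_rate (r B G : R) : 0 <= r -> 0 < G -> r ^+ 2 * G <= B ->
  r <= Num.sqrt B * (Num.sqrt G)^-1.
Proof.
move=> r0 G0 rB; rewrite ler_pdivlMr ?sqrtr_gt0//.
have := ler_wsqrtr rB; rewrite sqrtrM ?sqr_ge0// sqrtr_sqr ger0_norm//.
Qed.

End rates.

Section icgalp_realization.
Context {R : realType} {Hp Hd Hv : hilbertType R}.
Variables (A : {linear Hp -> Hd}) (T : {linear Hp -> Hv}) (b : Hd).
Variables (f h : Hp -> \bar R) (g : Hv -> \bar R).
Variables (F : Hp -> \bar R) (zeta : R -> R).
Variables (gamma beta theta rho : nat -> R) (Mlo Mhi rholo rhohi c : R).
Variables (xstar : Hp) (mustar : Hd).
Let C := dom h.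
Let Phi := real_objective T f h g.
Hypotheses (bA : bounded_operator A) (bT : bounded_operator T).
Hypotheses (g_pcl : proper_convex_lsc g) (f_pcl : proper_convex_lsc f)
  (gT_pcl : proper_convex_lsc (fun v => g (T v))) (h_pcl : proper_convex_lsc h).
Hypothesis smooth : Fzeta_smooth F zeta f C.
Hypothesis C_wcompact : weakly_compact C.
Hypothesis sub_ne : forall v, C v -> subdifferential g (T v) !=set0.
Hypothesis sub_bnd :
  (ereal_sup [set `|min_norm_element (subdifferential g (T v))|%:E | v in C]
    < +oo)%E.
Hypothesis h_lip : exists2 Lh : R, 0 <= Lh & forall u v, C u -> C v ->
  (`|h u - h v| <= (Lh * `|u - v|)%:E)%E.
Hypothesis saddle : saddle_point A T b f h g xstar mustar.
Hypothesis gamma01 : forall k, 0 < gamma k <= 1.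
Hypothesis beta_gt0 : forall k, 0 < beta k.
Hypothesis zeta_sum : ell1_plus (fun k => zeta (gamma k)).
Hypothesis gamma2beta_sum : ell1_plus (fun k => gamma k ^+ 2 / beta k).
Hypothesis gammabeta_sum : ell1_plus (fun k => gamma k * beta k).
Hypothesis gamma_div : ~ cvgn (series gamma).
Hypothesis beta_dec : nonincreasing_seq beta.
Hypothesis beta_cvg : beta @ \oo --> 0.
Hypothesis rho_inc : nondecreasing_seq rho.
Hypothesis rholo_gt0 : 0 < rholo.
Hypothesis rho_bnd : forall k, rholo <= rho k <= rhohi.
Hypothesis Mlo_ge1 : 1 <= Mlo.
Hypothesis gamma_ratio : forall k, Mlo <= gamma k / gamma k.+1 <= Mhi.
Hypothesis c_gt0 : 0 < c.
Hypothesis thetaE : forall k, theta k = gamma k / c.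
Hypothesis Mhi_lt : Mhi / c - rholo / 2 < 0.

Lemma f_ninfty u : f u != -oo%E. Proof. by have [[]] := f_pcl. Qed.
Lemma h_ninfty u : h u != -oo%E. Proof. by have [[]] := h_pcl. Qed.
Lemma g_ninfty v : g v != -oo%E. Proof. by have [[]] := g_pcl. Qed.
Let fN := f_ninfty. Let hN := h_ninfty. Let gN := g_ninfty.

Let C_ne : C !=set0. Proof. by have [[]] := h_pcl. Qed.

Let Cf : C `<=` dom f. Proof. by have [] := smooth. Qed.

Lemma dom_g_range u : C u -> dom g (T u).
Proof.
move=> Cu; have [v vs] := sub_ne Cu; have [[_ [w dw]] _ _] := g_pcl.
have := vs w; rewrite /dom /=.
case: (g (T u)) => [r _| |//]; first exact: ltry.
by rewrite addye// => /(le_lt_trans)/(_ dw); rewrite ltxx.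
Qed.
Let Cg := dom_g_range.

Let g_sub : exists2 v0, dom g v0 & subdifferential g v0 !=set0.
Proof. by have [u Cu] := C_ne; exists (T u); [exact: Cg|exact: sub_ne]. Qed.

Lemma dom_h_convex u v (t : R) : C u -> C v -> 0 <= t <= 1 ->
  C (v + t *: (u - v)).
Proof.
move=> Cu Cv t01; have [_ h_cvx _] := h_pcl.
by have [] := convex_efun_segment hN h_cvx Cu Cv t01.
Qed.
Let C_cvx := dom_h_convex.

Let h_cvx u v (t : R) : C u -> C v -> 0 <= t <= 1 ->
  fine (h (v + t *: (u - v))) <= fine (h v) + t * (fine (h u) - fine (h v)).
Proof.
move=> Cu Cv t01; have [_ cvx _] := h_pcl.
by have [] := convex_efun_segment hN cvx Cu Cv t01.
Qed.

Let f_cvx u v (t : R) : C u -> C v -> 0 <= t <= 1 ->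
  fine (f (v + t *: (u - v))) <= fine (f v) + t * (fine (f u) - fine (f v)).
Proof.
move=> Cu Cv t01; have [_ cvx _] := f_pcl.
by have [] := convex_efun_segment fN cvx (Cf Cu) (Cf Cv) t01.
Qed.

Let f_grad := gradient_inequality f_cvx smooth.

Lemma real_objective_convex u v (t : R) : C u -> C v -> 0 <= t <= 1 ->
  Phi (v + t *: (u - v)) <= Phi v + t * (Phi u - Phi v).
Proof.
move=> Cu Cv t01; have [_ gT_cvx _] := gT_pcl.
have := h_cvx Cu Cv t01; have := f_cvx Cu Cv t01.
have [_] := convex_efun_segment (fun w => gN (T w)) gT_cvx (Cg Cu) (Cg Cv) t01.
by rewrite /Phi /real_objective; lra.
Qed.
Let Phi_cvx := real_objective_convex.

Let Cbnd : exists2 B : R, 0 <= B & forall u, C u -> `|u| <= B.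
Proof. exact: weakly_compact_bounded. Qed.

Let subg_bnd : exists2 M : R, 0 <= M & forall u, C u ->
  exists2 v, subdifferential g (T u) v & `|v| <= M.
Proof.
have := sub_bnd; set S := ereal_sup _ => Slt.
exists `|fine S| => // u Cu.
exists (min_norm_element (subdifferential g (T u))).
  by apply: subdifferential_min_norm; [have [] := g_pcl|exact: sub_ne].
have le1 : (`|min_norm_element (subdifferential g (T u))|%:E <= S)%E.
  by apply: ereal_sup_ubound; exists u.
have Sf : S \is a fin_num.
  rewrite ge0_fin_numE//; apply: le_trans le1; rewrite lee_fin; exact: normr_ge0.
by move: le1; rewrite -{1}(fineK Sf) lee_fin => /le_trans; apply; exact: ler_norm.
Qed.

Let op_bnd {K : hilbertType R} (L : {linear Hp -> K}) : bounded_operator L ->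
  exists2 M : R, 0 <= M & forall u, `|L u| <= M * `|u|.
Proof.
move=> [M LM]; exists `|M| => // u; apply: le_trans (LM u) _.
by rewrite ler_wpM2r// ler_norm.
Qed.

Lemma h_bounded : exists D : R, forall u, C u -> `|fine (h u)| <= D.
Proof.
have [B B0 CB] := Cbnd; have [L L0 hL] := h_lip; have [x0 Cx0] := C_ne.
exists (`|fine (h x0)| + L * (2 * B)) => u Cu.
have := hL u x0 Cu Cx0.
have fu := dom_fin_num (hN u) Cu; have f0 := dom_fin_num (hN x0) Cx0.
rewrite -(fineK fu) -(fineK f0) -EFinB abse_EFin lee_fin => le1.
have le2 : L * `|u - x0| <= L * (2 * B).
  rewrite ler_wpM2l//; apply: le_trans (ler_normB _ _) _.
  by have := CB u Cu; have := CB x0 Cx0; lra.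
rewrite -[fine (h u)](subrK (fine (h x0))).
apply: le_trans (ler_normD _ _) _; rewrite addrC lerD2l.
exact: le_trans le1 le2.
Qed.

Lemma real_objective_bounded : exists D : R, forall u, C u -> `|Phi u| <= D.
Proof.
have [B B0 CB] := Cbnd; have [Dh hD] := h_bounded; have [x0 Cx0] := C_ne.
have [M M0 subM] := subg_bnd; have [MT MT0 TM] := op_bnd bT.
have [KF KF0 fs] := Fzeta_descent C_cvx smooth.
have diam v w : C v -> C w -> `|v - w| <= 2 * B.
  move=> Cv Cw; apply: le_trans (ler_normB _ _) _.
  by have := CB v Cv; have := CB w Cw; lra.
have diamT v w : C v -> C w -> `|T v - T w| <= MT * (2 * B).
  move=> Cv Cw; rewrite -linearB; apply: le_trans (TM _) _.
  by rewrite ler_wpM2l//; exact: diam.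
have gdiff v w : C v -> C w -> fine (g (T v)) - fine (g (T w)) <= M * (MT * (2 * B)).
  move=> Cv Cw; have [e es eM] := subM v Cv.
  have h1 := subdifferential_le gN (Cg Cv) (Cg Cw) es.
  have h2 : inner e (T v - T w) <= M * (MT * (2 * B)).
    apply: le_trans (inner_le _ _) _.
    by apply: ler_pM => //; exact: diamT.
  by rewrite -opprB innerNr in h1; move: h1 h2; lra.
(* Lower bound from the gradient inequality at [x0]; upper bound from the smoothness estimate with
   the full step [r = 1], which lands on [u]. *)
have [G0 fdiff] : exists G0 : R, forall u, C u -> `|fine (f u) - fine (f x0)| <= G0.
  have := fun u => f_grad (u := u) Cx0.
  have := fun u => fs x0 u 1 Cx0.
  move: (gradient f x0) => gr h1 h2.
  exists (`|gr| * (2 * B) + KF * `|zeta 1|) => u Cu.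
  have i1 := h2 u Cu.
  have i2 : fine (f u) <= fine (f x0) + inner gr (u - x0) + KF * zeta 1.
    have := h1 u Cu; rewrite ltr01 lexx scale1r mul1r => /(_ isT).
    by rewrite addrC subrK.
  have i3 : `|inner gr (u - x0)| <= `|gr| * (2 * B).
    by apply: le_trans (inner_normM _ _) _; rewrite ler_wpM2l//; exact: diam.
  have i4 : KF * zeta 1 <= KF * `|zeta 1| by rewrite ler_wpM2l// ler_norm.
  have i5 : 0 <= KF * `|zeta 1| by rewrite mulr_ge0.
  move: i3; rewrite ler_norml => /andP[i31 i32].
  by rewrite ler_norml; apply/andP; split; lra.
exists (`|fine (f x0)| + G0 + (`|fine (g (T x0))| + M * (MT * (2 * B))) + Dh).
move=> u Cu; rewrite /Phi /real_objective.
have j1 := fdiff u Cu; have j2 := gdiff u x0 Cu Cx0; have j3 := gdiff x0 u Cx0 Cu.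
have j4 := hD u Cu.
have k1 : `|fine (f u)| <= `|fine (f x0)| + G0.
  rewrite -[fine (f u)](subrK (fine (f x0))).
  by apply: le_trans (ler_normD _ _) _; rewrite addrC lerD2l.
have k2 : `|fine (g (T u))| <= `|fine (g (T x0))| + M * (MT * (2 * B)).
  rewrite -[fine (g (T u))](subrK (fine (g (T x0)))).
  apply: le_trans (ler_normD _ _) _; rewrite addrC lerD2l.
  by rewrite ler_norml; apply/andP; split; lra.
apply: le_trans (ler_normD _ _) _; apply: lerD => //.
by apply: le_trans (ler_normD _ _) _; exact: lerD.
Qed.

Let star : [/\ C xstar, A xstar = b
  & forall u, C u -> Phi xstar <= Phi u + inner mustar (A u - b)].
Proof. exact: saddle_pointE fN hN gN Cf Cg _ _ C_ne saddle. Qed.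

Let Cxstar : C xstar. Proof. by have [] := star. Qed.
Let Axstar : A xstar = b. Proof. by have [] := star. Qed.
Let gap_star u : C u -> Phi xstar <= Phi u + inner mustar (A u - b).
Proof. by have [_ _] := star; exact. Qed.

Let gamma_gt0 k : 0 < gamma k. Proof. by have /andP[] := gamma01 k. Qed.
Let gamma_le1 k : gamma k <= 1. Proof. by have /andP[] := gamma01 k. Qed.

Let gamma_dec k : gamma k.+1 <= gamma k.
Proof.
have /andP[+ _] := gamma_ratio k; move=> /(le_trans Mlo_ge1).
by rewrite ler_pdivlMr// mul1r.
Qed.

Section realization.
Variables (lam : nat -> Hp) (lams : nat -> R).
Variables (x : nat -> Hp) (mu : nat -> Hd) (y : nat -> Hv) (z s shat : nat -> Hp).
Hypothesis iter : icgalp_iteration A T b f h g gamma beta theta rho lam lams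
  x mu y z s shat.
Hypothesis lams_ge0 : forall k, 0 <= lams k.
Hypothesis lam_sum : bounded_sums (fun k => gamma k * `|lam k|).
Hypothesis lams_sum : bounded_sums (fun k => gamma k * lams k).

(** Comparison with a point of [C] makes the minimal value of the linearized problem less than
    [+oo], and the finite error [lams k] keeps it so at [shat k]. *)
Let Cshat k : C (shat k).
Proof.
have [x0 Cx0] := C_ne; have := icgalp_shat iter k.
have := icgalp_s iter k x0 => /= h1 h2.
have sfin : (h (s k) + (inner (z k) (s k))%:E < +oo)%E.
  apply: le_lt_trans h1 _.
  by rewrite -(fineK (dom_fin_num (hN x0) Cx0)) -EFinD ltry.
rewrite /C /dom /=; move: h2 sfin (hN (s k)).
case: (h (shat k)) => [r| |//]; first by rewrite ltry.
by case: (h (s k)) => [r'| |]// ; rewrite addye// -!EFinD leye_eq.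
Qed.

Let xS k : x k.+1 = x k + gamma k *: (shat k - x k).
Proof. by rewrite (icgalp_x iter) -scalerN opprB. Qed.

Lemma iterates_in_dom k : C (x k).
Proof.
elim: k => [|k IH]; first exact: (icgalp_x0 iter).
by rewrite xS; apply: C_cvx => //; rewrite (ltW (gamma_gt0 k)) gamma_le1.
Qed.
Let Cx := iterates_in_dom.

Lemma icgalp_asymptotics :
  [/\ bounded_sums (fun k => gamma k * `|A (x k) - b| ^+ 2),
      (fun k => `|A (x k) - b|) @ \oo --> 0
    & forall ms, (forall u, C u -> Phi xstar <= Phi u + inner ms (A u - b)) ->
      let w k := Phi (x k) + inner ms (A (x k) - b) - Phi xstar in
      [/\ bounded_sums (fun k => gamma k * w k.+1), w @ \oo --> 0,
          exists2 B : R, 0 <= B & forall k, `|mu k - ms| <= B,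
          cvgn (fun k => `|mu k - ms| ^+ 2)
        & forall u r, C u -> 0 < r -> \forall k \near \oo, Phi xstar - r <=
            Phi u + inner (mu k) (A u - b) + rhohi / 2 * `|A u - b| ^+ 2]].
Proof.
have [B B0 CB] := Cbnd; have [M M0 subM] := subg_bnd.
have [MA MA0 AM] := op_bnd bA; have [MT MT0 TM] := op_bnd bT.
have [KF KF0 fs] := Fzeta_descent C_cvx smooth.
have [D Phi_bnd] := real_objective_bounded.
have zeta_ge0 k : 0 <= zeta (gamma k) by have [] := zeta_sum.
have rhohi0 : 0 < rhohi.
  by have /andP[h1 h2] := rho_bnd 0%N; exact: lt_le_trans (le_trans h1 h2).
pose Psi k u := fine (f u) + fine (h u) + moreau_envelope (beta k) g (T u).
pose eps k := KF * zeta (gamma k)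
  + (MT * (2 * B)) ^+ 2 / 2 * (gamma k ^+ 2 / beta k)
  + rhohi / 2 * (MA * (2 * B)) ^+ 2 * gamma k ^+ 2
  + (2 * B) * (gamma k * `|lam k|) + gamma k * lams k.
(* The envelope lies below [g] by at most [beta / 2 * |u|^2], for a subgradient [u] of norm at most
   [M]. *)
pose K := M ^+ 2 / 2.
pose Ba := MA * (2 * B).
(* Since [beta] is nonincreasing, [gamma k ^+ 2] is at most [beta 0] times
   [gamma k ^+ 2 / beta k]. *)
have gamma2_sum : bounded_sums (fun k => gamma k ^+ 2).
  have b0 : 0 <= beta 0%N by exact: ltW.
  apply: bounded_sums_le (bounded_sumsZ b0 (ell1_bounded_sums gamma2beta_sum)).
  move=> k; rewrite mulrCA ler_pMr ?exprn_gt0// ler_pdivlMr// mul1r.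
  exact: beta_dec.
have eps_ge0 k : 0 <= eps k.
  have g0 := ltW (gamma_gt0 k).
  rewrite /eps; repeat apply: addr_ge0.
  - exact: mulr_ge0.
  - by apply: mulr_ge0; rewrite divr_ge0 ?sqr_ge0// ltW.
  - by rewrite !mulr_ge0// ?sqr_ge0// ltW.
  - by rewrite !mulr_ge0.
  - exact: mulr_ge0.
have eps_sum : bounded_sums eps.
  apply: bounded_sumsD => //; apply: bounded_sumsD; last first.
    by apply: bounded_sumsZ => //; rewrite mulr_ge0.
  apply: bounded_sumsD; last first.
    apply: bounded_sumsZ => //; rewrite mulr_ge0 ?sqr_ge0// divr_ge0// ltW//.
  apply: bounded_sumsD.
    by apply: bounded_sumsZ => //; exact: ell1_bounded_sums.
  apply: bounded_sumsZ; first by rewrite divr_ge0 ?sqr_ge0.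
  exact: ell1_bounded_sums.
have K0 : 0 <= K by rewrite divr_ge0 ?sqr_ge0.
have sub2 u : C u -> exists2 v, subdifferential g (T u) v & `|v| ^+ 2 / 2 <= K.
  move=> Cu; have [v vs vM] := subM u Cu; exists v => //.
  by rewrite ler_pM2r ?invr_gt0// ler_sqr ?nnegrE.
have Psi_le k u : C u -> Psi k u <= Phi u.
  move=> Cu; have := moreau_envelope_le_fun g_pcl g_sub (beta_gt0 k) (Cg Cu).
  by rewrite /Psi /Phi /real_objective; lra.
have Psi_ge k u : C u -> Phi u <= Psi k u + beta k * K.
  move=> Cu; have [v vs vK] := sub2 u Cu.
  have := moreau_envelope_ge g_pcl g_sub (beta_gt0 k) (Cg Cu) vs.
  have := ler_wpM2l (ltW (beta_gt0 k)) vK.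
  by rewrite /Psi /Phi /real_objective; lra.
have beta_decS k : beta k.+1 <= beta k by exact: beta_dec.
have Psi_inc k u : C u -> Psi k u <= Psi k.+1 u.
  move=> Cu; have [v vs vK] := sub2 u Cu.
  have /andP[+ _] := moreau_envelope_step g_pcl g_sub (beta_gt0 k.+1)
    (beta_decS k) (Cg Cu) vs.
  by rewrite /Psi lerD2l.
have Psi_step k u : C u ->
    Psi k.+1 u <= Psi k u + (beta k - beta k.+1) * K.
  move=> Cu; have [v vs vK] := sub2 u Cu.
  have /andP[_] := moreau_envelope_step g_pcl g_sub (beta_gt0 k.+1)
    (beta_decS k) (Cg Cu) vs.
  have b0 : 0 <= beta k - beta k.+1 by rewrite subr_ge0.
  have := ler_wpM2l b0 vK.
  by rewrite /Psi; lra.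
have res_bnd u : C u -> `|A u - b| <= Ba.
  move=> Cu; rewrite -Axstar -linearB; apply: le_trans (AM _) _.
  rewrite ler_wpM2l//; apply: le_trans (ler_normB _ _) _.
  by have := CB u Cu; have := CB xstar Cxstar; lra.
have muS k : mu k.+1 = mu k + theta k *: (A (x k.+1) - b).
  exact: (icgalp_mu iter).
have rho_incS k : rho k <= rho k.+1 by exact: rho_inc.
have gamma_ratioS k : gamma k <= Mhi * gamma k.+1.
  by have /andP[_] := gamma_ratio k; rewrite ler_pdivrMr.
have Mhi_ltS : Mhi / c < rholo / 2 by rewrite -subr_lt0.
have gammabeta_sumS : bounded_sums (fun k => gamma k * beta k).
  exact: ell1_bounded_sums.
have descent k u : C u ->
    Psi k (x k.+1) + inner (mu k) (A (x k.+1) - b)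
      + rho k / 2 * `|A (x k.+1) - b| ^+ 2 <=
    (1 - gamma k) * (Psi k (x k) + inner (mu k) (A (x k) - b)
      + rho k / 2 * `|A (x k) - b| ^+ 2)
    + gamma k * (Psi k u + inner (mu k) (A u - b) + rho k / 2 * `|A u - b| ^+ 2)
    - gamma k * rho k / 2 * `|A u - A (x k)| ^+ 2 + eps k.
  move=> Cu; rewrite xS.
  apply: (conditional_gradient_step bA bT AM TM MA0 MT0 B0 CB hN erefl h_cvx
    f_grad fs g_pcl g_sub (gamma01 k) (beta_gt0 k) _ (Cx k) (Cshat k) _
    (icgalp_s iter k) (icgalp_shat iter k) Cu).
    by have /andP[h1 h2] := rho_bnd k; rewrite h2 andbT; exact: lt_le_trans h1.
  by rewrite (icgalp_z iter) (icgalp_y iter).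
by apply: (augmented_lagrangian_asymptotics (C := C) (Phi := Phi) (Psi := Psi)
  (beta := beta) (theta := theta) (rho := rho) (eps := eps) (rholo := rholo)
  (Mhi := Mhi) (c := c) (K := K) (D := D) (Ba := Ba) (shat := shat)).
Qed.

Let LE u m : C u ->
  lagrangian A T b f h g u m = (Phi u + inner m (A u - b))%:E.
Proof. exact: lagrangianE fN hN gN Cf Cg u m. Qed.

Let Lstar : lagrangian A T b f h g xstar mustar = (Phi xstar)%:E.
Proof. by rewrite LE// Axstar subrr inner0r addr0. Qed.

Let res_cvx u v (t : R) : C u -> C v -> 0 <= t <= 1 ->
  `|A (v + t *: (u - v)) - b| ^+ 2 <=
  `|A v - b| ^+ 2 + t * (`|A u - b| ^+ 2 - `|A v - b| ^+ 2).
Proof.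
move=> _ _ /andP[t0 t1].
have -> : A (v + t *: (u - v)) - b = (A v - b) + t *: ((A u - b) - (A v - b)).
  by rewrite linearD linearZ linearB addrAC; congr (_ + _ *: _);
    rewrite opprB addrA subrK.
move: (A v - b) (A u - b) => p q.
rewrite (normD_sqr p) innerZr normZ_sqr (innerBr p q) inner_norm.
have hB : `|q - p| ^+ 2 = `|q| ^+ 2 - 2 * inner p q + `|p| ^+ 2.
  by rewrite normB_sqr innerC.
have h1 : t ^+ 2 * `|q - p| ^+ 2 <= t * `|q - p| ^+ 2.
  by rewrite ler_wpM2r ?sqr_ge0// expr2 ler_piMl.
rewrite hB in h1 *; lra.
Qed.

(** The summable quantity is the squared residual, whence the square roots in the rates; the
    averaged iterates are handled by the convexity of that square. *)
Lemma feasibility :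
  [/\ (fun k => `|A (x k) - b|) @ \oo --> 0,
      (fun k => inf [set `|A (x i) - b| | i in [set i | (i <= k)%N]])
        =O_\oo (fun k => (Num.sqrt (psum gamma k))^-1),
      exists2 phi : nat -> nat, {homo phi : i j / (i < j)%N} &
        forall j, `|A (x (phi j)) - b| <= (Num.sqrt (psum gamma (phi j)))^-1
    & (fun k => `|A (weighted_mean gamma x k) - b|)
        =O_\oo (fun k => (Num.sqrt (psum gamma k))^-1)].
Proof.
have [rs rc _] := icgalp_asymptotics; have [B rB] := rs.
have G0 := psum_gt0 gamma_gt0.
have sV k : 0 <= (Num.sqrt (psum gamma k))^-1 by rewrite invr_ge0 sqrtr_ge0.
split=> //.
- apply: (@eqO_bound _ _ _ (Num.sqrt B)) => k.
  set S := [set _ | _ in _].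
  have Slb : lbound S 0 by move=> _ [i _ <-].
  have i0 : 0 <= inf S.
    by apply: lb_le_inf => //; exists `|A (x 0) - b|, 0%N.
  have iS i : (i <= k)%N -> inf S <= `|A (x i) - b|.
    by move=> ik; apply: ge_inf; [exists 0|exists i].
  rewrite ger0_norm// [X in _ * X]ger0_norm//.
  apply: le_sqrt_rate => //; rewrite psumE; apply: le_trans (rB k.+1).
  rewrite mulr_sumr; apply: ler_sum_nat => i /andP[_ ik].
  rewrite mulrC ler_pM2l// ler_sqr ?nnegrE//; exact: iS.
- apply: (@subsequence_exists
    (fun k => `|A (x k) - b| <= (Num.sqrt (psum gamma k))^-1)) => N.
  have [k Nk h1] := weighted_sum_rate gamma_gt0 gamma_div rs
    (fun k => sqr_ge0 `|A (x k) - b|) N.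
  exists k => //; rewrite -sqrtrV; last exact: ltW.
  rewrite -[leLHS]ger0_norm// -sqrtr_sqr; exact: ler_wsqrtr.
- apply: (@eqO_bound _ _ _ (Num.sqrt B)) => k.
  rewrite normr_id [X in _ * X]ger0_norm//.
  apply: le_sqrt_rate => //; apply: le_trans (rB k.+1).
  by have [] := weighted_mean_jensen gamma_gt0 C_cvx res_cvx Cx k.
Qed.

Let w k := Phi (x k) + inner mustar (A (x k) - b) - Phi xstar.

Let w_ge0 k : 0 <= w k.
Proof. by rewrite subr_ge0; exact: gap_star. Qed.

Let w_sumS : bounded_sums (fun k => gamma k * w k.+1).
Proof. by have [_ _ /(_ mustar gap_star)[]] := icgalp_asymptotics. Qed.

Let w_cvg : w @ \oo --> 0.
Proof. by have [_ _ /(_ mustar gap_star)[]] := icgalp_asymptotics. Qed.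

Let w_sum : bounded_sums (fun k => gamma k * w k).
Proof.
apply: bounded_sums_unshift; apply: bounded_sums_le w_sumS => k.
by rewrite ler_wpM2r.
Qed.

Let LwE k : lagrangian A T b f h g (x k) mustar = (w k + Phi xstar)%:E.
Proof. by rewrite LE// /w subrK. Qed.

Lemma lagrangian_convergence : (fun k => lagrangian A T b f h g (x k) mustar)
  @ \oo --> lagrangian A T b f h g xstar mustar.
Proof.
under eq_fun do rewrite LwE.
rewrite Lstar; apply: cvg_EFin; first exact: nearW.
rewrite -[X in _ --> X]add0r; apply: cvgD => //; exact: cvg_cst.
Qed.

Lemma lagrangian_pointwise_rate :
  ebigO (fun k => (ereal_inf [set lagrangian A T b f h g (x i) mustar |
                               i in [set i | (i <= k)%N]]
                   - lagrangian A T b f h g xstar mustar)%E)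
        (fun k => (psum gamma k)^-1) /\
  exists2 phi : nat -> nat, {homo phi : i j / (i < j)%N} &
    forall j, (lagrangian A T b f h g (x (phi j).+1) mustar
      - lagrangian A T b f h g xstar mustar <= ((psum gamma (phi j))^-1)%:E)%E.
Proof.
have G0 := psum_gt0 gamma_gt0; have [B wB] := w_sum.
split; last first.
  apply: (@subsequence_exists (fun k => (lagrangian A T b f h g (x k.+1) mustar
    - lagrangian A T b f h g xstar mustar <= ((psum gamma k)^-1)%:E)%E)) => N.
  have [k Nk h1] := weighted_sum_rate gamma_gt0 gamma_div w_sumS
    (fun k => w_ge0 k.+1) N.
  by exists k => //; rewrite LwE Lstar -EFinB addrK lee_fin.
rewrite Lstar; apply: (@ebigO_bound _ _ _ B) => k.
- by rewrite invr_ge0 ltW.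
- rewrite leeBrDr// add0e; apply: le_ereal_inf_tmp => _ [i _ <-].
  by rewrite LwE lee_fin lerDr.
- set S := [set _ | _ in _].
  have Si i : (i <= k)%N -> (ereal_inf S <= (w i + Phi xstar)%:E)%E.
    by move=> ik; apply: ereal_inf_lbound; exists i; rewrite // LwE.
  have Sf : ereal_inf S \is a fin_num.
    rewrite fin_numElt; apply/andP; split.
      apply: (@lt_le_trans _ _ (Phi xstar)%:E); first exact: ltNyr.
      by apply: le_ereal_inf_tmp => _ [i _ <-]; rewrite LwE lee_fin lerDr.
    by apply: le_lt_trans (Si k (leqnn k)) _; exact: ltry.
  rewrite -(fineK Sf) -EFinB lee_fin ler_pdivlMr// psumE.
  apply: le_trans (wB k.+1); rewrite mulr_sumr; apply: ler_sum_nat => i /andP[_ ik].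
  rewrite mulrC ler_pM2l//.
  by have := Si i ik; rewrite -(fineK Sf) lee_fin lerBlDr.
Qed.

Let xbar := weighted_mean gamma (fun i => x i.+1).

Let W u := Phi u + inner mustar (A u - b).

Let W_cvx u v (t : R) : C u -> C v -> 0 <= t <= 1 ->
  W (v + t *: (u - v)) <= W v + t * (W u - W v).
Proof.
move=> Cu Cv t01; have := Phi_cvx Cu Cv t01.
have -> : W (v + t *: (u - v)) = Phi (v + t *: (u - v))
    + (inner mustar (A v) + t * (inner mustar (A u) - inner mustar (A v)))
    - inner mustar b.
  have Aseg : A (v + t *: (u - v)) = A v + t *: (A u - A v).
    by rewrite linearD linearZ linearB.
  by rewrite /W Aseg innerBr (innerDr mustar (A v)) innerZr
    (innerBr mustar (A u)) addrA.
by rewrite /W !innerBr; lra.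
Qed.

(** The mean pairs [gamma i] with [x i.+1], the very pairing in which the Lagrangian gaps are
    summed, so Jensen applies without shifting indices. *)
Let xbar_rate : exists2 B : R, 0 <= B & forall k, C (xbar k) /\
  0 <= W (xbar k) - Phi xstar <= B * (psum gamma k)^-1.
Proof.
have G0 := psum_gt0 gamma_gt0; have [B wB] := w_sumS.
have B0 : 0 <= B by have := wB 0%N; rewrite big_geq.
exists B => // k.
have [Cm J] := weighted_mean_jensen gamma_gt0 C_cvx W_cvx (fun i => Cx i.+1) k.
split=> //; rewrite subr_ge0 gap_star//= ler_pdivlMr// mulrBl.
apply: le_trans (wB k.+1); rewrite lerBlDr; apply: le_trans J _.
rewrite psumE mulr_sumr -big_split/= le_eqVlt; apply/orP; left; apply/eqP.
by apply: eq_bigr => i _; rewrite /w /W; ring.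
Qed.

Lemma lagrangian_ergodic_rate :
  ebigO (fun k => (lagrangian A T b f h g (xbar k) mustar
                   - lagrangian A T b f h g xstar mustar)%E)
        (fun k => (psum gamma k)^-1).
Proof.
have [B B0 HB] := xbar_rate.
apply: (@ebigO_bound _ _ _ B) => k.
- by rewrite invr_ge0 ltW// psum_gt0.
- have [Cm /andP[h1 h2]] := HB k.
  by rewrite Lstar LE// -EFinB lee_fin.
- have [Cm /andP[h1 h2]] := HB k.
  by rewrite Lstar LE// -EFinB lee_fin.
Qed.

(* Letting t -> 0 along xstar + t (u - xstar) removes the quadratic term. *)
Let augmented_gap l (q : R) : (forall u, C u -> Phi xstar <=
    Phi u + inner l (A u - b) + q * `|A u - b| ^+ 2) ->
  forall u, C u -> Phi xstar <= Phi u + inner l (A u - b).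
Proof.
move=> aug u Cu; rewrite leNgt; apply/negP => lt1.
pose del := Phi xstar - (Phi u + inner l (A u - b)).
have del0 : 0 < del by rewrite subr_gt0.
pose Y := `|q| * `|A u - b| ^+ 2; have Y0 : 0 <= Y by rewrite mulr_ge0// sqr_ge0.
(* Makes [t * Y] smaller than [del] while keeping [t] in ]0, 1]. *)
pose t := del / (del + Y + 1).
have d1 : 0 < del + Y + 1 by lra.
have t0 : 0 < t by rewrite divr_gt0.
have t1 : t <= 1 by rewrite ler_pdivrMr// mul1r; lra.
have t01 : 0 <= t <= 1 by rewrite t1 ltW.
have := aug _ (C_cvx Cu Cxstar t01); have := Phi_cvx Cu Cxstar t01.
have -> : A (xstar + t *: (u - xstar)) - b = t *: (A u - b).
  by rewrite linearD linearZ linearB Axstar addrAC subrr add0r.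
rewrite innerZr normZ_sqr => h1 h2.
have h3 : q * (t ^+ 2 * `|A u - b| ^+ 2) <= t * (t * Y).
  rewrite /Y expr2 -mulrA mulrCA ler_pM2l// mulrCA ler_pM2l//.
  by rewrite ler_wpM2r ?sqr_ge0// ler_norm.
have h4 : t * del <= t * (t * Y) by rewrite /del; lra.
rewrite ler_pM2l// in h4.
have tY : t * Y < del.
  by rewrite /t mulrAC ltr_pdivrMr// ltr_pM2l//; lra.
lra.
Qed.

Let mu_bounded : exists B : R, forall k, `|mu k| <= B.
Proof.
have [_ _ /(_ mustar gap_star)[_ _ [B B0 muB] _ _]] := icgalp_asymptotics.
exists (B + `|mustar|) => k; rewrite -[mu k](subrK mustar).
by apply: le_trans (ler_normD _ _) _; rewrite lerD2r.
Qed.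

(** Opial on the set of optimal multipliers. An ultrafilter limit is optimal because, for each fixed
    [u], the asymptotic lower bound is weakly continuous in the multiplier; [augmented_gap] then
    removes the penalty. *)
Lemma dual_weak_convergence : exists2 l, weakly_converges mu l &
  forall u, C u -> Phi xstar <= Phi u + inner l (A u - b).
Proof.
have [B muB] := mu_bounded; have [_ _ asym] := icgalp_asymptotics.
have [|U UU sU l Hl u Cu|l gl wl] := @opial _ _ mu
  [set l | forall u, C u -> Phi xstar <= Phi u + inner l (A u - b)] B muB.
- by move=> l gl; have [_ _ _ + _] := asym l gl.
- have [_ _ _ _ near] := asym mustar gap_star.
  apply: (@augmented_gap l (rhohi / 2)) => // v Cv.
  apply/ler_addgt0Pr => r r0; rewrite -lerBlDr.
  have cv : Phi v + inner (mu k) (A v - b) + rhohi / 2 * `|A v - b| ^+ 2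
      @[k --> U] --> Phi v + inner l (A v - b) + rhohi / 2 * `|A v - b| ^+ 2.
    apply: cvgD; last exact: cvg_cst.
    by apply: cvgD; [exact: cvg_cst|exact: Hl].
  rewrite -(cvg_lim _ cv)//; apply: limr_ge.
    by apply/cvg_ex; eexists; exact: cv.
  by apply: sU; exact: near v r Cv r0.
by exists l.
Qed.

(** The property common to weak cluster points and to weak limits along ultrafilters, so that both
    are treated at once. *)
Let frequently_near xb := forall v (r : R) N, 0 < r ->
  exists2 k, (N <= k)%N & `|inner (x k) v - inner xb v| < r.

Section weak_cluster.
Variable xb : Hp.
Hypothesis freq : frequently_near xb.

(* Moreau regularization at xb replaces the missing subgradients of h at xb. *)
Let h_minorant (a : R) : (a%:E < h xb)%E -> exists p e, [/\ C p,
  subdifferential h p e, a < fine (h p) & 0 <= inner e (xb - p)].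
Proof.
move=> axb; have [h_proper hcvx h_lsc] := h_pcl.
have [D hD] := h_bounded; have [x0 Cx0] := C_ne.
have D0 : 0 <= D by apply: le_trans (hD x0 Cx0).
have reg (bt : R) : 0 < bt -> exists p, [/\ C p,
    subdifferential h p (bt^-1 *: (xb - p)) & `|xb - p| ^+ 2 <= bt * (2 * D + 1)].
  move=> bt0.
  have low u : dom h u -> - D <= fine (h u) + (2 * bt)^-1 * `|xb - u| ^+ 2.
    move=> Cu; have := hD u Cu; rewrite ler_norml => /andP[h1 _].
    apply: le_trans h1 _; rewrite lerDl mulr_ge0 ?sqr_ge0// invr_ge0.
    by rewrite mulr_ge0// ltW.
  have [p minp] := prox_objective_argmin bt0 h_proper hcvx h_lsc low.
  have [Cp sp] := prox_objective_subgradient bt0 h_proper hcvx minp.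
  exists p; split=> //; set e := _ *: _ in sp.
  (* One iterate within tolerance 1 of [xb] in the direction [e] is enough: the oscillation [2 * D]
     of [h] on [C] plus this 1 gives the constant. *)
  have [k _ hk] := freq e 0%N ltr01.
  have h1 := subdifferential_le hN Cp (Cx k) sp.
  have h2 : inner e (x k - p) = inner (x k) e - inner xb e + inner e (xb - p).
    by rewrite !innerBr (innerC (x k)) (innerC xb); ring.
  have h3 : inner e (xb - p) = bt^-1 * `|xb - p| ^+ 2.
    by rewrite /e innerZl inner_norm.
  have := hD p Cp; rewrite ler_norml => /andP[h4 _].
  have := hD (x k) (Cx k); rewrite ler_norml => /andP[_ h5].
  move: hk; rewrite ltr_norml => /andP[h6 _].
  rewrite -ler_pdivrMl// -h3; lra.
have [V /nbhs_ballP[eps /= eps0 Veps] aV] := h_lsc _ _ axb.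
have d0 : 0 < 2 * D + 2 by lra.
(* With this parameter [|xb - p|] is below [eps], so [p] falls into the neighbourhood where [h]
   exceeds [a]. *)
have bt0 : 0 < eps ^+ 2 / (2 * D + 2) by rewrite divr_gt0// exprn_gt0.
have [p [Cp sp pn]] := reg _ bt0.
exists p; eexists; split; [exact: Cp|exact: sp| |].
  rewrite -lte_fin fineK; last exact: dom_fin_num.
  apply: aV; apply: Veps; rewrite -ball_normE /ball_/=.
  rewrite -(@ltr_pXn2r _ 2)// ?nnegrE// ?(ltW eps0)//.
  apply: le_lt_trans pn _; rewrite mulrAC ltr_pdivrMr// ltr_pM2l ?exprn_gt0//.
  lra.
by rewrite innerZl inner_norm mulr_ge0 ?sqr_ge0// invr_ge0 ltW.
Qed.

(** If [h xb] were [+oo], the minorant lemma at level [D] would produce a point of [C] where [h]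
    exceeds its own bound. *)
Let Cxb : C xb.
Proof.
apply: contrapT => nC; have [D hD] := h_bounded.
have hy : h xb = +oo%E by apply/eqP; rewrite -leye_eq leNgt; apply/negP.
have [|p [e [Cp _ Dp _]]] := @h_minorant D; first by rewrite hy ltry.
have := hD p Cp; have := ler_norm (fine (h p)); lra.
Qed.

Let Axb : A xb = b.
Proof.
have [_ rc _] := icgalp_asymptotics.
apply/eqP; rewrite -subr_eq0; apply/eqP; apply: inner_eq0 => v.
apply/eqP; rewrite -normr_le0; apply/ler_addgt0Pr => r r0; rewrite add0r.
have r20 : 0 < r / 2 by lra.
have vp : 0 < `|v| + 1 by rewrite ltr_wpDl.
have /cvgrPdist_lt/(_ _ (divr_gt0 r20 vp)) [N _ HN] := rc.
have [k Nk hk] := freq (adjoint A v) N r20.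
have := HN k Nk; rewrite /= sub0r normrN normr_id ltr_pdivlMr// => h1.
have h2 : `|inner (A (x k) - b) v| <= `|A (x k) - b| * (`|v| + 1).
  by apply: le_trans (inner_normM _ _) _; rewrite ler_wpM2l// lerDl.
have h3 : inner (A xb - b) v = inner (A (x k) - b) v
    - (inner (x k) (adjoint A v) - inner xb (adjoint A v)).
  rewrite (innerC (x k)) (innerC xb) !adjointE// (innerC v) (innerC v (A xb)).
  by rewrite !innerBl; ring.
rewrite h3; apply: le_trans (ler_normB _ _) _.
by apply: ltW; move: h1 h2 hk; lra.
Qed.

Let Phixb : Phi xb <= Phi xstar.
Proof.
rewrite leNgt; apply/negP => lt1.
pose del := Phi xb - Phi xstar; have del0 : 0 < del by rewrite subr_gt0.
have d40 : 0 < del / 4 by rewrite divr_gt0.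
(* Three errors of [del / 4] will be made: in the value of [h], in the Lagrangian gap and in the
   weak approximation. Together they stay below [del]. *)
have [|p [e [Cp sp hp ep]]] := @h_minorant (fine (h xb) - del / 4).
  rewrite -{2}(fineK (dom_fin_num (hN xb) Cxb)) lte_fin; lra.
have [sg sgs] := sub_ne Cxb.
have [N _ HN] := (cvgrPdist_lt _ _).1 w_cvg _ d40.
have fgrad k := f_grad Cxb (Cx k).
move: (gradient f xb) fgrad => gr fgrad.
(* All first-order terms of the Lagrangian in a single test vector: (sub)gradients at [xb], except
   for [h], whose subgradient is taken at the nearby [p]. *)
pose W0 := gr + adjoint T sg + e + adjoint A mustar.
have [k Nk hk] := freq W0 N d40.
have := HN k Nk; rewrite /= sub0r normrN ger0_norm// => hw.
have i1 := fgrad k.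
have i2 := subdifferential_le gN (Cg Cxb) (Cg (Cx k)) sgs.
have i3 := subdifferential_le hN Cp (Cx k) sp.
have i4 : inner e (x k - p) = inner e (x k) - inner e xb + inner e (xb - p).
  by rewrite !innerBr; ring.
have i5 : inner (x k) W0 - inner xb W0 = inner gr (x k - xb)
    + inner sg (T (x k) - T xb) + (inner e (x k) - inner e xb)
    + inner mustar (A (x k) - b).
  rewrite (innerC (x k)) (innerC xb) /W0 !innerDl !adjointE// !innerBr Axb; ring.
rewrite i5 in hk; rewrite i4 in i3; move: hk; rewrite ltr_norml => /andP[hk _].
have e1 : Phi (x k) = fine (f (x k)) + fine (g (T (x k))) + fine (h (x k)) by [].
have e2 : Phi xb = fine (f xb) + fine (g (T xb)) + fine (h xb) by [].
have e3 : w k = Phi (x k) + inner mustar (A (x k) - b) - Phi xstar by [].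
have e4 : del = Phi xb - Phi xstar by [].
clearbody del; lra.
Qed.

Lemma weak_cluster_primal_solution : primal_solution A T b f h g xb.
Proof.
exact: (primal_solutionI fN hN gN Cf Cg Cxstar Axstar gap_star Cxb Axb Phixb).
Qed.

Lemma weak_cluster_saddle_point l :
  (forall u, C u -> Phi xstar <= Phi u + inner l (A u - b)) ->
  saddle_point A T b f h g xb l.
Proof.
move=> gl; apply: (saddle_pointI fN hN gN Cf Cg Cxb Axb) => u Cu.
exact: le_trans Phixb (gl u Cu).
Qed.

End weak_cluster.

Lemma dual_convergence : exists mubar : Hd,
  [/\ weakly_converges mu mubar, dual_solution A T b f h g mubar
    & forall xb, weak_cluster_point x xb ->
      primal_solution A T b f h g xb /\ saddle_point A T b f h g xb mubar].
Proof.
have [l wl gl] := dual_weak_convergence; exists l; split=> //.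
  exact: (saddle_dual_solution fN hN gN Cf Cg bA Cxstar Axstar gl).
move=> xb /weak_cluster_point_frequently cl.
have fr : frequently_near xb by move=> v r N; exact: cl.
by split; [exact: weak_cluster_primal_solution|exact: weak_cluster_saddle_point].
Qed.

(** Every ultrafilter limit of the bounded iterates solves the primal problem, hence equals [xs]. *)
Lemma unique_weak_convergence xs : unique (primal_solution A T b f h g) xs ->
  weakly_converges x xs /\
  exists2 ms : Hd, weakly_converges mu ms & saddle_point A T b f h g xs ms.
Proof.
move=> [pxs uxs]; split.
  have [B B0 CB] := Cbnd.
  apply: (@weakly_converges_ultra _ _ _ _ B) => [k|U UU sU l Hl].
    exact: CB.
  apply/esym; apply: uxs; apply: weak_cluster_primal_solution => v r N r0.
  have /cvgrPdist_lt/(_ _ r0) UH := Hl v.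
  have UN : U [set k | (N <= k)%N] by apply: sU; exists N.
  have [k [/= h1 h2]] := filter_ex (filterI UH UN).
  by exists k => //; rewrite distrC.
have [l wl gl] := dual_weak_convergence; exists l => //.
have [Cxs Axs Pxs] := primal_solutionE fN hN gN Cf Cg Cxstar Axstar pxs.
apply: (saddle_pointI fN hN gN Cf Cg Cxs Axs) => u Cu.
exact: le_trans Pxs (gl u Cu).
Qed.

Lemma uniformly_convex_convergence xs (psi : R -> \bar R) :
  primal_solution A T b f h g xs ->
  uniformly_convex_on C (objective T f h g) psi ->
  x @ \oo --> xs /\
  ebigO (fun k => psi `|xbar k - xs|) (fun k => (psum gamma k)^-1).
Proof.
move=> pxs [psi0 psi_eq0 psi_mono psi_cvx].
have [Cxs Axs Pxs] := primal_solutionE fN hN gN Cf Cg Cxstar Axstar pxs.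
(* Uniform convexity at the midpoint, where t (1 - t) = 1/4, with the value there bounded below by
   the saddle inequality; [Phi xs <= Phi xstar] then leaves the factor 2. *)
have key u : C u -> (psi `|u - xs|%R <= (2 * (W u - Phi xstar))%:E)%E.
  move=> Cu; have t01 : 0 < (1 / 2 : R) < 1 by apply/andP; split; lra.
  have t01' : 0 <= (1 / 2 : R) <= 1 by apply/andP; split; lra.
  have := psi_cvx u xs _ Cu Cxs t01; rewrite segmentE.
  have Cm := C_cvx Cu Cxs t01'; have gm := gap_star Cm.
  move: gm; have -> : A (xs + (1 / 2) *: (u - xs)) - b = (1 / 2) *: (A u - b).
    by rewrite linearD linearZ linearB Axs addrAC subrr add0r.
  rewrite innerZr (objectiveE fN hN gN Cf Cg Cm) (objectiveE fN hN gN Cf Cg Cu).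
  rewrite (objectiveE fN hN gN Cf Cg Cxs) -/Phi.
  have : (0 <= psi `|u - xs|%R)%E by exact: psi0.
  case: (psi `|u - xs|) => [r r0 gm| _ _|//].
    rewrite -!EFinM -!EFinD !lee_fin /W => h1.
    by rewrite -/(Phi xs) -/(Phi xstar) in Pxs h1 gm *; clear r0; lra.
  rewrite gt0_muley; last by rewrite lte_fin; lra.
  by rewrite addey// -!EFinM -EFinD leye_eq.
split.
  apply/cvgrPdist_lt => r r0.
  have psir : (0 < psi r)%E.
    rewrite lt0e psi0 ?(ltW r0)// andbT; apply/eqP => /psi_eq0.
    by move=> /(_ (ltW r0)) E; rewrite E ltxx in r0.
  (* The modulus may be infinite at [r]; any positive real below it serves as threshold. *)
  have [dl dl0 dlpsi] : exists2 dl : R, 0 < dl & (dl%:E <= psi r)%E.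
    case: (psi r) psir => [q q0| _|//]; first by exists q.
    by exists 1; rewrite ?leey.
  have d2 : 0 < dl / 2 by rewrite divr_gt0.
  have /cvgrPdist_lt/(_ _ d2) := w_cvg; apply: filterS => k.
  rewrite sub0r normrN ger0_norm// => wk.
  rewrite distrC ltNge; apply/negP => rk.
  have := le_trans (le_trans dlpsi (psi_mono _ _ (ltW r0) rk)) (key _ (Cx k)).
  by rewrite lee_fin; move: wk; rewrite /w /W; lra.
have [B B0 HB] := xbar_rate.
apply: (@ebigO_bound _ _ _ (2 * B)) => k.
- by rewrite invr_ge0 ltW// psum_gt0.
- exact: psi0.
- have [Cm /andP[_ h2]] := HB k; apply: le_trans (key _ Cm) _.
  by rewrite lee_fin; move: h2; lra.
Qed.

End realization.
End icgalp_realization.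

(** * Almost sure convergence *)

Section noise.
Context {R : realType} {Hp Hd : hilbertType R} {d : measure_display}
  {Omega : measurableType d}.
Variables (P : probability Omega R) (x0 : Omega -> Hp) (mu0 : Omega -> Hd)
  (shat : nat -> Omega -> Hp).
Hypotheses (x0_meas : borel_random_variable x0)
  (mu0_meas : borel_random_variable mu0)
  (shat_meas : forall k, borel_random_variable (shat k)).

Let G k := sigma_of x0 `|` sigma_of mu0 `|`
  \bigcup_(i in [set i | (i <= k)%N]) sigma_of (shat i).

Lemma filtration_measurable k : filtration x0 mu0 shat k `<=` measurable.
Proof.
apply: smallest_sub; first exact: sigma_algebra_measurable.
by move=> S [[/x0_meas|/mu0_meas]|[i _ /shat_meas]].
Qed.

Lemma filtration_nondecreasing i k : (i <= k)%N ->
  filtration x0 mu0 shat i `<=` filtration x0 mu0 shat k.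
Proof.
move=> ik; apply: sub_sigma_algebra2 => S [?|[j ji ?]]; first by left.
by right; exists j => //; exact: leq_trans ji ik.
Qed.

(** The conditional expectations concern [X k.+1] given the past up to [k], so the first noise term
    is not covered by them and is added back at the end. *)
Lemma noise_bounded_sums (gamma : nat -> R) (X e : nat -> Omega -> R) :
  (forall k, 0 < gamma k) ->
  (forall k, measurable_fun setT (X k)) -> (forall k w, 0 <= X k w) ->
  (forall k, cond_expectation P (filtration x0 mu0 shat k) (X k.+1) (e k)) ->
  ell1_plus_filtered P (filtration x0 mu0 shat)
    (fun k w => gamma k.+1 * e k w) ->
  {ae P, forall w, bounded_sums (fun k => gamma k * X k w)}.
Proof.
move=> g0 mX X0 ce se.
have := @conditional_bounded_sums _ _ _ P G (fun k => gamma k.+1)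
  (fun k => X k.+1) e filtration_measurable filtration_nondecreasing
  (fun k => g0 k.+1) (fun k => mX k.+1) (fun k => X0 k.+1) ce se.
by apply: aeS => w; exact: bounded_sums_unshift.
Qed.

End noise.

Unset Implicit Arguments.

Theorem theorem4p11 (R : realType) (Hp Hd Hv : hilbertType R)
  (A : {linear Hp -> Hd}) (T : {linear Hp -> Hv}) (b : Hd)
  (f h : Hp -> \bar R) (g : Hv -> \bar R)
  (F : Hp -> \bar R) (zeta : R -> R)
  (d : measure_display) (Omega : measurableType d) (P : probability Omega R)
  (gamma beta theta rho : nat -> R)
  (lam : nat -> Omega -> Hp) (lams : nat -> Omega -> R)
  (x : nat -> Omega -> Hp) (mu : nat -> Omega -> Hd) (y : nat -> Omega -> Hv)
  (z s shat : nat -> Omega -> Hp)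
  (Mlo Mhi rholo rhohi c : R) (xstar : Hp) (mustar : Hd) :
  let C := dom h in
  let gT := fun v : Hp => g (T v) in
  let Phi := objective T f h g in
  let L := lagrangian A T b f h g in
  let Filt := filtration (x 0%N) (mu 0%N) shat in
  let Gam := psum gamma in
  let xbar := fun w => weighted_mean gamma (fun i => x i.+1 w) in
  (* setting *)
  bounded_operator A -> bounded_operator T -> range A b ->
  proper_convex_lsc g ->
  (* (A.1)-(A.8) *)
  [/\ proper_convex_lsc f, proper_convex_lsc gT & proper_convex_lsc h] ->
  Fzeta_smooth F zeta f C ->
  weakly_compact C ->
  (forall v, C v -> subdifferential g (T v) !=set0) ->
  (ereal_sup [set `|min_norm_element (subdifferential g (T v))|%:E | v in C]
    < +oo)%E ->
  (exists2 Lh : R, 0 <= Lh & forall u v, C u -> C v ->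
    (`|h u - h v| <= (Lh * `|u - v|)%:E)%E) ->
  saddle_point A T b f h g xstar mustar ->
  closed (range A) ->
  ((A @^-1` [set b] `&` (dom gT)° `&` C°) !=set0 \/
   [/\ finite_dimensional Hp, finite_dimensional Hd,
       (A @^-1` [set b] `&` relative_interior (dom gT)
          `&` relative_interior C) !=set0
     & range (adjoint A)
         `&` orthogonal_complement (linear_hull (dom gT `&` C)) = [set 0]]) ->
  (* (P.1)-(P.7) *)
  (forall k, 0 < gamma k <= 1) -> (forall k, 0 < beta k) ->
  ell1_plus (fun k => zeta (gamma k)) ->
  ell1_plus (fun k => gamma k ^+ 2 / beta k) ->
  ell1_plus (fun k => gamma k * beta k) ->
  ~ cvgn (series gamma) ->
  nonincreasing_seq beta -> beta @ \oo --> 0 ->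
  nondecreasing_seq rho -> 0 < rholo -> (forall k, rholo <= rho k <= rhohi) ->
  1 <= Mlo -> 0 < Mhi ->
  (forall k, Mlo <= gamma k / gamma k.+1 <= Mhi) ->
  0 < c -> (forall k, theta k = gamma k / c) -> Mhi / c - rholo / 2 < 0 ->
  (forall k, rho k.+1 - rho k - gamma k.+1 * rho k.+1 + 2 / c * gamma k
    - gamma k ^+ 2 / c <= gamma k.+1) ->
  (* the iterates *)
  (forall k, borel_random_variable (lam k)) ->
  (forall k, measurable_fun [set: Omega] (lams k)) ->
  (forall k w, 0 <= lams k w) ->
  borel_random_variable (x 0%N) -> borel_random_variable (mu 0%N) ->
  (forall k, borel_random_variable (shat k)) ->
  (forall w, icgalp_iteration A T b f h g gamma beta theta rho
    (lam^~ w) (lams^~ w) (x^~ w) (mu^~ w) (y^~ w) (z^~ w) (s^~ w)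
    (shat^~ w)) ->
  (* (P.8) *)
  (exists e : nat -> Omega -> R,
    (forall k, cond_expectation P (Filt k) (fun w => `|lam k.+1 w|) (e k)) /\
    ell1_plus_filtered P Filt (fun k w => gamma k.+1 * e k w)) ->
  (exists e : nat -> Omega -> R,
    (forall k, cond_expectation P (Filt k) (lams k.+1) (e k)) /\
    ell1_plus_filtered P Filt (fun k w => gamma k.+1 * e k w)) ->
  [/\ (* (0) *)
      {ae P, forall w,
        [/\ (fun k => `|A (x k w) - b|) @ \oo --> 0,
            (fun k => inf [set `|A (x i w) - b| | i in [set i | (i <= k)%N]])
              =O_\oo (fun k => (Num.sqrt (Gam k))^-1),
            exists2 phi : nat -> nat, {homo phi : i j / (i < j)%N} &
              forall j, `|A (x (phi j) w) - b| <= (Num.sqrt (Gam (phi j)))^-1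
          & (fun k => `|A (weighted_mean gamma (x^~ w) k) - b|)
              =O_\oo (fun k => (Num.sqrt (Gam k))^-1)]},
      (* (i) *)
      {ae P, forall w,
        (fun k => L (x k w) mustar) @ \oo --> L xstar mustar},
      (* (ii) *)
      {ae P, forall w, exists mubar : Hd,
        [/\ weakly_converges (mu^~ w) mubar,
            dual_solution A T b f h g mubar
          & forall xb, weak_cluster_point (x^~ w) xb ->
              primal_solution A T b f h g xb /\
              saddle_point A T b f h g xb mubar]},
      (* (iii) *)
      {ae P, forall w,
        ebigO (fun k => (ereal_inf [set L (x i w) mustar |
                                     i in [set i | (i <= k)%N]]
                         - L xstar mustar)%E)
              (fun k => (Gam k)^-1) /\
        exists2 phi : nat -> nat, {homo phi : i j / (i < j)%N} &
          forall j, (L (x (phi j).+1 w) mustar - L xstar mustar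
                     <= ((Gam (phi j))^-1)%:E)%E}
    & (* (iv) *)
      {ae P, forall w,
        ebigO (fun k => (L (xbar w k) mustar - L xstar mustar)%E)
              (fun k => (Gam k)^-1)} /\
      (* (v) *)
      (forall xs, unique (primal_solution A T b f h g) xs ->
        {ae P, forall w, weakly_converges (x^~ w) xs /\
          exists2 ms : Hd, weakly_converges (mu^~ w) ms &
            saddle_point A T b f h g xs ms}) /\
      (forall (xs : Hp) (psi : R -> \bar R),
        primal_solution A T b f h g xs -> uniformly_convex_on C Phi psi ->
        {ae P, forall w, (x^~ w) @ \oo --> xs /\
          ebigO (fun k => psi `|xbar w k - xs|) (fun k => (Gam k)^-1)})].
Proof.
move=> C gT Phi L Filt Gam xbar bA bT _ g_pcl [f_pcl gT_pcl h_pcl] smooth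
  Cwc sub_ne sub_bnd h_lip sad _ _ gamma01 beta0 zeta_sum g2b_sum gb_sum
  gamma_div beta_dec beta_cvg rho_inc rholo0 rho_bnd Mlo1 _ gamma_ratio c0
  thetaE Mhi_lt _ lam_meas lams_meas lams0 x0_meas mu0_meas shat_meas iter
  [e [ece e_sum]] [es [esce es_sum]].
have lam_ae : {ae P, forall w, bounded_sums (fun k => gamma k * `|lam k w|)}.
  apply: noise_bounded_sums e_sum => // k; first by have /andP[] := gamma01 k.
  exact: borel_norm_measurable.
have lams_ae : {ae P, forall w, bounded_sums (fun k => gamma k * lams k w)}.
  apply: noise_bounded_sums es_sum => // k; by have /andP[] := gamma01 k.
(* Both noise sums are bounded on one event of full measure, and there every conclusion holds path
   by path. *)
have main (Q : Omega -> Prop) : (forall w,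
    bounded_sums (fun k => gamma k * `|lam k w|) ->
    bounded_sums (fun k => gamma k * lams k w) -> Q w) -> {ae P, forall w, Q w}.
  by move=> HQ; apply: aeS (aeI lam_ae lams_ae) => w [h1 h2]; exact: HQ.
split.
- apply: main => w h1 h2.
  exact: (feasibility bA bT g_pcl f_pcl gT_pcl h_pcl smooth Cwc sub_ne
    sub_bnd h_lip sad gamma01 beta0 zeta_sum g2b_sum gb_sum gamma_div beta_dec
    beta_cvg rho_inc rholo0 rho_bnd Mlo1 gamma_ratio c0 thetaE Mhi_lt (iter w)
    (lams0^~ w) h1 h2).
- apply: main => w h1 h2.
  exact: (lagrangian_convergence bA bT g_pcl f_pcl gT_pcl h_pcl smooth Cwc sub_ne
    sub_bnd h_lip sad gamma01 beta0 zeta_sum g2b_sum gb_sum gamma_div beta_dec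
    beta_cvg rho_inc rholo0 rho_bnd Mlo1 gamma_ratio c0 thetaE Mhi_lt (iter w)
    (lams0^~ w) h1 h2).
- apply: main => w h1 h2.
  exact: (dual_convergence bA bT g_pcl f_pcl gT_pcl h_pcl smooth Cwc sub_ne
    sub_bnd h_lip sad gamma01 beta0 zeta_sum g2b_sum gb_sum gamma_div beta_dec
    beta_cvg rho_inc rholo0 rho_bnd Mlo1 gamma_ratio c0 thetaE Mhi_lt (iter w)
    (lams0^~ w) h1 h2).
- apply: main => w h1 h2.
  exact: (lagrangian_pointwise_rate bA bT g_pcl f_pcl gT_pcl h_pcl smooth Cwc sub_ne
    sub_bnd h_lip sad gamma01 beta0 zeta_sum g2b_sum gb_sum gamma_div beta_dec
    beta_cvg rho_inc rholo0 rho_bnd Mlo1 gamma_ratio c0 thetaE Mhi_lt (iter w)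
    (lams0^~ w) h1 h2).
split; [|split].
- apply: main => w h1 h2.
  exact: (lagrangian_ergodic_rate bA bT g_pcl f_pcl gT_pcl h_pcl smooth Cwc sub_ne
    sub_bnd h_lip sad gamma01 beta0 zeta_sum g2b_sum gb_sum gamma_div beta_dec
    beta_cvg rho_inc rholo0 rho_bnd Mlo1 gamma_ratio c0 thetaE Mhi_lt (iter w)
    (lams0^~ w) h1 h2).
- move=> xs uxs; apply: main => w h1 h2.
  exact: (unique_weak_convergence bA bT g_pcl f_pcl gT_pcl h_pcl smooth Cwc sub_ne
    sub_bnd h_lip sad gamma01 beta0 zeta_sum g2b_sum gb_sum gamma_div beta_dec
    beta_cvg rho_inc rholo0 rho_bnd Mlo1 gamma_ratio c0 thetaE Mhi_lt (iter w)
    (lams0^~ w) h1 h2 uxs).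
- move=> xs psi pxs uc; apply: main => w h1 h2.
  exact: (uniformly_convex_convergence bA bT g_pcl f_pcl gT_pcl h_pcl smooth Cwc sub_ne
    sub_bnd h_lip sad gamma01 beta0 zeta_sum g2b_sum gb_sum gamma_div beta_dec
    beta_cvg rho_inc rholo0 rho_bnd Mlo1 gamma_ratio c0 thetaE Mhi_lt (iter w)
    (lams0^~ w) h1 h2 pxs uc).
Qed.
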